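(* For any nonnegative integers $g$ and $h$ there exist $2$-connected factor-critical equimatchable graphs $G$ and $\tilde G$ such that $G$ has orientable genus $g$ and at least $4\lfloor\sqrt{2g}\rfloor+5$ vertices, and $\tilde G$ has nonorientable genus $h$ and at least $4\lfloor\sqrt h\rfloor+5$ vertices.
   Context: Graphs are finite and simple. $G$ is factor-critical if $G-w$ has a perfect matching for every vertex $w$; equimatchable if every maximal matching is maximum. Orientable (nonorientable) genus of a graph is the minimum genus of an orientable (nonorientable) surface in which it cellularly embeds. *)

(* Defs.v *)
From mathcomp Require Import all_boot all_fingroup all_order all_algebra.
Set Implicit Arguments.
Unset Strict Implicit.
Unset Printing Implicit Defensive.

Record sgraph := SGraph {
  svertex :> finType;
  adj : rel svertex;
  adj_sym : symmetric adj;
  adj_irr : irreflexive adj }.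

Arguments adj {s}.

Section Deletion.
Variables (G : sgraph) (w : G).

Definition del_adj : rel {x : G | x != w} := fun x y => adj (val x) (val y).

Lemma del_adj_sym : symmetric del_adj.
Proof. by move=> x y; exact: adj_sym. Qed.

Lemma del_adj_irr : irreflexive del_adj.
Proof. by move=> x; exact: adj_irr. Qed.

Definition del_vertex : sgraph := SGraph del_adj_sym del_adj_irr.

End Deletion.

Definition connected_graph (G : sgraph) : Prop :=
  0 < #|G| /\ forall u v : G, connect adj u v.

Definition two_connected (G : sgraph) : Prop :=
  [/\ 2 < #|G|, connected_graph G & forall w : G, connected_graph (del_vertex w)].

Section Matchings.
Variable G : sgraph.

Definition edges : {set {set G}} :=
  [set [set d.1; d.2] | d : G * G & adj d.1 d.2].

Definition matching (M : {set {set G}}) : bool :=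
  (M \subset edges) && trivIset M.

Definition perfect_matching (M : {set {set G}}) : bool :=
  matching M && (cover M == [set: G]).

Definition maximal_matching (M : {set {set G}}) : bool := maxset matching M.

Definition maximum_matching (M : {set {set G}}) : bool :=
  matching M && [forall M' : {set {set G}}, matching M' ==> (#|M'| <= #|M|)].

Definition equimatchable : Prop :=
  forall M : {set {set G}}, maximal_matching M -> maximum_matching M.

End Matchings.

Definition factor_critical (G : sgraph) : Prop :=
  forall w : G, exists M, perfect_matching (G := del_vertex w) M.

(* Cellular embeddings of a connected graph in closed surfaces, up to
   homeomorphism, are given combinatorially by embedding schemes (rotation
   systems with signatures): a cyclic order of the edge ends at every vertex,
   taken with respect to a local orientation chosen there, together with the set
   of edges along which the local orientations at the two ends disagree. *)
Section Embeddings.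
Variable G : sgraph.

(* (u, v) stands for the edge uv leaving u. *)
Definition dart := {d : G * G | adj d.1 d.2}.

Definition tail (d : dart) : G := (val d).1.
Definition head (d : dart) : G := (val d).2.

Lemma flip_proof (d : dart) : adj (head d) (tail d).
Proof. by rewrite adj_sym; exact: (valP d). Qed.

Definition flip (d : dart) : dart :=
  exist (fun p : G * G => adj p.1 p.2) (head d, tail d) (flip_proof d).

(* rot_cyclic: the cycles of rot are exactly the sets of darts leaving a common
   vertex.  The values of twisted on nonadjacent pairs are irrelevant. *)
Record embedding := Embedding {
  rot : {perm dart};
  rot_cyclic : forall d d' : dart, (d' \in porbit rot d) = (tail d == tail d');
  twisted : rel G;
  twisted_sym : symmetric twisted }.

Variable E : embedding.

(* Face tracing.  In a state (d, b) the walk is about to traverse d, and b says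
   whether it currently reads rotations against the local orientation. *)
Definition face_step (x : dart * bool) : dart * bool :=
  let: (d, b) := x in
  let b' := b (+) twisted E (tail d) (head d) in
  ((if b' then (rot E)^-1%g else rot E) (flip d), b').

(* Every facial walk is traced in its two directions by two distinct orbits of
   face_step, hence the halving; maxn accounts for the single face of the
   one-vertex graph, which has no dart. *)
Definition nfaces : nat := maxn 1 (fcard face_step predT)./2.

Definition euler_char : int := (#|G|%:Z - #|edges G|%:Z + nfaces%:Z)%R.

(* The local orientations at the vertices can be reversed at some vertices (those
   where o is true) so that they agree along every edge. *)
Definition orientable : Prop :=
  exists o : G -> bool,
    forall u v : G, adj u v -> twisted E u v = o u (+) o v.

End Embeddings.

(* Cellular embeddability in the orientable surface with g handles. *)
Definition embeds_orientable (G : sgraph) (g : nat) : Prop :=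
  connected_graph G /\
  exists E : embedding G, orientable E /\ euler_char E = (2 - (2 * g)%:Z)%R.

(* Cellular embeddability in the nonorientable surface with h crosscaps; by the
   usual convention h = 0 denotes the sphere, so that planar graphs have
   nonorientable genus 0. *)
Definition embeds_nonorientable (G : sgraph) (h : nat) : Prop :=
  connected_graph G /\
  exists E : embedding G,
    (if h == 0 then orientable E else ~ orientable E) /\
    euler_char E = (2 - h%:Z)%R.

Definition least (P : nat -> Prop) (n : nat) : Prop :=
  P n /\ forall m, P m -> n <= m.

Definition has_orientable_genus (G : sgraph) (g : nat) : Prop :=
  least (embeds_orientable G) g.

Definition has_nonorientable_genus (G : sgraph) (h : nat) : Prop :=
  least (embeds_nonorientable G) h.

(* Main.v *)
Require Import Defs.
From mathcomp Require Import all_boot all_fingroup all_order all_algebra.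
From mathcomp Require Import zify.
From Stdlib Require Import Classical FunctionalExtensionality Btauto.
From Stdlib Require PeanoNat.
Import Defs.
Set Implicit Arguments.
Unset Strict Implicit.
Unset Printing Implicit Defensive.

(** Take K_{p+1,p} with classes A, B and K_{q,q} with classes C, D, join a vertex
    v of A to a nonempty subset S of D and another vertex x of A to a nonempty
    subset T of C, and possibly v to x.  Every maximal matching misses exactly one
    vertex and the graph is factor-critical, whatever S and T are.  All triangles
    contain the edge vx, so Euler's formula bounds the genus below, with equality
    when nearly all faces are quadrangles.

    Embeddings are represented by fixed-point free involutions on flags.
    Quadrangulations of the two bipartite blocks come from cyclic sequences of
    perfect matchings in which consecutive ones form a Hamiltonian cycle; joining
    the blocks at v (and x) and adding the edge xa costs at most one face.  Varying
    #|S| or #|T| gives all nonorientable genera between consecutive values of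
    (p, q); in the orientable case one starts from #|S| = 2, #|T| = 1 and adds
    edges one at a time up to S = D, T = C, each raising the genus by at most one. *)

(** * Pairs of fixed-point free involutions *)

(** The order is 2(p + q) + 1, while the genus grows like (p^2 + q^2)/4 in the orientable case and
    twice that in the nonorientable one. For a given genus the order is therefore largest near p =
    q, which is where the square roots come from; around p = q there is enough room for the genus
    intervals of neighbouring pairs (p, q) to cover all integers. In the left block the paired class
    must be even, so the cyclically ordered one is odd: two alternating matchings cannot close up,
    and three are needed. A triangle in their union certifies nonorientability and survives the
    joining. In the orientable case the genus (p-1)(p-2)/4 must be an integer, which restricts p to
    1 and 2 modulo 4. For larger S and T no orientable embedding is written down; a discrete
    intermediate value argument replaces it, with Euler's bound for the full S and T at the far end.
    With flags, vertices and faces alike are cycles of two involutions. Each change of an embedding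
    is a conjugation by a transposition, so the corner map stays a fixed-point free involution, and
    one set of lemmas controls both vertices and faces. *)

Lemma porbit_tperm_out (T : finType) (s : {perm T}) (c d x : T) :
  c \notin porbit s x -> d \notin porbit s x ->
  porbit (tperm c d * s)%g x = porbit s x.
Proof.
move=> cx dx; apply/porbit_setP.
have E k : ((tperm c d * s)%g ^+ k)%g x = (s ^+ k)%g x.
  elim: k => [|k IH]; first by rewrite !expg0.
  rewrite !expgSr !permM IH tpermD //.
    by apply: contraNneq cx => ->; apply: mem_porbit.
  by apply: contraNneq dx => ->; apply: mem_porbit.
by move=> y; apply/porbitP/porbitP => -[i ->]; exists i; rewrite E.
Qed.

Lemma permXS (T : finType) (s : {perm T}) k x : (s ^+ k.+1)%g x = s ((s ^+ k)%g x).
Proof. by rewrite expgSr permM. Qed.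

Lemma permXSr (T : finType) (s : {perm T}) k x : (s ^+ k.+1)%g x = (s ^+ k)%g (s x).
Proof. by rewrite expgS permM. Qed.

Lemma porbit_step (T : finType) (s : {perm T}) x : porbit s (s x) = porbit s x.
Proof. exact: (porbit_perm s 1). Qed.

(** For fixed-point free involutions the components are cycles alternating between pairs of [a] and
    of [b]. They are the vertices of an embedding for [swap_side] and the corner map, its faces for
    [swap_vertex] and the corner map. *)
Definition link (T : finType) (a b : {perm T}) : rel T :=
  fun x y => (y == a x) || (y == b x).

Section Dihedral.
Variables (T : finType) (a b : {perm T}).
Hypotheses (aK : involutive a) (bK : involutive b).
Hypotheses (aF : forall x, a x != x) (bF : forall x, b x != x).
Local Notation r := (a * b)%g.

Lemma link_sym : symmetric (link a b).
Proof.
by move=> x y; rewrite /link -(inv_eq aK) -(inv_eq bK) eq_sym [b y == x]eq_sym.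
Qed.

Lemma link_csym : connect_sym (link a b).
Proof. exact: sym_connect_sym link_sym. Qed.

Lemma rotE x : r x = b (a x).
Proof. by rewrite permM. Qed.

(** [r ^+ k] followed by [b] is a reflection of the dihedral group, conjugate to [a] or to [b]
    according to the parity of [k], hence without fixed points. Passing from [x] to [r x] lowers [k]
    by 2. *)
Lemma rot_reflect k x : (r ^+ k)%g x <> b x.
Proof.
have [n] := ubnP k; elim: n k x => // n IH [|[|k]] x /ltnSE-le.
- by rewrite expg0 perm1 => /eqP; rewrite eq_sym (negbTE (bF x)).
- rewrite expg1 rotE => /(can_inj bK) /eqP; by rewrite (negbTE (aF x)).
rewrite permXS permXSr rotE => /(can_inj bK) H.
apply: (IH k (r x)); first by apply: leq_trans le.
by rewrite -[LHS]aK H rotE bK.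
Qed.

Lemma porbit_b x : b x \notin porbit r x.
Proof. by apply/porbitP => -[k /esym]; apply: rot_reflect. Qed.

Lemma porbit_a x : a x \notin porbit r x.
Proof.
apply/porbitP => -[k /(congr1 r)]; rewrite rotE aK => /esym H.
by apply: (@rot_reflect k.+1 x); rewrite permXS.
Qed.

Lemma porbit_ba x : porbit r (b x) = porbit r (a x).
Proof. by rewrite -(porbit_step r (a x)) rotE aK. Qed.

Lemma porbit_bb x y : (b y \in porbit r (b x)) = (y \in porbit r x).
Proof.
have H k z : b ((r ^+ k)%g z) = (r^-1 ^+ k)%g (b z).
  elim: k z => [|k IH] z; first by rewrite !expg0 !perm1.
  rewrite !permXSr IH; congr (_ _).
  by apply: (@perm_inj _ r); rewrite permKV !rotE bK aK.
apply/idP/idP; last first.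
  by case/porbitP=> k ->; rewrite H -porbitV mem_porbit.
by case/porbitP=> k /(congr1 b); rewrite bK H bK => ->; rewrite -porbitV mem_porbit.
Qed.

Lemma porbit_aa x y : (a y \in porbit r (a x)) = (y \in porbit r x).
Proof.
by rewrite -eq_porbit_mem -!porbit_ba eq_porbit_mem porbit_bb.
Qed.

(** A cycle read in its two directions gives two orbits of [r], those of [f] and of [a f]. *)
Lemma connect_orbit f g : connect (link a b) f g =
  (g \in porbit r f) || (a g \in porbit r f).
Proof.
apply/idP/orP; last first.
  have H k x : connect (link a b) x ((r ^+ k)%g x).
    elim: k x => [|k IH] x; first by rewrite expg0 perm1.
    rewrite permXSr; apply: connect_trans (IH _).
    apply: (@connect_trans _ _ (a x)); apply: connect1; first by rewrite /link eqxx.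
    by rewrite /link rotE eqxx orbT.
  case=> /porbitP[k E]; first by rewrite E.
  rewrite -[g]aK E; apply: connect_trans (H k f) _.
  by apply: connect1; rewrite /link eqxx.
case/connectP=> p pP ->; elim/last_ind: p pP => [|p z IH]; first by left; apply: porbit_id.
rewrite rcons_path last_rcons => /andP[/IH {}IH] /orP[/eqP->|/eqP->].
  by rewrite aK; case: IH; [right|left].
rewrite -!eq_porbit_mem -(porbit_ba (b _)) bK porbit_ba.
by case: IH; rewrite -eq_porbit_mem => ->; [right|left].
Qed.

(** The components are even cycles: [a] and [b] both exchange the two orbits of [r] in a component,
    and the root singles out one of them. *)
Lemma two_coloring : exists col : T -> bool,
  forall x, col (a x) = ~~ col x /\ col (b x) = ~~ col x.
Proof.
pose col x := x \in porbit r (fingraph.root (link a b) x).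
have R x y : connect (link a b) x y -> fingraph.root (link a b) x = fingraph.root (link a b) y.
  by move=> H; apply/eqP; rewrite root_connect //; apply: link_csym.
have rx x : connect (link a b) (fingraph.root (link a b) x) x.
  by rewrite link_csym connect_root.
have Ca x : col (a x) = ~~ col x.
  rewrite /col -(R x); last by apply: connect1; rewrite /link eqxx.
  have := rx x; rewrite connect_orbit; set z := fingraph.root _ _.
  case: (boolP (x \in _)) => [xz _|_ /= -> //].
  rewrite -eq_porbit_mem in xz; rewrite -(eqP xz); exact/negbTE/porbit_a.
exists col => x; split=> //; rewrite -Ca.
rewrite /col -(R x (b x)) -?(R x (a x)); try by apply: connect1; rewrite /link eqxx ?orbT.
by rewrite -!eq_porbit_mem porbit_ba.
Qed.

End Dihedral.

(** * Exchanging the partners of two pairs *)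

Section Repair.
Variables (T : finType) (a b : {perm T}).
Hypotheses (aK : involutive a) (bK : involutive b).
Hypotheses (aF : forall x, a x != x) (bF : forall x, b x != x).
Variables (f h : T).
Hypotheses (hf : h != f) (hbf : h != b f).
Local Notation t := (tperm (b f) h).
(* The pairs {f, b f} and {h, b h} become {f, h} and {b f, b h}. *)
Definition repair : {perm T} := (t * b * t)%g.
Local Notation b' := repair.
Local Notation r := (a * b)%g.

Lemma repairE x : b' x = t (b (t x)).
Proof. by rewrite !permM. Qed.

Lemma repairK : involutive b'.
Proof. by move=> x; rewrite !repairE tpermK bK tpermK. Qed.

Lemma repairF x : b' x != x.
Proof. by rewrite repairE -{2}[x](tpermK (b f) h) (inj_eq perm_inj) bF. Qed.

Lemma repair_f : b' f = h.
Proof. by rewrite repairE (@tpermD _ _ _ f) ?bF // tpermL. Qed.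

Lemma repair_bf : b' (b f) = b h.
Proof. by rewrite repairE tpermL tpermD // 1?eq_sym ?bF // (inj_eq perm_inj). Qed.

Lemma repair_h : b' h = f.
Proof. by rewrite -[LHS](congr1 b' repair_f) repairK. Qed.

Lemma repair_bh : b' (b h) = b f.
Proof. by rewrite -(congr1 b' repair_bf) repairK. Qed.

Lemma repair_out x : x != f -> x != b f -> x != h -> x != b h -> b' x = b x.
Proof.
move=> xf xbf xh xbh; rewrite repairE (@tpermD _ _ _ x) 1?eq_sym // tpermD //.
  by rewrite (inj_eq perm_inj) eq_sym.
by rewrite eq_sym (inv_eq bK).
Qed.

(** Conjugating [b] by a transposition multiplies [r] by two transpositions, and each of these
    changes the number of orbits by one. *)
Lemma repair_rot :
  (a * b' = tperm (a (b f)) (a h) * (tperm (a f) (a (b h)) * r))%g.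
Proof.
apply/permP => x; rewrite !permM.
have Ea c d z : a (tperm c d z) = tperm (a c) (a d) (a z) by apply/inj_tperm/perm_inj.
have Eb c d z : b (tperm c d z) = tperm (b c) (b d) (b z) by apply/inj_tperm/perm_inj.
by rewrite !Ea !aK (Eb f) bK.
Qed.

(** If the two pairs lie on different cycles, the exchange merges them. On a common cycle the
    hypothesis says that [f] and [h] point the same way round, so the exchange reverses a segment
    and the cycle stays whole. *)
Lemma repair_connect x y : b h \notin porbit r f ->
  connect (link a b) x y -> connect (link a b') x y.
Proof.
move=> hO.
have fO : b f \notin porbit r f by apply: porbit_b.
have S := sym_connect_sym (link_sym aK (repairK)).
have eA z : connect (link a b') z (a z) by apply: connect1; rewrite /link eqxx.
have eB z : connect (link a b') z (b' z) by apply: connect1; rewrite /link eqxx orbT.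
(* Up to the first time [r] brings [f] to [f] or [h], the walk uses only pairs that the exchange
   keeps; its last vertex is then [b f] or [b h]. *)
have /ex_minnP[[|k] // /andP[_ kz] kmin] :
    exists k, (0 < k) && ((r ^+ k)%g f \in [:: f; h]).
  exists #[r]%g; rewrite order_gt0 expg_order perm1 inE eqxx //.
have P j : j <= k -> connect (link a b') f ((r ^+ j)%g f).
  elim: j => [|j IH] jk; first by rewrite expg0 perm1.
  apply: connect_trans (IH (ltnW jk)) _; rewrite permXS rotE.
  set z := (r ^+ j)%g f; apply: connect_trans (eA z) _.
  have zS : b (a z) = (r ^+ j.+1)%g f by rewrite permXS rotE.
  rewrite -(@repair_out (a z)) //.
  - by apply: contraNneq fO => E; rewrite -[X in b X \in _]E zS mem_porbit.
  - apply/eqP => E; have := kmin j.+1; rewrite -zS E bK inE eqxx /=.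
    by move=> /(_ isT); rewrite ltnS leqNgt jk.
  - by apply: contraNneq hO => E; rewrite -[X in b X \in _]E zS mem_porbit.
  apply/eqP => E; have := kmin j.+1; rewrite -zS E bK !inE eqxx orbT /=.
  by move=> /(_ isT); rewrite ltnS leqNgt jk.
have fh : connect (link a b') f h by have := eB f; rewrite repair_f.
have fbh : connect (link a b') (b f) (b h) by have := eB (b f); rewrite repair_bf.
have ffb : connect (link a b') f (b f).
  have := connect_trans (P k (leqnn _)) (eA _).
  move: kz; rewrite permXS rotE !inE => /orP[] /eqP /(congr1 b); rewrite bK => ->.
    by [].
  by move=> H; apply: connect_trans H _; rewrite S.
apply: connect_sub => {x y} x y /orP[] /eqP ->; first exact: eA.
have [->//|xf] := eqVneq x f.
have [->|xbf] := eqVneq x (b f); first by rewrite bK S.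
have [->|xh] := eqVneq x h.
  by rewrite S in fh; apply: connect_trans fh _; apply: connect_trans ffb _.
have [->|xbh] := eqVneq x (b h).
  rewrite bK; rewrite S in fbh; apply: connect_trans fbh _.
  by rewrite S in ffb; apply: connect_trans ffb _.
by rewrite -repair_out.
Qed.

Let s1 := (tperm (a f) (a (b h)) * r)%g.

Let count1 : #|porbits s1| + (h \notin porbit r (b f)).*2 = #|porbits r| + 1.
Proof.
have E : (a f \in porbit r (a (b h))) = (h \in porbit r (b f)).
  by rewrite -eq_porbit_mem -!porbit_ba // bK eq_porbit_mem porbit_sym.
rewrite -E (porbits_mul_tperm r (a f) (a (b h))) (inj_eq perm_inj).
by rewrite -(inj_eq (@perm_inj _ b) f) bK eq_sym hbf.
Qed.

Let count2 : #|porbits (a * b')%g| + (a (b f) \notin porbit s1 (a h)).*2 = #|porbits s1| + 1.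
Proof. by rewrite repair_rot porbits_mul_tperm (inj_eq perm_inj) eq_sym hbf. Qed.

Lemma repair_porbits_ge : #|porbits r| <= #|porbits (a * b')%g| + 2.
Proof. by move: count1 count2; case: (_ \notin _); case: (_ \notin _) => /=; lia. Qed.

(** [b f] and [h] lie on one cycle and are met in the same direction: both transpositions cut an
    orbit, so one cycle becomes two. *)
Lemma repair_split : h \in porbit r (b f) -> #|porbits (a * b')%g| = #|porbits r| + 2.
Proof.
move=> hO; have E1 : porbit r (a h) = porbit r (a (b f)).
  by apply/eqP; rewrite eq_porbit_mem porbit_aa.
have E : porbit s1 (a h) = porbit r (a h).
  apply: porbit_tperm_out.
    rewrite -eq_porbit_mem E1 -!porbit_ba // bK eq_porbit_mem.
    exact: porbit_b.
  by rewrite -eq_porbit_mem -(@porbit_ba _ a b aK (b h)) bK eq_porbit_mem porbit_sym porbit_a.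
move: count1 count2; rewrite E hO -eq_porbit_mem E1 eqxx /=; lia.
Qed.

(** [h] avoids both directions of the cycle of [f], so both transpositions join orbits. *)
Lemma repair_merge : h \notin porbit r (b f) -> f \notin porbit r h ->
  #|porbits (a * b')%g| + 2 = #|porbits r|.
Proof.
move=> hO fO.
have E : porbit s1 (a (b f)) = porbit r (a (b f)).
  apply: porbit_tperm_out.
    by rewrite porbit_aa // porbit_sym; apply: porbit_b.
  rewrite -eq_porbit_mem -!porbit_ba // !bK eq_porbit_mem porbit_sym //.
move: count1 count2; rewrite hO porbit_sym E porbit_aa // hO /=; lia.
Qed.

End Repair.

(** * Counting orbits by their lengths *)

Section Orbits.
Variables (T : finType) (f : T -> T).
Hypothesis injf : injective f.

Lemma card_orbit_sum (A B : {pred T}) : fclosed f A ->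
  #|predI A B| = \sum_(x | froots f x && (x \in A)) #|predI (fconnect f x) B|.
Proof.
move=> Acl; have S := fconnect_sym injf.
rewrite -sum1_card (partition_big (froot f) (fun x => froots f x && (x \in A))) /=; last first.
  move=> x /andP[xA _]; rewrite roots_root //=.
  by rewrite -(closed_connect Acl (connect_root _ x)).
apply: eq_bigr => r /andP[rr rA]; rewrite sum1dep_card.
apply: eq_card => x; rewrite !inE -(eqP (rr : fingraph.root _ r == r)) root_connect //.
rewrite (eqP (rr : fingraph.root _ r == r)) S andbAC; congr (_ && _); apply: andb_idl.
by move=> /(closed_connect Acl) E; move: rA; rewrite E.
Qed.

Lemma card_closed_order (A : {pred T}) : fclosed f A ->
  #|A| = \sum_(x | froots f x && (x \in A)) fingraph.order f x.
Proof.
move=> Acl; rewrite -(eq_card (_ : predI A predT =i A)) ?(card_orbit_sum _ Acl); last first.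
  by move=> x; rewrite !inE andbT.
by apply: eq_bigr => x _; apply: eq_card => y; rewrite !inE andbT.
Qed.

Lemma card_leq_fcard (A : {pred T}) k : fclosed f A ->
  {in A, forall x, fingraph.order f x <= k} -> #|A| <= k * fcard f A.
Proof.
move=> Acl le; rewrite (card_closed_order Acl) mulnC -sum_nat_const.
by apply: leq_sum => x /andP[_ xA]; apply: le.
Qed.

(** Elements of [B] make up for what an orbit lacks to length [k]. It serves with [k = 4] and [B]
    the states on the edge vx, where short faces are triangles. *)
Lemma fcard_leq_card (A B : {pred T}) k : fclosed f A ->
  {in A, forall x, k <= fingraph.order f x + #|predI (fconnect f x) B|} ->
  k * fcard f A <= #|A| + #|predI A B|.
Proof.
move=> Acl ge; rewrite (card_closed_order Acl) (card_orbit_sum _ Acl) -big_split.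
rewrite mulnC -sum_nat_const.
by apply: leq_sum => x /andP[_ xA]; apply: ge.
Qed.

End Orbits.

Lemma order_leq (T : finType) (f : T -> T) x k : injective f ->
  0 < k -> iter k f x = x -> fingraph.order f x <= k.
Proof.
move=> injf; case: k => // k _ H.
have := @order_le_cycle _ f (traject f x k.+1) _ x.
rewrite size_traject; apply; last by rewrite trajectS inE eqxx.
rewrite trajectS /= -[x in rcons _ x]H iterSr -trajectSr; exact: fpath_traject.
Qed.

Lemma fconnect_porbit (T : finType) (s : {perm T}) x y : fconnect s x y = (y \in porbit s x).
Proof.
apply/idP/porbitP => [/iter_findex <-|[i ->]].
  by exists (findex s x y); rewrite permX.
by rewrite permX fconnect_iter.
Qed.

Lemma card_porbits_fcard (T : finType) (s : {perm T}) : #|porbits s| = fcard s T.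
Proof.
have S := fconnect_sym (@perm_inj _ s).
have -> : porbits s = [set porbit s x | x in froots s].
  apply/setP=> O; apply/imsetP/imsetP => -[x xA ->]; last by exists x.
  exists (froot s x); first exact: roots_root.
  by apply/eqP; rewrite eq_porbit_mem porbit_sym -fconnect_porbit connect_root.
rewrite card_in_imset; first by apply: eq_card => x; rewrite !inE andbT.
move=> x y /eqP rx /eqP ry /eqP; rewrite eq_porbit_mem -fconnect_porbit -root_connect //.
by rewrite rx ry eq_sym => /eqP.
Qed.

(** * Flags and embeddings *)

Section Flags.
Variable V : finType.

(* (u, w, s) is one of the two sides of the edge uw near u.  All pairs (u, w) are
   kept, so that the type does not depend on the graph; the term u == w makes
   swap_vertex fixed point free. *)
Definition flag := (V * V * bool)%type.

Definition turn_edge (f : flag) : flag := (f.1.2, f.1.1, f.2 (+) (f.1.1 == f.1.2)).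

Lemma turn_edgeK : involutive turn_edge.
Proof. by case=> [[u w] s]; rewrite /turn_edge /= [w == u]eq_sym addbK. Qed.

Definition swap_vertex : {perm flag} := perm (inv_inj turn_edgeK).

Definition turn_side (f : flag) : flag := (f.1, ~~ f.2).

Lemma turn_sideK : involutive turn_side.
Proof. by case=> d s; rewrite /turn_side /= negbK. Qed.

Definition swap_side : {perm flag} := perm (inv_inj turn_sideK).

Local Notation th0 := swap_vertex.
Local Notation th2 := swap_side.

Lemma th0E f : th0 f = turn_edge f. Proof. by rewrite permE. Qed.
Lemma th2E f : th2 f = turn_side f. Proof. by rewrite permE. Qed.

Lemma th0K : involutive th0.
Proof. by move=> f; rewrite !th0E turn_edgeK. Qed.

Lemma th2K : involutive th2.
Proof. by move=> f; rewrite !th2E turn_sideK. Qed.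

Lemma th0F f : th0 f != f.
Proof.
case: f => [[u w] s]; rewrite th0E /turn_edge /=; apply/eqP => -[-> _].
by rewrite eqxx addbT; case: s.
Qed.

Lemma th2F f : th2 f != f.
Proof. by rewrite th2E; apply/eqP => /(congr1 snd) /=; case: (f.2). Qed.

Definition tl (f : flag) : V := f.1.1.

Variable e : rel V.
Hypotheses (e_sym : symmetric e) (e_irr : irreflexive e).

Definition on (f : flag) := e f.1.1 f.1.2.

Lemma on0 f : on (th0 f) = on f.
Proof. by rewrite th0E /on /= e_sym. Qed.

Lemma on2 f : on (th2 f) = on f.
Proof. by rewrite th2E. Qed.

Variable th : {perm flag}.

(* th exchanges the two flags at each corner of the embedding, so every face
   gives two orbits of swap_vertex * th, one for each direction. *)
Record corners : Prop := Corners {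
  cornerK : involutive th;
  cornerF : forall f, th f != f;
  corner_tl : forall f, tl (th f) = tl f;
  corner_out : forall f, ~~ on f -> th f = th2 f }.

Hypothesis C : corners.

Lemma on_corner f : on (th f) = on f.
Proof.
have H g : ~~ on g -> ~~ on (th g) by move=> ng; rewrite (corner_out C) // on2.
case: (boolP (on f)) => [h|/H/negbTE //].
by apply: contraLR h => /H; rewrite (cornerK C).
Qed.

Local Notation r := (th0 * th)%g.

Lemma rE f : r f = th (th0 f). Proof. by rewrite permM. Qed.

Lemma on_closed : fclosed r on.
Proof. by move=> f g /eqP <-; rewrite -!topredE /= rE on_corner on0. Qed.

(** Flags off the graph contribute a known number of orbits: fixed points for the pairs (u, u),
    orbits of length two for the other nonadjacent pairs. Thus orbits may be counted on all flags, a
    type that stays the same when edges are added. *)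
Lemma porbits_darts :
  #|porbits r| + #|[pred p : V * V | e p.1 p.2]| = fcard r on + #|V| * #|V| + #|V|.
Proof.
have rI := @perm_inj _ r.
pose dg := [pred f : flag | f.1.1 == f.1.2].
pose off := [pred f : flag | ~~ on f & f.1.1 != f.1.2].
have rout f : ~~ on f -> r f = th2 (th0 f) by move=> nf; rewrite rE (corner_out C) ?on0.
have rdg f : dg f -> r f = f.
  move=> /eqP E; rewrite rout; last by rewrite /on E e_irr.
  by case: f E => [[u w] s] /= ->; rewrite th0E th2E /turn_side /turn_edge /= eqxx addbT negbK.
have roff f : off f -> r f = (f.1.2, f.1.1, ~~ f.2).
  move=> /andP[nf /negbTE E]; rewrite rout // th0E th2E /turn_side /turn_edge /=.
  by rewrite E addbF.
have cl_dg : fclosed r dg.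
  by apply: intro_closed => [|f g /eqP <- fd]; [apply: fconnect_sym | rewrite rdg].
have cl_off : fclosed r off.
  apply: intro_closed => [|f g /eqP <- fo]; first exact: fconnect_sym.
  rewrite (roff _ fo) inE; case/andP: fo => nf E.
  by rewrite /on e_sym nf /= eq_sym.
have o1 : fcard r dg * 1 = #|dg|.
  apply: fcard_order_set cl_dg; first exact: rI.
  apply/subsetP => f fd; rewrite inE eqn_leq fingraph.order_gt0 andbT.
  by apply: order_leq => //; apply: rdg.
have o2 : fcard r off * 2 = #|off|.
  apply: fcard_order_set cl_off; first exact: rI.
  apply/subsetP => f fo; rewrite inE eqn_leq order_leq //=; last first.
    have go : off (r f) by rewrite (roff _ fo) inE /on e_sym /= eq_sym.
    by rewrite (roff _ go) (roff _ fo) /= negbK -!surjective_pairing.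
  rewrite ltnNge; apply/negP => le1.
  have : fconnect r f (r f) by apply: fconnect1.
  have o1' : fingraph.order r f = 1 by apply/eqP; rewrite eqn_leq le1 fingraph.order_gt0.
  rewrite fconnect_orbit /fingraph.orbit o1' inE => /eqP.
  by rewrite roff // => /(congr1 snd) /=; case: (f.2).
have cdg : #|dg| = 2 * #|V|.
  rewrite -card_bool mulnC -cardsT -[#|{:bool}|]cardsT -cardsX.
  have inj : injective (fun p : V * bool => (p.1, p.1, p.2) : flag).
    by move=> [u s] [w t] [-> _ ->].
  rewrite -(card_imset _ inj); apply: eq_card => -[[u w] s]; rewrite !inE /=.
  apply/eqP/imsetP => [->|[[x t] _ [-> -> _]] //].
  by exists (w, s); rewrite ?inE.
have con : #|[pred f : flag | on f]| = 2 * #|[pred p : V * V | e p.1 p.2]|.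
  rewrite -card_bool mulnC -cardX; apply: eq_card => -[[u w] s].
  by rewrite !inE andbT.
have tot : #|{: flag}| = #|V| * #|V| * 2 by rewrite !card_prod card_bool.
have nT : fcard r predT = fcard r on + (fcard r dg + fcard r off).
  rewrite (n_compC on); congr (_ + _); rewrite /n_comp_mem.
  rewrite -(cardID dg); congr (_ + _); apply: eq_card => f; rewrite !inE /= -?andbA.
    have [E|_] := eqVneq f.1.1 f.1.2; last by rewrite !andbF.
    by have -> : f \notin on by rewrite -topredE /= /on E e_irr.
  by case: (f.1.1 == f.1.2); rewrite /= ?andbF ?andbT.
have cT : #|{: flag}| = #|[pred f : flag | on f]| + (#|dg| + #|off|).
  rewrite -(cardC [pred f : flag | on f]); congr (_ + _).
  rewrite -(cardID dg); congr (_ + _); apply: eq_card => f; rewrite !inE /=.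
    by apply: andb_idl => /eqP E; rewrite /on E e_irr.
  by rewrite andbC.
move: nT; rewrite card_porbits_fcard => ->.
move: cT; rewrite tot con cdg => cT; lia.
Qed.

End Flags.

(** The corners at a vertex form a single cycle, so no vertex is a pinch point. *)
Definition linked_at (V : finType) (e : rel V) (th : {perm flag V}) :=
  forall f g, on e f -> on e g -> tl f = tl g -> connect (link (swap_side V) th) f g.

(** Such a colouring is an orientation of the surface. *)
Definition flips_on (V : finType) (e : rel V) (th : {perm flag V}) (col : flag V -> bool) :=
  forall f, on e f ->
  [/\ col (swap_vertex V f) = ~~ col f, col (swap_side V f) = ~~ col f & col (th f) = ~~ col f].

Lemma fcard_image (T T' : finType) (f : T -> T) (g : T' -> T') (h : T -> T') (A : {pred T'}) :
  injective f -> injective g -> injective h -> (forall x, h (f x) = g (h x)) ->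
  fclosed g A -> (forall y, (y \in A) = (y \in codom h)) -> fcard f T = fcard g A.
Proof.
move=> fI gI hI E cl AE.
have adj : fun_adjunction h g f A.
  apply: strict_adjunction => //; first exact: fconnect_sym.
    by apply/subsetP => y; rewrite AE.
  by move=> x y _; rewrite /= -E (inj_eq hI).
rewrite (adjunction_n_comp _ (fconnect_sym gI) (fconnect_sym fI) cl adj).
by apply: eq_n_comp_r => x; rewrite !inE AE codom_f.
Qed.

Section FromFlags.
Variables (G : sgraph) (th : {perm flag G}).
Hypothesis C : corners adj th.

Hypothesis L : linked_at adj th.

Lemma embedding_of_flags : exists E : embedding G,
  fcard (face_step E) predT = fcard (swap_vertex G * th)%g (on adj) /\
  (orientable E <-> exists col, flips_on adj th col).
Proof.
have [col colP] := two_coloring (@th2K G) (cornerK C) (@th2F G) (cornerF C).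
have col2 f : col (swap_side G f) = ~~ col f by case: (colP f).
have colth f : col (th f) = ~~ col f by case: (colP f).
pose fl (d : dart G) (c : bool) : flag G := (val d, col (val d, false) (+) c).
have col_side p s : col (p, s) = col (p, false) (+) s.
  by case: s; rewrite ?addbF // addbT -col2 th2E.
have col_fl d c : col (fl d c) = c by rewrite col_side addKb.
have on_fl d c : on adj (fl d c) by rewrite /on /=; exact: (valP d).
have flP (f : flag G) (H : on adj f) : f = fl (exist _ f.1 H) (col f).
  by case: f H => p s H; rewrite /fl /= [col (p, s)]col_side addKb.
have fl_inj d d' c c' : fl d c = fl d' c' -> d = d' /\ c = c'.
  move=> E; split; first by apply: val_inj; case: E.
  by rewrite -(col_fl d c) E col_fl.
have onth f : on adj f -> on adj (th f) by rewrite (on_corner C).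
pose rotf d : dart G := exist _ (th (fl d false)).1 (onth _ (on_fl d false)).
have rotfE d : th (fl d false) = fl (rotf d) true.
  by rewrite [LHS](flP _ (onth _ (on_fl d false))) colth col_fl.
have rotf_inj : injective rotf.
  move=> d d' E; have := rotfE d; rewrite E -rotfE => /perm_inj.
  by case/fl_inj.
pose rt := perm rotf_inj.
have rtE d : th (fl d false) = fl (rt d) true by rewrite permE.
have rtV d : th (fl d true) = fl ((rt^-1)%g d) false.
  by rewrite -[d in LHS](permKV rt) -rtE (cornerK C).
have tl_fl d c : tl (fl d c) = tail d by [].
have rt_tail d : tail (rt d) = tail d.
  by rewrite -(tl_fl _ true) -rtE (corner_tl C).
pose th2 := swap_side G.
have rtX k d : ((th * th2)%g ^+ k)%g (fl d false) = fl ((rt ^+ k)%g d) false.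
  elim: k => [|k IH]; first by rewrite !expg0 !perm1.
  by rewrite !permXS IH permM rtE th2E /turn_side /fl /= addbT negbK addbF.
have rt_cyc d d' : (d' \in porbit rt d) = (tail d == tail d').
  apply/porbitP/eqP => [[k ->]|E].
    by elim: k => [|k IH]; [rewrite expg0 perm1 | rewrite permXS rt_tail].
  have := L (on_fl d false) (on_fl d' false) E.
  rewrite (eq_connect (_ : _ =2 link th th2)); last first.
    by move=> x y; rewrite /link orbC.
  rewrite (connect_orbit (cornerK C) (@th2K G)).
  have H x : x \in porbit (th * th2)%g (fl d false) -> col x = false.
    by case/porbitP=> k ->; rewrite rtX col_fl.
  case/orP => [/porbitP[k]|/H]; last by rewrite colth col_fl.
  by rewrite rtX => /fl_inj[-> _]; exists k.
pose tw : rel G := fun u w => col (u, w, false) == col (w, u, false).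
have tw_sym : symmetric tw by move=> u w; rewrite /tw eq_sym.
pose E := Embedding rt_cyc tw_sym; exists E.
have th0_fl d c : swap_vertex G (fl d c) =
   fl (flip d) (~~ c (+) tw (tail d) (head d)).
  case: d => [[u w] uw]; rewrite th0E /turn_edge /fl /=.
  have -> : (u == w) = false by apply/eqP => H; move: (uw); rewrite /= H adj_irr.
  rewrite addbF /tw /tail /head /=; congr (_, _, _).
  by case: (col _); case: (col _); case: c.
split.
  (* The negation accounts for the order of the moves: [face_step] flips the dart, and the corner
     step that follows turns colour [b'] into its opposite. *)
  pose psi (x : dart G * bool) := fl x.1 (~~ x.2).
  have psi_inj : injective psi.
    by move=> [d b] [d' b'] /fl_inj /= [-> /(congr1 negb)]; rewrite !negbK => ->.
  have step x : psi (face_step E x) = (swap_vertex G * th)%g (psi x).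
    case: x => d b; rewrite permM /psi /= th0_fl negbK.
    by case: (b (+) _); rewrite ?rtV ?rtE.
  have fsI : injective (face_step E).
    by move=> x y H; apply: psi_inj; apply: (@perm_inj _ (swap_vertex G * th)%g); rewrite -!step H.
  apply: (fcard_image fsI (@perm_inj _ _) psi_inj step).
    exact: (on_closed (@adj_sym G) C).
  move=> f; rewrite -topredE /=; apply/idP/codomP => [H|[x ->]]; last exact: on_fl.
  by exists (exist _ f.1 H, ~~ col f); rewrite /psi /= negbK; exact: flP.
split=> [[o oP]|[c cP]].
  exists (fun f => col f (+) o (tl f)) => f Hf.
  have tl2 : tl (swap_side G f) = tl f by rewrite th2E.
  rewrite col2 colth (corner_tl C) tl2 !addNb; split=> //.
  have oP' u w : adj u w -> tw u w = o u (+) o w := oP u w.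
  rewrite (flP _ Hf) th0_fl !col_fl !tl_fl oP' //.
  by rewrite /tail /head /=; case: (col f); case: (o _); case: (o _).
(* Around a vertex both [col] and [c] change at every step, so their sum is constant and tells
   whether to reverse that vertex. The default [false] concerns isolated vertices only. *)
exists (fun u => if [pick f | on adj f && (tl f == u)] is Some f then col f (+) c f else false).
have const f g : connect (link th2 th) f g -> on adj f -> col f (+) c f = col g (+) c g.
  case/connectP=> p pP ->; elim: p f pP => //= z p IH f /andP[/orP[]/eqP-> pz] Hf.
    rewrite -IH // ?on2 // col2; case: (cP _ Hf) => _ -> _; by rewrite addbN addNb negbK.
  rewrite -IH // ?(on_corner C) // colth; case: (cP _ Hf) => _ _ ->; by rewrite addbN addNb negbK.
have oE f : on adj f -> (if [pick g | on adj g && (tl g == tl f)] is Some g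
     then col g (+) c g else false) = col f (+) c f.
  move=> Hf; case: pickP => [g /andP[Hg /eqP E']|/(_ f)]; last by rewrite Hf eqxx.
  by apply: (const _ _ _ Hg); apply: L.
move=> u w uw; have Hf : on adj (u, w, false) by [].
have Hf' : on adj (w, u, false) by rewrite /on /= adj_sym.
rewrite -[u in X in X (+) _]/(tl (u, w, false)) -[w in X in _ (+) X]/(tl (w, u, false)).
rewrite (oE _ Hf) (oE _ Hf') /= /tw.
have [H _ _] := cP _ Hf; move: H; rewrite th0E /turn_edge /=.
have -> : (u == w) = false by apply/eqP => H; move: uw; rewrite H adj_irr.
by move=> /= ->; case: (col _); case: (col _); case: (c _).
Qed.

End FromFlags.

(** * Rerouting corners and adding edges *)

Section Surgery.
Variable V : finType.
Implicit Types (e : rel V) (th : {perm flag V}).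
Local Notation th0 := (swap_vertex V).
Local Notation th2 := (swap_side V).

Lemma tl2 (f : flag V) : tl (th2 f) = tl f.
Proof. by rewrite th2E. Qed.

Lemma repair_tl th f h : (forall x, tl (th x) = tl x) -> tl f = tl h ->
  forall x, tl (repair th f h x) = tl x.
Proof.
move=> T fh x; rewrite repairE.
have E y : tl (tperm (th f) h y) = tl y by case: tpermP => // ->; rewrite T.
by rewrite E T E.
Qed.

Lemma porbit_closed (T : finType) (s : {perm T}) (A : {pred T}) x y :
  (forall z, z \in A -> s z \in A) -> x \in A -> y \in porbit s x -> y \in A.
Proof.
move=> cl xA /porbitP[k ->]; elim: k => [|k IH]; first by rewrite expg0 perm1.
by rewrite permXS cl.
Qed.

Lemma porbit_on e th f g : symmetric e -> corners e th ->
  g \in porbit (th0 * th)%g f -> on e f -> on e g.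
Proof.
move=> S C gO fo; apply: (porbit_closed (A := on e) _ fo gO) => z zo.
by rewrite -topredE /= permM (on_corner C) (on0 S).
Qed.

Lemma porbit_on2 e th f g : corners e th ->
  g \in porbit (th2 * th)%g f -> on e f -> on e g.
Proof.
move=> C gO fo; apply: (porbit_closed (A := on e) _ fo gO) => z zo.
by rewrite -topredE /= permM (on_corner C) on2.
Qed.

Lemma repair_corners e th f h : corners e th -> tl f = tl h -> on e f -> on e h ->
  h != f -> h != th f -> corners e (repair th f h).
Proof.
move=> C fh fo ho hf hf'; split.
- exact: repairK (cornerK C) _ _.
- exact: repairF (cornerF C) _ _.
- exact: repair_tl (corner_tl C) fh.
move=> x xo; have H y : on e y -> x != y by move=> yo; apply: contraNneq xo => ->.
by rewrite (repair_out (cornerK C)) ?H ?(on_corner C) // (corner_out C).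
Qed.

Definition add_edge e u w : rel V :=
  [rel x y | [|| e x y, (x == u) && (y == w) | (x == w) && (y == u)]].

Lemma add_edge_sym e u w : symmetric e -> symmetric (add_edge e u w).
Proof.
move=> S x y; rewrite /add_edge /= S; congr (_ || _).
by rewrite orbC; congr (_ || _); rewrite andbC.
Qed.

Lemma add_edge_irr e u w : irreflexive e -> u != w -> irreflexive (add_edge e u w).
Proof.
move=> I uw x; rewrite /add_edge /= I /=; apply/negbTE; rewrite negb_or !negb_and.
by have [->|] := eqVneq x u; rewrite ?uw ?orbT.
Qed.

Section Insert.
Variables (e : rel V) (th : {perm flag V}) (u w : V).
Hypotheses (S : symmetric e) (C : corners e th) (uw : u != w) (nuw : ~~ e u w).
Variables (f g : flag V) (s1 s2 : bool).
Hypotheses (fo : on e f) (go : on e g) (fu : tl f = u) (gw : tl g = w).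
Let h : flag V := (u, w, s1).
Let k : flag V := (w, u, s2).
Let ho : ~~ on e h. Proof. by []. Qed.
Let ko : ~~ on e k. Proof. by rewrite /on /= S. Qed.

(* The end at u of the new edge is put into the corner {f, th f}, the end at w
   into the corner {g, th g}; s1 and s2 fix its sides. *)
Definition insert_half := repair th f h.
Definition insert := repair insert_half g k.

Lemma insert_hf : h != f. Proof. by apply: contraNneq ho => ->. Qed.
Lemma insert_hf' : h != th f.
Proof. by apply: contraNneq ho => ->; rewrite (on_corner C). Qed.

Lemma half_out x : tl x != u -> insert_half x = th x.
Proof.
move=> xu; have H y : tl y = u -> x != y by move=> yu; apply: contraNneq xu => ->; apply/eqP.
by rewrite /insert_half (repair_out (cornerK C)) ?H ?(corner_tl C).
Qed.

Let gu : tl g != u. Proof. by rewrite gw eq_sym. Qed.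
Let ku : tl k != u. Proof. by rewrite eq_sym. Qed.

Lemma insert_kg : k != g. Proof. by apply: contraNneq ko => ->. Qed.
Lemma insert_kg' : k != insert_half g.
Proof. by rewrite half_out //; apply: contraNneq ko => ->; rewrite (on_corner C). Qed.

Lemma half_K : involutive insert_half.
Proof. exact: repairK (cornerK C) _ _. Qed.
Lemma half_F x : insert_half x != x.
Proof. exact: repairF (cornerF C) _ _ _. Qed.
Lemma half_tl x : tl (insert_half x) = tl x.
Proof. by apply: (repair_tl (corner_tl C)); rewrite fu. Qed.

Lemma half_on x : on (add_edge e u w) (insert_half x) = on (add_edge e u w) x.
Proof.
have H y : on (add_edge e u w) y -> on (add_edge e u w) (insert_half y).
  have sub z : on e z -> on (add_edge e u w) z by rewrite /on /add_edge /= => ->.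
  have hO : on (add_edge e u w) h by rewrite /on /add_edge /= !eqxx orbT.
  rewrite /insert_half.
  have [->|yf] := eqVneq y f; first by rewrite (repair_f (cornerF C) insert_hf).
  have [->|yf'] := eqVneq y (th f).
    by rewrite (repair_bf (cornerF C) insert_hf) (corner_out C ho) on2 => _.
  have [->|yh] := eqVneq y h.
    by rewrite (repair_h (cornerK C) (cornerF C) insert_hf) => _; apply: sub.
  have [->|yh'] := eqVneq y (th h).
    rewrite (repair_bh (cornerK C) (cornerF C) insert_hf) => _; apply: sub.
    by rewrite (on_corner C).
  rewrite (repair_out (cornerK C)) //.
  case: (boolP (on e y)) => yo; first by move=> _; apply: sub; rewrite (on_corner C).
  by rewrite (corner_out C) // on2.
by apply/idP/idP => [/H|/H //]; rewrite half_K.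
Qed.

Lemma insert_corners : corners (add_edge e u w) insert.
Proof.
have gk : tl g = tl k by rewrite gw.
split.
- exact: repairK half_K _ _.
- exact: repairF half_F _ _.
- exact: repair_tl half_tl gk.
move=> x xo.
have xg y : on (add_edge e u w) y -> x != y by move=> yo; apply: contraNneq xo => ->.
have sub z : on e z -> on (add_edge e u w) z by rewrite /on /add_edge /= => ->.
have kO : on (add_edge e u w) k by rewrite /on /add_edge /= !eqxx !orbT.
have hO : on (add_edge e u w) h by rewrite /on /add_edge /= !eqxx orbT.
rewrite /insert (repair_out half_K) ?xg ?half_on //; try exact: sub.
rewrite /insert_half (repair_out (cornerK C)) ?xg ?(corner_out C ho) ?on2 //.
- by rewrite (corner_out C) //; apply: contra xo => /sub.
- exact: sub.
- by apply: sub; rewrite (on_corner C).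
Qed.

Hypothesis L : linked_at e th.

Lemma half_connect x y : connect (link th2 th) x y -> connect (link th2 insert_half) x y.
Proof.
apply: (repair_connect (@th2K V) (cornerK C) (@th2F V) (cornerF C) insert_hf).
by apply: contra ho => /(porbit_on2 C) /(_ fo); rewrite (on_corner C).
Qed.

Lemma insert_connect x y : connect (link th2 th) x y -> connect (link th2 insert) x y.
Proof.
move=> /half_connect.
apply: (repair_connect (@th2K V) half_K (@th2F V) half_F insert_kg).
rewrite half_out // (corner_out C) //; apply: contra ko => H.
rewrite -on2.
have : th2 k \in [pred x | on e x & tl x == w].
  apply: porbit_closed H; last by rewrite inE go gw eqxx.
  move=> z /andP[zo /eqP zw]; have zu : tl (th2 z) != u by rewrite tl2 zw eq_sym.
  by rewrite permM half_out // inE (on_corner C) on2 zo (corner_tl C) tl2 zw eqxx.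
by case/andP.
Qed.

Lemma insert_f : insert f = h.
Proof.
rewrite /insert (repair_out half_K); first by rewrite /insert_half (repair_f (cornerF C) insert_hf).
all: by apply/eqP => /(congr1 (@tl V)) /eqP; rewrite ?half_tl fu ?gw; exact/negP.
Qed.

Lemma insert_linked : linked_at (add_edge e u w) insert.
Proof.
have Sy : connect_sym (link th2 insert).
  apply: sym_connect_sym; apply: link_sym; first exact: th2K.
  exact: repairK half_K _ _.
have l2 x : connect (link th2 insert) x (th2 x) by apply: connect1; rewrite /link eqxx.
have li x : connect (link th2 insert) x (insert x) by apply: connect1; rewrite /link eqxx orbT.
have side a b s s' : connect (link th2 insert) (a, b, s) (a, b, s').
  have [->//|/eqP E] := eqVneq s s'.
  by have := l2 (a, b, s); rewrite th2E /turn_side /=; case: s s' E => [] [].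
have H x : on (add_edge e u w) x ->
    exists2 y, on e y & tl y = tl x /\ connect (link th2 insert) x y.
  case: (boolP (on e x)) => xo; first by exists x.
  case: x xo => [[x y] s] xo; rewrite /on /add_edge /= in xo *; rewrite (negbTE xo) /=.
  case/orP=> /andP[/eqP-> /eqP->]; [exists f|exists g] => //; split=> //; rewrite Sy.
    apply: (connect_trans _ (side u w s1 s)).
    by have := li f; rewrite insert_f.
  apply: (connect_trans _ (side w u s2 s)).
  by have := li g; rewrite /insert (repair_f half_F insert_kg).
move=> x y /H[x' x'o [tx cx]] /H[y' y'o [ty cy]] xy.
apply: connect_trans cx _; rewrite Sy; apply: connect_trans cy _.
by apply: insert_connect; apply: L => //; rewrite tx ty.
Qed.

(** The flags of the new edge form orbits of their own as long as the edge is absent, so putting in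
    its first end always merges two faces. *)
Lemma half_porbits : #|porbits (th0 * insert_half)%g| + 2 = #|porbits (th0 * th)%g|.
Proof.
apply: (repair_merge (@th0K V) (cornerK C) (@th0F V) (cornerF C) insert_hf insert_hf').
  by apply: contra ho => /(porbit_on S C); apply; rewrite (on_corner C).
by rewrite porbit_sym; apply: contra ho => /(porbit_on S C); apply.
Qed.

(** The second end falls into the face that already contains the first and cuts it. The count over
    all flags is restored, which by [porbits_darts] means one more face of the graph. *)
Lemma insert_split : k \in porbit (th0 * insert_half)%g (th g) ->
  #|porbits (th0 * insert)%g| = #|porbits (th0 * th)%g|.
Proof.
rewrite -half_porbits -half_out // => H.
exact: (repair_split (@th0K V) half_K (@th0F V) half_F insert_kg insert_kg' H).
Qed.

End Insert.
End Surgery.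

Lemma card_edges (G : sgraph) : 2 * #|edges G| = #|[pred p : G * G | adj p.1 p.2]|.
Proof.
rewrite -[RHS]sum1_card (partition_big (fun p => [set p.1; p.2]) [in edges G]) /=; last first.
  by move=> p pa; apply/imsetP; exists p => //; rewrite inE.
rewrite mulnC -sum_nat_const; apply: eq_bigr => e /imsetP[[u w] /= uw ->].
rewrite sum1dep_card -[LHS](_ : #|[set (u, w); (w, u)]| = 2); last first.
  rewrite cards2; case: eqVneq uw => // -[-> _]; by rewrite inE /= adj_irr.
apply: eq_card => -[x y]; rewrite !inE /= !xpair_eqE.
have uw' : adj u w by move: uw; rewrite inE.
apply/orP/andP => [[]/andP[/eqP-> /eqP->]|[xy /eqP E]]; rewrite ?eqxx ?uw' //.
  by rewrite adj_sym uw' setUC eqxx.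
have xuw : x \in [set u; w] by rewrite -E set21.
have yuw : y \in [set u; w] by rewrite -E set22.
have nxy : x != y by apply: contraTneq xy => ->; rewrite adj_irr.
move: xuw yuw nxy; rewrite !inE.
by do 2![case/orP=> /eqP->]; rewrite ?eqxx; [| left | right |].
Qed.

(** The two directions of one face are distinct orbits. Hence the [maxn 1] in [nfaces] has no effect
    once there is an edge. *)
Lemma fcard_on_gt1 (V : finType) (e : rel V) (th : {perm flag V}) f :
  symmetric e -> corners e th -> on e f -> 1 < fcard (swap_vertex V * th)%g (on e).
Proof.
move=> S C fo; have cl := on_closed S C.
apply/(fcard_gt1P (@perm_inj _ _) cl).
exists f => //; exists (swap_vertex V f); first by rewrite -topredE /= on0.
rewrite fconnect_porbit; apply: porbit_a; try exact: th0K; try exact: th0F.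
  exact: cornerK C.
exact: cornerF C.
Qed.

(** * From orientable embeddings to flags *)

Section ToFlags.
Variables (G : sgraph) (E : embedding G) (o : G -> bool).
Hypothesis oP : forall u v : G, adj u v -> twisted E u v = o u (+) o v.

Lemma flags_of_embedding : exists th : {perm flag G},
  [/\ corners adj th, linked_at adj th, exists col, flips_on adj th col &
      fcard (face_step E) predT = fcard (swap_vertex G * th)%g (on adj)].
Proof.
pose rt := rot E.
(* Reversing the rotation where [o] holds makes all local orientations agree; a flag of colour [c]
   then turns forwards or backwards according to [c]. *)
pose sg (c : bool) (d : dart G) : dart G := if o (tail d) (+) c then (rt^-1)%g d else rt d.
have rtt d : tail (rt d) = tail d.
  by apply/eqP; rewrite eq_sym -(rot_cyclic E) (mem_porbit _ 1).
have rtV d : tail ((rt^-1)%g d) = tail d by rewrite -[d in RHS](permKV rt) rtt.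
have sgt c d : tail (sg c d) = tail d by rewrite /sg; case: (_ (+) _).
have sgK c d : sg (~~ c) (sg c d) = d.
  by rewrite {1}/sg sgt /sg addbN; case: (o _ (+) c); rewrite /= ?permK ?permKV.
(* [swap_vertex] keeps the side while the colour has to change along an edge. An arbitrary order of
   the vertices breaks the symmetry between the two ends. *)
pose kp (p : G * G) := (enum_rank p.1 < enum_rank p.2).
have kpC u w : u != w -> kp (w, u) = ~~ kp (u, w).
  move=> uw; rewrite /kp /= -leqNgt ltn_neqAle; apply: andb_idl => _.
  by apply: contraNneq uw => /val_inj /enum_rank_inj ->.
pose col (f : flag G) := f.2 (+) kp f.1.
pose fl (d : dart G) (c : bool) : flag G := (val d, c (+) kp (val d)).
have col_fl d c : col (fl d c) = c by rewrite /col /fl /= addbK.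
have on_fl d c : on adj (fl d c) by exact: (valP d).
pose tf (f : flag G) : flag G :=
  if insub f.1 is Some d then fl (sg (col f) d) (~~ col f) else turn_side f.
have tf_fl d c : tf (fl d c) = fl (sg c d) (~~ c) by rewrite /tf valK col_fl.
have flP f : on adj f -> exists d, f = fl d (col f).
  case: f => p s fo; exists (exist _ p fo); by rewrite /fl /col /= addbK.
have tf_out f : ~~ on adj f -> tf f = turn_side f by move=> fo; rewrite /tf insubN.
have tfK : involutive tf.
  move=> f; case: (boolP (on adj f)) => fo.
    by have [d Ed] := flP f fo; rewrite {1}Ed !tf_fl sgK negbK -Ed.
  by rewrite !tf_out ?turn_sideK // tf_out.
pose th := perm (can_inj tfK).
have th_fl d c : th (fl d c) = fl (sg c d) (~~ c) by rewrite permE tf_fl.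
have C : corners adj th.
  split.
  - by move=> f; rewrite !permE tfK.
  - move=> f; case: (boolP (on adj f)) => fo.
      have [d Ed] := flP f fo; rewrite {1}Ed th_fl; apply/eqP => /(congr1 col).
      by rewrite col_fl; case: (col f).
    by rewrite permE tf_out // -th2E th2F.
  - move=> f; case: (boolP (on adj f)) => fo; last by rewrite permE tf_out.
    by have [d Ed] := flP f fo; rewrite {1}Ed th_fl [in RHS]Ed /tl /= -/(tail _) sgt.
  by move=> f fo; rewrite permE tf_out // th2E.
have th2_fl d c : swap_side G (fl d c) = fl d (~~ c).
  by rewrite th2E /turn_side /fl /= addNb.
have L2 d c c' : connect (link (swap_side G) th) (fl d c) (fl d c').
  have [->//|/eqP cc'] := eqVneq c c'.
  by apply: connect1; rewrite /link th2_fl; case: c c' cc' => [] [] // _; rewrite eqxx.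
have Lr d c c' : connect (link (swap_side G) th) (fl d c) (fl (rt d) c').
  pose b := o (tail d).
  apply: connect_trans (L2 d c b) _; apply: connect_trans (L2 (rt d) (~~ b) c').
  by apply: connect1; rewrite /link th_fl /sg -/b addbb eqxx orbT.
have L : linked_at adj th.
  move=> f g fo go; have [d ->] := flP f fo; have [d' ->] := flP g go.
  rewrite /tl /= -/(tail d) -/(tail d') => /eqP; rewrite -(rot_cyclic E).
  case/porbitP => k ->; elim: k d {fo} (col f) => [|k IH] d c; first by rewrite expg0 perm1.
  by rewrite permXSr; apply: connect_trans (Lr d c c) (IH _ _).
have th0_fl d c : swap_vertex G (fl d c) = fl (flip d) (~~ c).
  case: d => [[u w] uw]; rewrite th0E /turn_edge /fl /=.
  have E' : (u == w) = false by apply/eqP => H; move: (uw); rewrite /= H adj_irr.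
  by rewrite E' addbF (kpC u w) ?E' // addbN addNb negbK.
exists th; split=> //.
  exists col => f fo; have [d Ed] := flP f fo.
  by rewrite {1 3 5}Ed th0_fl th2_fl th_fl !col_fl.
pose psi (x : dart G * bool) := fl x.1 (~~ (x.2 (+) o (tail x.1))).
have fl_inj d d' c c' : fl d c = fl d' c' -> d = d' /\ c = c'.
  move=> E'; split; first by apply: val_inj; case: E'.
  by rewrite -(col_fl d c) E' col_fl.
have psi_inj : injective psi.
  move=> [d b] [d' b'] /fl_inj /= [-> /(congr1 negb)]; rewrite !negbK => /(congr1 (addb^~ (o (tail d')))).
  by rewrite !addbK => ->.
have step x : psi (face_step E x) = (swap_vertex G * th)%g (psi x).
  case: x => d b; rewrite permM /psi /= th0_fl negbK th_fl.
  have -> : twisted E (tail d) (head d) = o (tail d) (+) o (head d) by apply: oP; exact: (valP d).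
  set c := b (+) o (tail d).
  have -> : b (+) (o (tail d) (+) o (head d)) = c (+) o (head d) by rewrite addbA.
  rewrite -/rt; have -> : (if c (+) o (head d) then (rt^-1)%g else rt) (flip d) = sg c (flip d).
    by rewrite /sg /= -/(head d) addbC; case: (_ (+) _).
  by rewrite sgt /= -/(head d) addbK.
have fsI : injective (face_step E).
  by move=> x y H; apply: psi_inj; apply: (@perm_inj _ (swap_vertex G * th)%g); rewrite -!step H.
apply: (fcard_image fsI (@perm_inj _ _) psi_inj step).
  exact: (on_closed (@adj_sym G) C).
move=> f; rewrite -topredE /=; apply/idP/codomP => [H|[x ->]]; last exact: on_fl.
have [d Ed] := flP f H; exists (d, ~~ (col f (+) o (tail d))).
by rewrite /psi /= addNb addbK negbK.
Qed.
End ToFlags.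

(** * Genus under the addition of an edge *)

Section AddEdge.
Variables (V : finType) (e : rel V) (es : symmetric e) (ei : irreflexive e).
Variables (u w : V) (uw : u != w) (nuw : ~~ e u w).
Local Notation e' := (add_edge e u w).
Local Notation es' := (add_edge_sym u w es).
Local Notation ei' := (add_edge_irr ei uw).

(** Since [h] and [f] differ in colour, [b f] and [h] agree, and conjugation by their transposition
    respects the colouring. *)
Lemma repair_flips (T : finType) (b : {perm T}) (f h : T) (A : {pred T}) (col : T -> bool) :
  (forall x, (b x \in A) = (x \in A)) -> {in A, forall x, col (b x) = ~~ col x} ->
  f \in A -> h \in A -> col h = ~~ col f -> {in A, forall x, col (repair b f h x) = ~~ col x}.
Proof.
move=> bA bc fA hA hf x xA; rewrite repairE.
have ct y : col (tperm (b f) h y) = col y by case: tpermP => // ->; rewrite hf bc.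
rewrite ct bc ?ct //; by case: tpermP => // _; rewrite ?bA.
Qed.

Lemma card_add_edge :
  #|[pred p : V * V | e' p.1 p.2]| = #|[pred p : V * V | e p.1 p.2]| + 2.
Proof.
rewrite addnC -[2](_ : #|[set (u, w); (w, u)]| = 2); last first.
  by rewrite cards2 xpair_eqE negb_and uw.
rewrite -cardsE -[X in _ + X]cardsE -cardsUI.
rewrite [X in _ + X](_ : _ = 0) ?addn0.
  by apply: eq_card => -[x y]; rewrite !inE /add_edge /= !xpair_eqE orbC.
apply/eqP; rewrite cards_eq0; apply/eqP/setP => -[x y]; rewrite !inE !xpair_eqE.
apply/negbTE/negP => /andP[/orP[]/andP[/eqP-> /eqP->]]; first exact/negP.
by rewrite es; exact/negP.
Qed.

(** The sides [~~ col f] and [col g] are those that give the new end opposite colours to [f] at [u]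
    and to [g] at [w]. *)
Lemma insert_flips th f g col : corners e th -> flips_on e th col ->
  on e f -> on e g -> tl f = u -> tl g = w ->
  exists2 col', flips_on e' (insert_half th u w f (~~ col f)) col' &
    flips_on e' (insert th u w f g (~~ col f) (col g)) col'.
Proof.
move=> C colP fo go fu gw.
pose col' (x : flag V) := if on e x then col x else x.2 (+) (tl x == w).
set s1 := ~~ col f; set s2 := col g.
pose h : flag V := (u, w, s1); pose k : flag V := (w, u, s2).
pose th1 := insert_half th u w f s1.
pose th' := insert th u w f g s1 s2.
have sub x : on e x -> on e' x by rewrite /on /add_edge /= => ->.
have hO : on e' h by rewrite /on /add_edge /= !eqxx orbT.
have kO : on e' k by rewrite /on /add_edge /= !eqxx !orbT.
have nk : ~~ on e k by rewrite /on /= es.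
have thO x : (th x \in on e') = (x \in on e').
  rewrite -!topredE /=; case: (boolP (on e x)) => xo.
    by rewrite !sub // (on_corner C).
  by rewrite (corner_out C) // on2.
have thc : {in on e', forall x, col' (th x) = ~~ col' x}.
  move=> x _; rewrite /col' (on_corner C); case: ifP => xo; first by case: (colP x xo).
  by rewrite (corner_out C) ?xo // th2E /turn_side /tl /= addNb.
have th1c : {in on e', forall x, col' (th1 x) = ~~ col' x}.
  apply: repair_flips => //; first by rewrite -topredE; apply: sub.
  by rewrite /col' fo (negbTE nuw : on e h = false) /= (negbTE uw) addbF.
have th1O x : (th1 x \in on e') = (x \in on e').
  by rewrite -!topredE /= half_on.
have th'c : {in on e', forall x, col' (th' x) = ~~ col' x}.
  apply: repair_flips => //; first by rewrite -topredE; apply: sub.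
  by rewrite /col' go (negbTE nk) /= eqxx addbT.
have c0 x : on e' x -> col' (swap_vertex V x) = ~~ col' x.
  rewrite /col' on0 //; case: ifP => xo; first by case: (colP x xo).
  case: x xo => [[a b] s]; rewrite /on /add_edge /= => -> /=.
  rewrite th0E /turn_edge /tl /=.
  by case/orP=> /andP[/eqP-> /eqP->]; rewrite ?(negbTE uw) ?(eq_sym w u) ?(negbTE uw) eqxx
    !addbF addbT ?negbK.
have c2 x : col' (swap_side V x) = ~~ col' x.
  rewrite /col' on2; case: ifP => xo'; first by case: (colP x xo').
  by rewrite th2E /turn_side /tl /= addNb.
by exists col' => x xo; split; [exact: c0| |exact: th1c|exact: c0| |exact: th'c].
Qed.

(** The first end of the edge merges two faces; the second splits a face or merges two again. The
    remaining possibility, an unchanged number of faces, would put flags of different colours on one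
    orbit. So the Euler characteristic stays or drops by 2. *)
Lemma embeds_add_edge m : (exists z, e u z) -> (exists z, e w z) ->
  connected_graph (SGraph es' ei') ->
  embeds_orientable (SGraph es ei) m ->
  exists2 m', m' <= m.+1 & embeds_orientable (SGraph es' ei') m'.
Proof.
move=> [zu uzu] [zw wzw] conn [_ [E [[o oP] chi]]].
have [th [C L [col colP] cE]] := flags_of_embedding oP.
have {}C : corners e th := C.
have {}L : linked_at e th := L.
pose f : flag V := (u, zu, false); pose g : flag V := (w, zw, false).
have fo : on e f := uzu.
have go : on e g := wzw.
pose s1 := ~~ col f; pose s2 := col g.
pose h : flag V := (u, w, s1); pose k : flag V := (w, u, s2).
pose th1 := insert_half th u w f s1.
pose th' := insert th u w f g s1 s2.
have sub x : on e x -> on e' x by rewrite /on /add_edge /= => ->.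
have hO : on e' h by rewrite /on /add_edge /= !eqxx orbT.
have kO : on e' k by rewrite /on /add_edge /= !eqxx !orbT.
have nk : ~~ on e k by rewrite /on /= es.
have C' : corners e' th' by apply: insert_corners.
have L' : linked_at e' th' by apply: insert_linked.
have [col' col1 col2] := insert_flips C colP fo go erefl erefl.
have th1O x : (th1 x \in on e') = (x \in on e').
  by rewrite -!topredE /= half_on.
have [E' [cE' orE']] := @embedding_of_flags (SGraph es' ei') th' C' L'.
have {}orE' : orientable E'.
  by apply/orE'; exists col'.
have X := porbits_darts es ei C.
have X' := porbits_darts es' ei' C'.
have X1 : #|porbits (swap_vertex V * th1)%g| + 2 = #|porbits (swap_vertex V * th)%g|.
  by apply: (half_porbits es).
have X2 : #|porbits (swap_vertex V * th')%g| = #|porbits (swap_vertex V * th1)%g| + 2 \/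
   #|porbits (swap_vertex V * th')%g| + 2 = #|porbits (swap_vertex V * th1)%g|.
  have K1 := half_K u w C f s1; have F1 := half_F u w C f s1.
  have kg := insert_kg es nuw s2 go.
  have kg' : k != th1 g by apply: insert_kg'.
  case: (boolP (k \in porbit (swap_vertex V * th1)%g (th1 g))) => [H|H]; [left|right].
    exact: (repair_split (@th0K V) K1 (@th0F V) F1 kg kg' H).
  apply: (repair_merge (@th0K V) K1 (@th0F V) F1 kg kg' H); apply/negP => H'.
  have : g \in [pred x | on e' x & col' x == col' k].
    apply: porbit_closed H'; last by rewrite inE kO eqxx.
    move=> x /andP[xo /eqP xc]; rewrite permM inE.
    have x0 : on e' (swap_vertex V x) by rewrite (on0 es').
    have := th1O (swap_vertex V x); rewrite -!topredE /= x0 => -> /=.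
    by have [_ _ ->] := col1 _ x0; have [-> _ _] := col1 _ xo; rewrite negbK xc.
  have gk : col' g = ~~ col' k.
    by have [_ _] := col2 g (sub _ go); rewrite (repair_f F1 kg) => ->; rewrite negbK.
  by case/andP=> _ /=; rewrite gk; case: (col' k).
have D' := card_add_edge.
have ce := @card_edges (SGraph es ei); have ce' := @card_edges (SGraph es' ei').
have g1 := fcard_on_gt1 es C fo; have g1' := fcard_on_gt1 es' C' (sub _ fo).
have nfE : nfaces E = (fcard (face_step E) predT)./2 by rewrite /nfaces; apply/maxn_idPr; rewrite cE half_gt0.
have nfE' : nfaces E' = (fcard (face_step E') predT)./2 by rewrite /nfaces; apply/maxn_idPr; rewrite cE' half_gt0.
have nf : nfaces E' = nfaces E + 1 \/ nfaces E' + 1 = nfaces E.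
  rewrite nfE nfE' cE cE'; move: X X' X1 X2 D' g1 g1'; clear.
  rewrite /=; set a := fcard _ _; set b := fcard _ _; lia.
have chi' : euler_char E' = euler_char E \/ (euler_char E' = euler_char E - 2)%R.
  rewrite /euler_char /=; move: nf ce ce' D'; clear.
  rewrite /=; lia.
case: chi' => chi'; [exists m => // |exists m.+1 => //]; split=> //; exists E'; split=> //; rewrite chi' chi //.
by clear; lia.
Qed.

End AddEdge.

(** Edges are added as long as the next graph still embeds in genus at most [g]. When it does not,
    the present graph has no embedding below [g], since one edge raises the genus by at most one;
    its known embedding then has genus exactly [g]. *)
Lemma orientable_genus_interpolation (V : finType) (Q : rel V -> Prop) (g : nat) :
  (forall e (es : symmetric e) (ei : irreflexive e), Q e -> connected_graph (SGraph es ei)) ->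
  (forall e (es : symmetric e) (ei : irreflexive e), Q e ->
    (forall m, embeds_orientable (SGraph es ei) m -> g <= m) \/
    exists u w, [/\ u != w, ~~ e u w, exists z, e u z, exists z, e w z & Q (add_edge e u w)]) ->
  forall e (es : symmetric e) (ei : irreflexive e) m,
  Q e -> m <= g -> embeds_orientable (SGraph es ei) m ->
  exists e' (es' : symmetric e') (ei' : irreflexive e'),
    Q e' /\ has_orientable_genus (SGraph es' ei') g.
Proof.
move=> conn step e; have [n] := ubnP #|[pred p : V * V | ~~ e p.1 p.2]|.
elim: n e => // n IH e /ltnSE-le es ei m Qe mg em.
case: (step e es ei Qe) => [full|[u [w [uw nuw ezu ezw Q']]]].
  exists e, es, ei; split=> //; split=> //.
  by have -> : g = m by apply/eqP; rewrite eqn_leq mg full.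
pose es' := add_edge_sym u w es; pose ei' := add_edge_irr ei uw.
case: (classic (exists2 m', m' <= g & embeds_orientable (SGraph es' ei') m')).
  case=> m' m'g em'; apply: (IH _ _ es' ei' m') => //; apply: leq_trans le.
  apply: proper_card; apply/properP; split.
    by apply/subsetP => -[x y]; rewrite !inE /add_edge /= !negb_or => /andP[].
  by exists (u, w); rewrite !inE /add_edge /= ?eqxx ?orbT.
move=> no; exists e, es, ei; split=> //.
have ge k : embeds_orientable (SGraph es ei) k -> g <= k.
  move=> ek; rewrite leqNgt; apply/negP => kg; apply: no.
  have [m' m'k em'] := embeds_add_edge (uw := uw) nuw ezu ezw (conn _ _ _ Q') ek.
  by exists m' => //; apply: leq_trans kg.
by split=> //; have -> : g = m by apply/eqP; rewrite eqn_leq mg ge.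
Qed.

(** * Faces and triangles *)

Section FaceBound.
Variables (G : sgraph) (E : embedding G) (v x : G).
Hypothesis deg2 : forall u w : G, adj u w -> exists2 w', adj u w' & w' != w.
Hypothesis triangles : forall a b c : G, adj a b -> adj b c -> adj c a ->
  has (fun d => (d == (v, x)) || (d == (x, v))) [:: (a, b); (b, c); (c, a)].

Lemma flipK : involutive (@flip G).
Proof. by case=> [[u w] uw]; apply: val_inj. Qed.

Lemma face_step_inj : injective (face_step E).
Proof.
move=> [d b] [d' b'] /=; set c := b (+) _; set c' := b' (+) _ => -[H cc].
move: H; rewrite -cc => /perm_inj /(can_inj flipK) H; move: cc; rewrite /c /c' H.
by move=> /addIb ->.
Qed.

Lemma tail_face_step y : tail (face_step E y).1 = head y.1.
Proof.
case: y => d b /=; apply/eqP; rewrite eq_sym -[head d]/(tail (flip d)) -(rot_cyclic E).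
case: (_ (+) _); last exact: (mem_porbit (rot E) 1).
by rewrite -porbitV; apply: (mem_porbit (rot E)^-1 1).
Qed.

(** A facial walk turns back only at a vertex of degree one. *)
Lemma face_step_turn y : (face_step E y).1 != flip y.1.
Proof.
case: y => d b /=; apply/eqP => H.
have {}H : rot E (flip d) = flip d.
  by move: H; case: (_ (+) _) => // H; rewrite -[X in rot E X]H permKV.
have [w' w'a w'd] := deg2 (valP (flip d)).
have : (exist _ (head d, w') w'a : dart G) \in porbit (rot E) (flip d).
  by rewrite rot_cyclic.
case/porbitP => k; rewrite (_ : (rot E ^+ k)%g (flip d) = flip d); last first.
  by elim: k => [|k IH]; rewrite ?expg0 ?perm1 // permXS IH.
by case=> E'; rewrite E' eqxx in w'd.
Qed.

(* A face traced in at most three steps is a triangle, hence uses one of the four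
   states on the edge vx. *)
Lemma fcard_face_step : fcard (face_step E) predT <= #|edges G| + adj v x.
Proof.
pose B := [pred y : dart G * bool | (val y.1 == (v, x)) || (val y.1 == (x, v))].
have cl : fclosed (face_step E) predT by [].
have dartE (d : dart G) : val d = (tail d, head d) by rewrite /tail /head; case: (val d).
have nl (d : dart G) : tail d != head d.
  by apply/eqP => H; have := valP d; rewrite /= -/(tail d) -/(head d) H adj_irr.
have B2 : #|predI predT B| <= 4 * adj v x.
  case: (boolP (adj v x)) => vx; last first.
    rewrite muln0 leqn0; apply/eqP/eq_card0 => y; rewrite !inE /=.
    apply/negbTE; apply: contra vx => /orP[] /eqP H; have := valP y.1; rewrite /= H //=.
    by rewrite adj_sym.
  have xv : adj x v by rewrite adj_sym.
  pose d1 : dart G := exist _ (v, x) vx; pose d2 : dart G := exist _ (x, v) xv.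
  apply: leq_trans (_ : #|[:: (d1, true); (d1, false); (d2, true); (d2, false)]| <= _); last exact: card_size.
  apply/subset_leq_card/subsetP => -[d b]; rewrite !inE /= => /orP[]/eqP H.
    by rewrite (_ : d = d1); [case: b; rewrite eqxx ?orbT | apply: val_inj].
  by rewrite (_ : d = d2); [case: b; rewrite eqxx ?orbT | apply: val_inj].
have := fcard_leq_card (k := 4) (B := B) face_step_inj cl.
have -> : #|{: dart G * bool}| = 4 * #|edges G|.
  rewrite (_ : 4 = 2 * 2) // -mulnA card_edges card_prod card_bool mulnC; congr (_ * _).
  by rewrite card_sig; apply: eq_card => p; rewrite !inE.
move=> H; rewrite -(leq_pmul2l (isT : 0 < 4)) mulnDr.
apply: leq_trans (H _) _; last by rewrite leq_add2l.
move=> y _; have := iter_order face_step_inj y; set n := fingraph.order _ _ => yn.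
have n0 : 0 < n by apply: fingraph.order_gt0.
have t1 := tail_face_step y; have t2 := tail_face_step (face_step E y).
have t3 := tail_face_step (face_step E (face_step E y)).
case: n n0 yn => [|[|[|[|n]]]] //= _ yn.
- by have := nl y.1; rewrite -t1 yn eqxx.
- have := face_step_turn y; rewrite (_ : (_ == _)) //; apply/eqP; apply: val_inj => /=.
  by rewrite dartE t1 -t2 yn.
set y1 := face_step E y in yn t1 t2 t3 *; set y2 := face_step E y1 in yn t2 t3 *.
apply: (@leq_trans (3 + 1)) => //; rewrite leq_add2l; apply/card_gt0P.
have yv (z : dart G * bool) : val z.1 = (tail z.1, head z.1) := dartE z.1.
have a0 := valP y.1; have a1 := valP y1.1; have a2 := valP y2.1.
rewrite /= !yv /= in a0 a1 a2; rewrite t1 in a1; rewrite t2 in a2; move: t3; rewrite yn => t3.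
rewrite -t3 in a2.
have c1 : fconnect (face_step E) y y1 by exact: fconnect1.
have c2 : fconnect (face_step E) y y2 by apply: connect_trans c1 (fconnect1 _ _).
have := triangles a0 a1 a2; rewrite /= orbF => /orP[K|/orP[K|K]]; [exists y|exists y1|exists y2].
- by rewrite !inE connect0 /= yv.
- by rewrite !inE c1 /= yv t1.
- by rewrite !inE c2 /= yv t2 -t3.
Qed.

End FaceBound.

(** * Matchings and the graphs *)

Section Matchings.
Variable G : sgraph.

Definition matchable (X : {set G}) := exists2 M, matching M & cover M = X.

Lemma card_edge (e : {set G}) : e \in edges G -> #|e| = 2.
Proof.
case/imsetP=> -[u w]; rewrite inE /= => uw ->; rewrite cards2.
by case: eqVneq uw => // ->; rewrite adj_irr.
Qed.

Lemma card_cover_matching (M : {set {set G}}) : matching M -> #|cover M| = 2 * #|M|.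
Proof.
case/andP=> /subsetP sub /eqP <-; rewrite mulnC -sum_nat_const.
by apply: eq_bigr => e /sub /card_edge.
Qed.

Lemma matchableU (X Y : {set G}) : matchable X -> matchable Y -> [disjoint X & Y] ->
  matchable (X :|: Y).
Proof.
move=> [M /andP[sM tM] <-] [N /andP[sN tN] <-] dj; exists (M :|: N).
  by rewrite /matching subUset sM sN trivIsetU.
by rewrite /cover bigcup_setU.
Qed.

Lemma matchable0 : matchable set0.
Proof.
exists set0; last by rewrite /cover big_set0.
by rewrite /matching sub0set; apply/trivIsetP => A B; rewrite inE.
Qed.

Lemma matchable_edge u w : adj u w -> matchable [set u; w].
Proof.
move=> uw; exists [set [set u; w]]; last by rewrite /cover big_set1.
rewrite /matching sub1set; apply/andP; split; last first.
  by apply/trivIsetP => A B; rewrite !inE => /eqP-> /eqP->; rewrite eqxx.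
by apply/imsetP; exists (u, w); rewrite ?inE.
Qed.

Lemma matchable_bip (X Y : {set G}) : [disjoint X & Y] -> #|X| = #|Y| ->
  (forall x y, x \in X -> y \in Y -> adj x y) -> matchable (X :|: Y).
Proof.
have [n] := ubnP #|X|; elim: n X Y => // n IH X Y /ltnSE-le dj cXY XY.
have [X0|[x xX]] := set_0Vmem X.
  move: cXY; rewrite X0 cards0 => /esym/eqP; rewrite cards_eq0 => /eqP ->.
  rewrite set0U; exact: matchable0.
have [y yY] : exists y, y \in Y.
  by apply/set0Pn; rewrite -card_gt0 -cXY card_gt0; apply/set0Pn; exists x.
have cX := cardsD1 x X; have cY := cardsD1 y Y; rewrite xX in cX; rewrite yY in cY.
have -> : X :|: Y = (X :\ x :|: Y :\ y) :|: [set x; y].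
  apply/setP => z; rewrite !inE.
  have [->|_] := eqVneq z x; first by rewrite xX orbT.
  by have [->|_] := eqVneq z y; rewrite ?yY /= ?orbT ?orbF.
have yX : y \notin X by apply/negP => yX; rewrite (disjointFr dj yX) in yY.
have xY : x \notin Y by rewrite (disjointFr dj xX).
apply: matchableU.
- apply: IH; [lia| | lia |].
    apply: (disjointWl (subsetDl _ _)); apply: disjointWr dj; exact: subsetDl.
  by move=> a b /setD1P[_ aX] /setD1P[_ bY]; apply: XY.
- by apply: matchable_edge; apply: XY.
rewrite -setI_eq0; apply/eqP/setP => z; rewrite !inE; apply/negbTE/negP.
case/andP=> H /orP[]/eqP E; move: H; rewrite E eqxx ?(negbTE xY) ?(negbTE yX) /= ?andbF //.
Qed.

Lemma factor_critical_of_matchable :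
  (forall w : G, matchable (~: [set w])) -> factor_critical G.
Proof.
move=> H w; have [M /andP[/subsetP sM tM] cM] := H w.
pose pre (e : {set G}) : {set del_vertex w} := [set u | val u \in e].
have alive (e : {set G}) u : e \in M -> u \in e -> u != w.
  move=> eM ue; have : u \in cover M by apply/bigcupP; exists e.
  by rewrite cM !inE.
exists [set pre e | e in M]; rewrite /perfect_matching /matching -andbA; apply/and3P; split.
- apply/subsetP => _ /imsetP[e eM ->].
  have /imsetP[[a b]] := sM _ eM; rewrite inE /= => ab Ee.
  have aw : a != w by apply: (alive e) => //; rewrite Ee set21.
  have bw : b != w by apply: (alive e) => //; rewrite Ee set22.
  apply/imsetP; exists (exist _ a aw, exist _ b bw); first by rewrite inE.
  by apply/setP => u; rewrite !inE Ee !inE.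
- apply/trivIsetP => _ _ /imsetP[e eM ->] /imsetP[e' e'M ->] ne.
  have {}ne : e != e' by apply: contraNneq ne => ->.
  have := trivIsetP tM _ _ eM e'M ne; rewrite -!setI_eq0 => /eqP dj.
  apply/eqP/setP => u; have /setP/(_ (val u)) := dj; by rewrite !inE.
apply/eqP/setP => u; rewrite inE; apply/bigcupP.
have : val u \in cover M by rewrite cM !inE (valP u).
case/bigcupP=> e eM ue; exists (pre e); first exact: imset_f.
by rewrite inE.
Qed.

Lemma maximal_uncovered (M : {set {set G}}) u w : maximal_matching M ->
  u \notin cover M -> w \notin cover M -> ~~ adj u w.
Proof.
case/maxsetP=> /andP[sM tM] maxM uM wM; apply/negP => uw.
have eE : [set u; w] \in edges G by apply/imsetP; exists (u, w); rewrite ?inE.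
have dj (e : {set G}) : e \in M -> [disjoint [set u; w] & e].
  move=> eM; rewrite -setI_eq0; apply/eqP/setP => y; rewrite !inE; apply/negbTE/negP.
  case/andP=> /orP[]/eqP-> ye; [case/negP: uM|case/negP: wM]; by apply/bigcupP; exists e.
have : [set u; w] |: M = M.
  apply: maxM; last exact: subsetUr.
  rewrite /matching subUset sub1set eE sM; apply/trivIsetP => A B.
  rewrite !inE => /orP[/eqP->|AM] /orP[/eqP->|BM]; rewrite ?eqxx //.
  - by move=> _; apply: dj.
  - by move=> _; rewrite disjoint_sym; apply: dj.
  exact: (trivIsetP tM).
move=> E; case/negP: uM; apply/bigcupP; exists [set u; w]; last exact: set21.
by rewrite -E setU11.
Qed.

(** A larger matching would cover at least two more vertices, but at most one is left. *)
Lemma equimatchable_of_uncovered :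
  (forall M : {set {set G}}, maximal_matching M -> #|~: cover M| <= 1) -> equimatchable G.
Proof.
move=> H M mM; have := H M mM; case/maxsetP: (mM) => M1 _; rewrite cardsCs setCK => c.
rewrite /maximum_matching M1; apply/forallP => N; apply/implyP => N1.
have := card_cover_matching M1; have := card_cover_matching N1.
have := max_card [in cover N]; move: c; set X := #|cover M|; set Y := #|cover N|.
lia.
Qed.

End Matchings.

Lemma connected_del (G : sgraph) (w : G) :
  0 < #|del_vertex w| ->
  (forall a b : G, a != w -> b != w ->
     connect [rel a b : G | [&& a != w, b != w & adj a b]] a b) ->
  connected_graph (del_vertex w).
Proof.
move=> c0 H; split=> // a b; have /connectP[p] := H _ _ (valP a) (valP b).
elim: p a => [|y p IH] a /=.
  by move=> _ E; rewrite (_ : a = b) //; apply: val_inj.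
case/andP=> /and3P[_ yw ay] pp lp.
by apply: (connect_trans _ (IH (exist _ y yw) pp lp)); apply: connect1.
Qed.

Section Gadget.
Variables (V : finType) (A B C D : {set V}) (v x : V).
Implicit Types (S T : {set V}) (z : bool).

Definition half_gadget S T z : rel V := fun u w =>
  [|| (u \in A) && (w \in B), (u \in C) && (w \in D), (u == v) && (w \in S),
      (u == x) && (w \in T) | [&& z, u == v & w == x]].

Definition gadget S T z : rel V := fun u w => half_gadget S T z u w || half_gadget S T z w u.

Record parts (p q : nat) : Prop := Parts {
  part_cover : forall u, [|| u \in A, u \in B, u \in C | u \in D];
  part_AB : [disjoint A & B]; part_AC : [disjoint A & C]; part_AD : [disjoint A & D];
  part_BC : [disjoint B & C]; part_BD : [disjoint B & D]; part_CD : [disjoint C & D];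
  part_v : v \in A; part_x : x \in A; part_vx : v != x;
  card_A : #|A| = p.+1; card_B : #|B| = p; card_C : #|C| = q; card_D : #|D| = q }.

Lemma gadget_sym S T z : symmetric (gadget S T z).
Proof. by move=> u w; rewrite /gadget orbC. Qed.

Section Parts.
Variables (p q : nat) (P : parts p q).

Lemma classes u :
  [\/ [/\ u \in A, u \in B = false, u \in C = false & u \in D = false],
      [/\ u \in A = false, u \in B, u \in C = false & u \in D = false],
      [/\ u \in A = false, u \in B = false, u \in C & u \in D = false] |
      [/\ u \in A = false, u \in B = false, u \in C = false & u \in D]].
Proof.
case/or4P: (part_cover P u) => h; [constructor 1|constructor 2|constructor 3|constructor 4];
  split=> //.
- exact: disjointFr (part_AB P) h.
- exact: disjointFr (part_AC P) h.
- exact: disjointFr (part_AD P) h.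
- exact: disjointFl (part_AB P) h.
- exact: disjointFr (part_BC P) h.
- exact: disjointFr (part_BD P) h.
- exact: disjointFl (part_AC P) h.
- exact: disjointFl (part_BC P) h.
- exact: disjointFr (part_CD P) h.
- exact: disjointFl (part_AD P) h.
- exact: disjointFl (part_BD P) h.
- exact: disjointFl (part_CD P) h.
Qed.

Lemma class_A u : u \in A -> [/\ u \in A, u \in B = false, u \in C = false & u \in D = false].
Proof. by move=> h; case: (classes u) h => -[] // ->. Qed.

Lemma class_B u : u \in B -> [/\ u \in A = false, u \in B, u \in C = false & u \in D = false].
Proof. by move=> h; case: (classes u) h => -[] // ? ->. Qed.

Lemma class_C u : u \in C -> [/\ u \in A = false, u \in B = false, u \in C & u \in D = false].
Proof. by move=> h; case: (classes u) h => -[] // ? ? ->. Qed.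

Lemma class_D u : u \in D -> [/\ u \in A = false, u \in B = false, u \in C = false & u \in D].
Proof. by move=> h; case: (classes u) h => -[] // ? ? ? ->. Qed.

Variables (S T : {set V}) (z : bool).
Hypotheses (SD : S \subset D) (TC : T \subset C).
Local Notation e := (gadget S T z).

Lemma v_class : [/\ v \in A, v \in B = false, v \in C = false & v \in D = false].
Proof. exact/class_A/(part_v P). Qed.

Lemma x_class : [/\ x \in A, x \in B = false, x \in C = false & x \in D = false].
Proof. exact/class_A/(part_x P). Qed.

Lemma gadget_irr : irreflexive e.
Proof.
move=> u; rewrite /gadget orbb /half_gadget; have vx := part_vx P.
have [vA vB vC vD] := v_class; have [xA xB xC xD] := x_class.
have -> : (u == v) && (u \in S) = false.
  by apply/negbTE/andP => -[/eqP-> /(subsetP SD)]; rewrite vD.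
have -> : (u == x) && (u \in T) = false.
  by apply/negbTE/andP => -[/eqP-> /(subsetP TC)]; rewrite xC.
have -> : (u == v) && (u == x) = false.
  by apply/negbTE/andP => -[/eqP-> /eqP E]; rewrite E eqxx in vx.
by rewrite andbF; case: (classes u) => -[-> -> -> ->].
Qed.

Definition gadget_graph : sgraph := SGraph (gadget_sym S T z) gadget_irr.

Lemma card_gadget : #|gadget_graph| = 2 * p + 2 * q + 1.
Proof.
have -> : #|gadget_graph| = #|A :|: B :|: (C :|: D)|.
  by rewrite -cardsT; apply: eq_card => u; rewrite !inE -orbA; apply/esym/(part_cover P).
rewrite cardsU (_ : _ :&: _ = set0); last first.
  apply/setP => u; rewrite !inE; by case: (classes u) => -[-> -> -> ->].
rewrite cards0 subn0 !cardsU !(disjoint_setI0 (part_AB P)) !(disjoint_setI0 (part_CD P)).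
rewrite !cards0 (card_A P) (card_B P) (card_C P) (card_D P); lia.
Qed.

(** Let s1, ..., s5 count the matching edges of the five kinds. By maximality each block has a fully
    covered class, so |1 - s3 - s4 - 2 s5| + |s3 - s4| vertices are missed. As s3 + s5 and s4 + s5
    are at most 1, this is always 1. *)
Lemma gadget_equimatchable : equimatchable gadget_graph.
Proof.
apply: equimatchable_of_uncovered => M mM.
have ind u w : u \notin cover M -> w \notin cover M -> ~~ e u w := maximal_uncovered mM.
have [/andP[sM tM] _] := maxsetP mM.
pose cnt (X : {set V}) (E : {set V}) := \sum_(u in E) (u \in X).
have cov X : \sum_(E in M) cnt X E = #|cover M :&: X|.
  rewrite /cnt -(big_trivIset _ tM) -sum1_card.
  rewrite [RHS](eq_bigl (fun u => (u \in cover M) && (u \in X))); last by move=> u; rewrite inE.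
  by rewrite -big_mkcondr.
(* t1, ..., t5 tell apart the edges AB, CD, vS, xT and vx. *)
pose t1 E : bool := (cnt A E == 1) && (cnt B E == 1).
pose t2 E : bool := (cnt C E == 1) && (cnt D E == 1).
pose t3 E : bool := (cnt A E == 1) && (cnt D E == 1).
pose t4 E : bool := (cnt A E == 1) && (cnt C E == 1).
pose t5 E : bool := cnt A E == 2.
have [vA vB vC vD] := v_class; have [xA xB xC xD] := x_class.
have edgeP E : E \in M -> [/\ cnt A E = t1 E + t3 E + t4 E + 2 * t5 E, cnt B E = t1 E,
    cnt C E = t2 E + t4 E & cnt D E = t2 E + t3 E] /\
    (t3 E + t5 E <= cnt [set v] E /\ t4 E + t5 E <= cnt [set x] E).
  move=> EM; have /imsetP[[a b]] := subsetP sM _ EM; rewrite inE /= => ab ->.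
  have {EM E ab} [u [w [uw h ->]]] : exists u w, [/\ u != w, half_gadget S T z u w &
      [set a; b] = [set u; w]].
    have nab : a != b by apply: contraTneq ab => ->; rewrite gadget_irr.
    case/orP: ab => h; first by exists a, b.
    by exists b, a; rewrite eq_sym setUC.
  have cE X : cnt X [set u; w] = (u \in X) + (w \in X).
    by rewrite /cnt big_setU1 ?big_set1 // inE.
  rewrite /t1 /t2 /t3 /t4 /t5 !cE !in_set1; move: h uw.
  case/or4P => [/andP[/class_A[-> -> -> ->] /class_B[-> -> -> ->]] //
    |/andP[/class_C[-> -> -> ->] /class_D[-> -> -> ->]] //
    |/andP[/eqP-> /(subsetP SD)/class_D[-> -> -> ->]] _
    |/orP[/andP[/eqP-> /(subsetP TC)/class_C[-> -> -> ->]] _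
    |/and3P[_ /eqP-> /eqP->] _]]; rewrite ?vA ?vB ?vC ?vD ?xA ?xB ?xC ?xD !eqxx /=; split=> //;
    by rewrite ?leq_addr ?leq_addl.
have sums : [/\ #|cover M :&: A| = \sum_(E in M) (t1 E + t3 E + t4 E + 2 * t5 E),
    #|cover M :&: B| = \sum_(E in M) t1 E,
    #|cover M :&: C| = \sum_(E in M) (t2 E + t4 E) &
    #|cover M :&: D| = \sum_(E in M) (t2 E + t3 E)].
  by split; rewrite -cov; apply: eq_bigr => E /edgeP[[]].
have n3 : \sum_(E in M) (t3 E + t5 E) <= 1.
  apply: leq_trans (_ : \sum_(E in M) cnt [set v] E <= _); first by apply: leq_sum => E /edgeP[_ []].
  by rewrite cov; apply: leq_trans (subset_leq_card (subsetIr _ _)) _; rewrite cards1.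
have n4 : \sum_(E in M) (t4 E + t5 E) <= 1.
  apply: leq_trans (_ : \sum_(E in M) cnt [set x] E <= _); first by apply: leq_sum => E /edgeP[_ []].
  by rewrite cov; apply: leq_trans (subset_leq_card (subsetIr _ _)) _; rewrite cards1.
move: sums n3 n4; rewrite !big_split /= big1_eq.
set s1 := \sum_(E in M) t1 E; set s2 := \sum_(E in M) t2 E; set s3 := \sum_(E in M) t3 E.
set s4 := \sum_(E in M) t4 E; set s5 := \sum_(E in M) (t5 E : nat).
case=> cA cB cC cD n3 n4.
have unc X : #|~: cover M :&: X| = #|X| - #|cover M :&: X|.
  by rewrite -(cardsID (cover M) X) (setIC X) addKn setDE setIC.
have zero (X Y : {set gadget_graph}) : (forall a b, a \in X -> b \in Y -> e a b) ->
    #|~: cover M :&: X| = 0 \/ #|~: cover M :&: Y| = 0.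
  move=> XY; have [->|[a /setIP[aM aX]]] := set_0Vmem (~: cover M :&: X).
    by left; rewrite cards0.
  right; apply: eq_card0 => b; apply/negbTE/negP => /setIP[bM bY].
  by have := ind a b; rewrite XY // !inE in aM bM *; move/(_ aM bM).
have zAB : #|~: cover M :&: A| = 0 \/ #|~: cover M :&: B| = 0.
  by apply: zero => a b aA bB; rewrite /gadget /half_gadget aA bB.
have zCD : #|~: cover M :&: C| = 0 \/ #|~: cover M :&: D| = 0.
  by apply: zero => a b aA bB; rewrite /gadget /half_gadget aA bB !orbT.
have le : #|~: cover M| <= #|~: cover M :&: A| + #|~: cover M :&: B| +
    (#|~: cover M :&: C| + #|~: cover M :&: D|).
  apply: leq_trans (_ : #|(~: cover M :&: A :|: ~: cover M :&: B) :|: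
     (~: cover M :&: C :|: ~: cover M :&: D)| <= _).
    apply/subset_leq_card/subsetP => u uM; rewrite !inE in uM *; rewrite uM /= -orbA.
    exact: part_cover P u.
  by apply: leq_trans (leq_card_setU _ _) _; apply: leq_add; exact: leq_card_setU.
apply: leq_trans le _; move: zAB zCD; rewrite !unc cA cB cC cD.
rewrite (card_A P) (card_B P) (card_C P) (card_D P); clear -n3 n4; lia.
Qed.

Hypotheses (Sn0 : S != set0) (Tn0 : T != set0).

(** Besides edges of the two bicliques, the matching uses edges that restore the balance of the
    blocks: none when [w] is in A, vs when it is in C, xt when it is in D, both when it is in B. *)
Lemma gadget_factor_critical : factor_critical gadget_graph.
Proof.
apply: factor_critical_of_matchable => w.
have [s sS] := set0Pn _ Sn0; have [t tT] := set0Pn _ Tn0.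
have [sA sB sC sD] := class_D (subsetP SD _ sS); have [tA tB tC tD] := class_C (subsetP TC _ tT).
have [vA vB vC vD] := v_class; have [xA xB xC xD] := x_class.
have vs : e v s by rewrite /gadget /half_gadget sS eqxx !orbT.
have xt : e x t by rewrite /gadget /half_gadget tT eqxx !orbT.
have AB (X Y : {set gadget_graph}) : X \subset A -> Y \subset B -> #|X| = #|Y| -> matchable (X :|: Y).
  move=> XA YB c; apply: matchable_bip => //.
    exact: disjointWl XA (disjointWr YB (part_AB P)).
  by move=> a b /(subsetP XA) aA /(subsetP YB) bB; rewrite /adj /= /gadget /half_gadget aA bB.
have CD (X Y : {set gadget_graph}) : X \subset C -> Y \subset D -> #|X| = #|Y| -> matchable (X :|: Y).
  move=> XC YD c; apply: matchable_bip => //.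
    exact: disjointWl XC (disjointWr YD (part_CD P)).
  by move=> a b /(subsetP XC) aC /(subsetP YD) bD; rewrite /adj /= /gadget /half_gadget aC bD !orbT.
have [cA cB cC cD] := And4 (card_A P) (card_B P) (card_C P) (card_D P).
have yv y : (y == v) ==> (y \in A) by apply/implyP => /eqP->.
have yx y : (y == x) ==> (y \in A) && (y != v).
  by apply/implyP => /eqP->; rewrite xA eq_sym (part_vx P).
have ys y : (y == s) ==> (y \in D) by apply/implyP => /eqP->.
have yt y : (y == t) ==> (y \in C) by apply/implyP => /eqP->.
have c1 (X : {set V}) y : y \in X -> #|X :\ y| = #|X|.-1 by move=> yX; rewrite (cardsD1 y X) yX.
have D1 (X : {set V}) y : X :\ y \subset X by exact: subsetDl.
case: (classes w) => -[wA wB wC wD].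
- have yw y : (y == w) ==> (y \in A) by apply/implyP => /eqP->.
  have -> : ~: [set w] = (A :\ w :|: B) :|: (C :|: D).
    apply/setP => y; rewrite !inE; move: (yw y); case: (classes y) => -[-> -> -> ->];
      by case: (y == w).
  apply: matchableU; [apply: AB => //|apply: CD => //|]; rewrite ?c1 ?cA ?cB ?cC ?cD //.
  by rewrite -setI_eq0; apply/eqP/setP => y; rewrite !inE; case: (classes y) => -[-> -> -> ->];
    rewrite ?andbF.
- have yw y : (y == w) ==> (y \in B) by apply/implyP => /eqP->.
  have -> : ~: [set w] = ([set v; s] :|: [set x; t]) :|:
     ((A :\ v :\ x :|: B :\ w) :|: (C :\ t :|: D :\ s)).
    apply/setP => y; rewrite !inE; move: (yw y) (yv y) (yx y) (ys y) (yt y).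
    case: (classes y) => -[-> -> -> ->];
      by case: (y == w); case: (y == v); case: (y == x); case: (y == s); case: (y == t).
  apply: matchableU; [apply: matchableU; try exact: matchable_edge| |].
  + rewrite -setI_eq0; apply/eqP/setP => y; rewrite !inE; move: (yw y) (yv y) (yx y) (ys y) (yt y).
    case: (classes y) => -[-> -> -> ->];
      by case: (y == w); case: (y == v); case: (y == x); case: (y == s); case: (y == t).
  + apply: matchableU; [apply: AB => //|apply: CD => //|].
    * exact: subset_trans (D1 _ _) (D1 _ _).
    * by rewrite !c1 ?cA ?cB // !inE eq_sym (part_vx P).
    * by rewrite !c1 ?cC ?cD.
    by rewrite -setI_eq0; apply/eqP/setP => y; rewrite !inE; case: (classes y) => -[-> -> -> ->];
      rewrite ?andbF ?orbF.
  rewrite -setI_eq0; apply/eqP/setP => y; rewrite !inE; move: (yw y) (yv y) (yx y) (ys y) (yt y).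
  case: (classes y) => -[-> -> -> ->];
    by case: (y == w); case: (y == v); case: (y == x); case: (y == s); case: (y == t).
- have yw y : (y == w) ==> (y \in C) by apply/implyP => /eqP->.
  have -> : ~: [set w] = [set v; s] :|: ((A :\ v :|: B) :|: (C :\ w :|: D :\ s)).
    apply/setP => y; rewrite !inE; move: (yw y) (yv y) (ys y).
    by case: (classes y) => -[-> -> -> ->]; case: (y == w); case: (y == v); case: (y == s).
  apply: matchableU; [exact: matchable_edge| |].
  + apply: matchableU; [apply: AB => //|apply: CD => //|]; rewrite ?c1 ?cA ?cB ?cC ?cD //.
    by rewrite -setI_eq0; apply/eqP/setP => y; rewrite !inE; case: (classes y) => -[-> -> -> ->];
      rewrite ?andbF ?orbF.
  rewrite -setI_eq0; apply/eqP/setP => y; rewrite !inE; move: (yw y) (yv y) (ys y).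
  by case: (classes y) => -[-> -> -> ->]; case: (y == w); case: (y == v); case: (y == s).
have yw y : (y == w) ==> (y \in D) by apply/implyP => /eqP->.
have -> : ~: [set w] = [set x; t] :|: ((A :\ x :|: B) :|: (C :\ t :|: D :\ w)).
  apply/setP => y; rewrite !inE; move: (yw y) (yx y) (yt y).
  by case: (classes y) => -[-> -> -> ->]; case: (y == w); case: (y == x); case: (y == t).
apply: matchableU; [exact: matchable_edge| |].
+ apply: matchableU; [apply: AB => //|apply: CD => //|]; rewrite ?c1 ?cA ?cB ?cC ?cD //.
  by rewrite -setI_eq0; apply/eqP/setP => y; rewrite !inE; case: (classes y) => -[-> -> -> ->];
    rewrite ?andbF ?orbF.
rewrite -setI_eq0; apply/eqP/setP => y; rewrite !inE; move: (yw y) (yx y) (yt y).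
by case: (classes y) => -[-> -> -> ->]; case: (y == w); case: (y == x); case: (y == t).
Qed.

Hypotheses (p0 : 0 < p) (q1 : 1 < q).

(** [ok] fails at one vertex at most, so this covers the graph itself and every vertex deletion. The
    edges vs and xt are disjoint, so one of them still joins the blocks. *)
Lemma gadget_connect (ok : pred V) : (forall a b, ~~ ok a -> ~~ ok b -> a = b) ->
  forall a b, ok a -> ok b -> connect [rel a b : V | [&& ok a, ok b & e a b]] a b.
Proof.
move=> ok1; set r := [rel a b : V | _].
have r_sym : connect_sym r.
  apply: sym_connect_sym => a b; rewrite /r /= gadget_sym andbA [ok a && _]andbC -andbA.
  by [].
have c1 a b : ok a -> ok b -> e a b -> connect r a b.
  by move=> oa ob ab; apply: connect1; rewrite /r /= oa ob ab.
have [s sS] := set0Pn _ Sn0; have [t tT] := set0Pn _ Tn0.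
have [sA sB sC sD] := class_D (subsetP SD _ sS); have [tA tB tC tD] := class_C (subsetP TC _ tT).
have [vA vB vC vD] := v_class; have [xA xB xC xD] := x_class.
have vs : e v s by rewrite /gadget /half_gadget sS eqxx !orbT.
have xt : e x t by rewrite /gadget /half_gadget tT eqxx !orbT.
have AB a b : a \in A -> b \in B -> e a b.
  by move=> aA bB; rewrite /gadget /half_gadget aA bB.
have CD a b : a \in C -> b \in D -> e a b.
  by move=> aA bB; rewrite /gadget /half_gadget aA bB !orbT.
have two (X : {set V}) : 1 < #|X| -> exists2 a, a \in X & ok a.
  case/card_gt1P=> a [b [aX bX ab]]; case: (boolP (ok a)) => oa; first by exists a.
  exists b => //; apply/negPn/negP => ob; by rewrite (ok1 _ _ oa ob) eqxx in ab.
have [d0 d0D d0ok] : exists2 d, d \in D & ok d by apply: two; rewrite (card_D P).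
have [c0 c0C c0ok] : exists2 c, c \in C & ok c by apply: two; rewrite (card_C P).
have hC c : c \in C -> ok c -> connect r c d0 by move=> cC oc; apply: c1 => //; apply: CD.
have hD d : d \in D -> ok d -> connect r d d0.
  move=> dD od; apply: (connect_trans _ (hC _ c0C c0ok)); rewrite r_sym; apply: c1 => //.
  exact: CD.
have bad a b : ~~ ok a -> a != b -> ok b.
  by move=> na ab; apply/negPn/negP => nb; rewrite (ok1 _ _ na nb) eqxx in ab.
have [b0 b0B] : exists b, b \in B.
  by apply/set0Pn; rewrite -card_gt0 (card_B P).
have xv : x != v by rewrite eq_sym (part_vx P).
have nAD a d : a \in A -> d \in D -> d != a.
  by move=> aA dD; apply: contraTneq dD => ->; have [_ _ _ ->] := class_A aA.
have nAC a d : a \in A -> d \in C -> d != a.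
  by move=> aA dD; apply: contraTneq dD => ->; have [_ _ -> _] := class_A aA.
have nBD a d : a \in B -> d \in D -> d != a.
  by move=> aA dD; apply: contraTneq dD => ->; have [_ _ _ ->] := class_B aA.
have nBC a d : a \in B -> d \in C -> d != a.
  by move=> aA dD; apply: contraTneq dD => ->; have [_ _ -> _] := class_B aA.
have hv : ok v -> connect r v d0.
  move=> ov; case: (boolP (ok s)) => os; first by apply: connect_trans (c1 _ _ ov os vs) (hD _ sD os).
  have ob : ok b0 by apply: (bad _ _ os); apply: nBD.
  have ox : ok x by apply: (bad _ _ os); apply: nAD.
  have ot : ok t by apply: (bad _ _ os); apply: contraTneq tC => <-; rewrite sC.
  apply: connect_trans (c1 _ _ ov ob (AB _ _ vA b0B)) _.
  apply: (@connect_trans _ _ x); first by rewrite r_sym; apply: c1 => //; apply: AB.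
  exact: connect_trans (c1 _ _ ox ot xt) (hC _ tC ot).
have hx : ok x -> connect r x d0.
  move=> ox; case: (boolP (ok t)) => ot; first by apply: connect_trans (c1 _ _ ox ot xt) (hC _ tC ot).
  have ob : ok b0 by apply: (bad _ _ ot); apply: nBC.
  have ov : ok v by apply: (bad _ _ ot); apply: nAC.
  apply: connect_trans (c1 _ _ ox ob (AB _ _ xA b0B)) _.
  by apply: connect_trans (hv ov); rewrite r_sym; apply: c1 => //; apply: AB.
have hB b : b \in B -> ok b -> connect r b d0.
  move=> bB ob; case: (boolP (ok v)) => ov.
    by apply: connect_trans (hv ov); rewrite r_sym; apply: c1 => //; apply: AB.
  have ox : ok x by apply: (bad _ _ ov); rewrite eq_sym.
  by apply: connect_trans (hx ox); rewrite r_sym; apply: c1 => //; apply: AB.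
have hA a : a \in A -> ok a -> connect r a d0.
  move=> aA oa; have [av|av] := eqVneq a v; first by rewrite av in oa *; apply: hv.
  have [ax|ax] := eqVneq a x; first by rewrite ax in oa *; apply: hx.
  (* A third vertex of A forces p to be at least 2, so some vertex of B remains. *)
  have B1 : 1 < #|B|.
    rewrite (card_B P) -ltnS -(card_A P).
    apply: leq_trans (subset_leq_card (_ : a |: [set v; x] \subset A)).
      by rewrite cardsU1 cards2 !inE (negbTE av) (negbTE ax) (part_vx P).
    by apply/subsetP => y; rewrite !inE => /or3P[]/eqP->.
  have [b bB ob] := two _ B1.
  by apply: connect_trans (c1 _ _ oa ob (AB _ _ aA bB)) (hB _ bB ob).
suff h a : ok a -> connect r a d0.
  by move=> a b oa ob; apply: connect_trans (h _ oa) _; rewrite r_sym; apply: h.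
by move=> oa; case: (classes a) => -[aA aB aC aD]; [apply: hA|apply: hB|apply: hC|apply: hD].
Qed.

Lemma gadget_connected : connected_graph gadget_graph.
Proof.
split; first by rewrite card_gadget; lia.
move=> a b; have := gadget_connect (ok := predT); apply=> //.
Qed.

Lemma gadget_two_connected : two_connected gadget_graph.
Proof.
split; [by rewrite card_gadget; lia|exact: gadget_connected|] => w.
apply: connected_del; last by apply: (gadget_connect (ok := predC1 w)) => a b /negPn/eqP-> /negPn/eqP->.
have : #|predC1 w| = (2 * p + 2 * q + 1).-1.
  have := cardC1 w; rewrite card_gadget => <-. by [].
rewrite card_sig => ->; lia.
Qed.

(** By 2-connectivity [u] still reaches a third vertex [y] after [w] is deleted; the first step of
    the path gives [w']. *)
Lemma gadget_deg2 u w : e u w -> exists2 w', e u w' & w' != w.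
Proof.
move=> uw; have nuw : u != w by apply: contraTneq uw => ->; rewrite gadget_irr.
have [y yu yw] : exists2 y, y != u & y != w.
  have : 0 < #|~: [set u; w]|.
    have := cardsC [set u; w]; rewrite cards2 nuw -[#|V|]/(#|gadget_graph|) card_gadget; lia.
  by case/card_gt0P=> y; rewrite !inE negb_or => /andP[]; exists y.
have := @gadget_connect (predC1 w) _ u y nuw yw; case/(_ _)/connectP.
  by move=> a b /negPn/eqP-> /negPn/eqP->.
case=> [|w' l] /=; first by move=> _ E; rewrite E eqxx in yu.
by case/andP=> /and3P[_ w'w uw'] _ _; exists w'.
Qed.

(* Without the edge vx the gadget maps homomorphically to a pentagon. *)
Lemma gadget_triangles a b c : e a b -> e b c -> e c a ->
  has (fun d => (d == (v, x)) || (d == (x, v))) [:: (a, b); (b, c); (c, a)].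
Proof.
pose k y := if y == x then 3 else if y \in A then 0 else if y \in B then 4 else
  if y \in C then 2 else 1.
pose pent i j := (j == i.+1 %% 5) || (i == j.+1 %% 5).
have [vA vB vC vD] := v_class; have [xA xB xC xD] := x_class.
have nx y : y \in A = false -> (y == x) = false.
  by apply: contraFF => /eqP->.
have half u w : half_gadget S T z u w -> ((u, w) == (v, x)) || pent (k u) (k w).
  case/or4P => [/andP[uA /class_B[wA wB wC wD]]|/andP[/class_C[uA uB uC uD] /class_D[wA wB wC wD]]
     |/andP[/eqP-> /(subsetP SD)/class_D[wA wB wC wD]]|/orP[/andP[/eqP-> /(subsetP TC)/class_C[wA wB wC wD]]|]].
  - by rewrite /k uA wA wB (nx _ wA) /pent; case: (u == x); rewrite orbT.
  - by rewrite /k uA uB uC wA wB wC (nx _ wA) (nx _ uA) orbT.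
  - by rewrite /k vA wA wB wC (negbTE (part_vx P)) (nx _ wA) orbT.
  - by rewrite /k wA wB wC (nx _ wA) eqxx orbT.
  by case/and3P=> _ /eqP-> /eqP->; rewrite eqxx.
have pentC i j : pent i j = pent j i by rewrite /pent orbC.
have edge u w : e u w -> ((u, w) == (v, x)) || ((u, w) == (x, v)) || pent (k u) (k w).
  case/orP=> /half; first by case/orP=> ->; rewrite ?orbT.
  by rewrite !xpair_eqE [(w == v) && _]andbC pentC => /orP[]->; rewrite ?orbT.
have k5 y : k y < 5 by rewrite /k; do 4?case: ifP.
move=> /edge eab /edge ebc /edge eca; rewrite /= orbF.
case/orP: eab => [->//|ab]; case/orP: ebc => [->|bc]; rewrite ?orbT //.
case/orP: eca => [->|ca]; rewrite ?orbT //.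
move: ab bc ca (k5 a) (k5 b) (k5 c); rewrite /pent.
by case: (k a) => [|[|[|[|[|?]]]]] //; case: (k b) => [|[|[|[|[|?]]]]] //;
  case: (k c) => [|[|[|[|[|?]]]]].
Qed.

Lemma card_gadget_darts :
  #|[pred d : V * V | e d.1 d.2]| = 2 * (p * p.+1 + q * q + #|S| + #|T| + z).
Proof.
pose H := setX A B :|: setX C D :|: (setX [set v] S :|: setX [set x] T) :|: (if z then [set (v, x)] else set0).
have HE d : d \in H = half_gadget S T z d.1 d.2.
  rewrite /half_gadget !inE -!orbA; do 4!congr (_ || _).
  by case: z; rewrite !inE.
have [vA vB vC vD] := v_class; have [xA xB xC xD] := x_class.
(* [rk] increases along [half_gadget], so no edge arises from it in both directions. *)
pose rk y := if y == x then 1 else if y \in A then 0 else if y \in D then 3 else 2.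
have nx y : y \in A = false -> (y == x) = false by apply: contraFF => /eqP->.
have rank u w : half_gadget S T z u w -> rk u < rk w.
  case/or4P => [/andP[uA /class_B[wA wB wC wD]]|/andP[/class_C[uA uB uC uD] /class_D[wA wB wC wD]]
     |/andP[/eqP-> /(subsetP SD)/class_D[wA wB wC wD]]|/orP[/andP[/eqP-> /(subsetP TC)/class_C[wA wB wC wD]]|]].
  - by rewrite /rk uA wA wD (nx _ wA); case: (u == x).
  - by rewrite /rk uA uD wA wD (nx _ wA) (nx _ uA).
  - by rewrite /rk vA wA wD (negbTE (part_vx P)) (nx _ wA).
  - by rewrite /rk wA wD (nx _ wA) eqxx.
  by case/and3P=> _ /eqP-> /eqP->; rewrite /rk eqxx vA (negbTE (part_vx P)).
have cH : #|H| = p * p.+1 + q * q + #|S| + #|T| + z.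
  have cU (X Y : {set V * V}) : (forall d, d \in X -> d \in Y -> False) -> #|X :|: Y| = #|X| + #|Y|.
    move=> XY; rewrite cardsU (_ : _ :&: _ = set0) ?cards0 ?subn0 //.
    by apply/setP => d; rewrite !inE; apply/negbTE/andP => -[]; apply: XY.
  have nS y : y \in S -> [/\ y \in A = false, y \in B = false, y \in C = false & y \in D].
    by move/(subsetP SD)/class_D.
  have nT y : y \in T -> [/\ y \in A = false, y \in B = false, y \in C & y \in D = false].
    by move/(subsetP TC)/class_C.
  rewrite /H !cU ?cardsX ?cards1 ?(card_A P) ?(card_B P) ?(card_C P) ?(card_D P).
  - by rewrite !mul1n (mulnC p.+1) !addnA; case: (z); rewrite ?cards1 ?cards0.
  - by case=> a b; rewrite !inE /= => /andP[/eqP-> /nS[_ _ _ bD]] /andP[_ /nT[_ _ _]]; rewrite bD.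
  - by case=> a b; rewrite !inE /= => /andP[/class_A[_ _ aC _] _] /andP[]; rewrite aC.
  - case=> a b; rewrite !inE /= => /orP[/andP[aA bB]|/andP[aC bD]] /orP[]/andP[/eqP Ea].
    + by case/nS => _; rewrite bB.
    + by case/nT => _; rewrite bB.
    + by move: aC; rewrite Ea vC.
    + by move: aC; rewrite Ea xC.
  case=> a b; case: (z); rewrite !inE //= xpair_eqE => H1 /andP[/eqP Ea /eqP Eb]; move: H1.
  rewrite Ea Eb vC xB !andbF /=; case/orP => /andP[_].
    by case/nS; rewrite xA.
  by case/nT; rewrite xA.
have -> : #|[pred d : V * V | e d.1 d.2]| = #|H :|: [set (d.2, d.1) | d in H]|.
  apply: eq_card => d; rewrite in_setU HE /gadget -topredE /=; congr (_ || _).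
  apply/idP/imsetP => [h|[d' d'H ->]]; last by rewrite -HE.
  by exists (d.2, d.1); [rewrite HE | case: d h].
rewrite cardsU (_ : _ :&: _ = set0); last first.
  apply/setP => -[a b]; rewrite in_setI in_set0; apply/negbTE/andP => -[].
  rewrite HE => h1 /imsetP[[c d]]; rewrite HE /= => h2 [Ea Eb]; move: h1 h2.
  rewrite -{c}Eb -{d}Ea {Eb} /=.
  by move/rank => ab /rank; rewrite ltnNge (ltnW ab).
rewrite cards0 subn0 card_imset ?cH; last by move=> [a b] [c d] [-> ->].
by rewrite addnn mul2n.
Qed.

End Parts.
End Gadget.

(** * Quadrangular blocks *)

(* The vertices be b see al 0, ..., al m.-1 (and al m when b \in S) in this cyclic
   order; around al i the matchings M i and M i.-1 alternate.  The faces are the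
   quadrangles al i, be b, al i.+1, be (M i b). *)
Section Block.
Variables (V : finType) (e : rel V) (EV : finType) (m : nat).
Variables (al : nat -> V) (be : EV -> V) (M : nat -> EV -> EV) (S : {set EV}).

Definition ins (i : nat) (b : EV) := (i < m) || (i == m) && (b \in S).

Definition nxt (b : EV) (s : bool) (i : nat) : nat :=
  let l := if b \in S then m else m.-1 in
  if s then (if i == l then 0 else i.+1) else (if i == 0 then l else i.-1).

Arguments nxt : simpl never.

(** Side [true] of an edge at [al i] faces the next vertex in the cyclic order and uses [M i]; side
    [false] faces the previous one, and index 0 wraps round to [m]. *)
Definition gap (i : nat) (s : bool) : EV -> EV :=
  M (if s then i else if i == 0 then m else i.-1).

(** [bd_out] makes [M m] serve as the last matching also at the vertices [be b] that miss [al m].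
    [bd_link] says that the two matchings around [al i] form one cycle on its neighbours. *)
Record block_data : Prop := BlockData {
  bd_sym : symmetric e;
  bd_m : 0 < m;
  bd_be : injective be;
  bd_al : forall i j b c, ins i b -> ins j c -> al i = al j -> i = j;
  bd_ab : forall i b c, ins i b -> al i != be c;
  bd_e1 : forall i b, ins i b -> e (al i) (be b);
  bd_e2 : forall u w, e u w -> exists i b, ins i b /\
     ((u = al i /\ w = be b) \/ (u = be b /\ w = al i));
  bd_K : forall i, i <= m -> involutive (M i);
  bd_F : forall i b, i <= m -> M i b != b;
  bd_out : forall b, b \notin S -> M m b = M m.-1 b;
  bd_S : forall b, (M m b \in S) = (b \in S);
  bd_S' : forall b, (M m.-1 b \in S) = (b \in S);
  bd_link : forall i b c, ins i b -> ins i c ->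
    connect (fun b c => (c == gap i true b) || (c == gap i false b)) b c }.

Hypothesis H : block_data.

Lemma ins_le i b : ins i b -> i <= m.
Proof. by case/orP=> [/ltnW //|/andP[/eqP->]]. Qed.

Lemma gap_le i (s : bool) : i <= m -> (if s then i else if i == 0 then m else i.-1) <= m.
Proof. by case: s => //; case: eqP => // _; apply: leq_trans (leq_pred _). Qed.

Lemma gapK i s : i <= m -> involutive (gap i s).
Proof. by move=> im; apply: (bd_K H); apply: gap_le. Qed.

Lemma gapF i s b : i <= m -> gap i s b != b.
Proof. by move=> im; apply: (bd_F H); apply: gap_le. Qed.

Lemma ins_gap i s b : ins i b -> ins i (gap i s b).
Proof.
case/orP=> [im|/andP[/eqP-> bS]]; first by rewrite /ins im.
rewrite /ins eqxx ltnn /gap; case: s; first by rewrite (bd_S H).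
by rewrite -[m == 0]negbK -lt0n (bd_m H) /= (bd_S' H).
Qed.

Lemma ins_nxt b s i : ins i b -> ins (nxt b s i) b.
Proof.
have m0 := bd_m H; rewrite /ins /nxt; case: (b \in S); case: s; rewrite ?andbT ?andbF ?orbF /=;
  case: ifP; clear -m0; lia.
Qed.

Lemma nxtK b s i : ins i b -> nxt b (~~ s) (nxt b s i) = i.
Proof.
have m0 := bd_m H; rewrite /ins /nxt; case: (b \in S); case: s; rewrite ?andbT ?andbF ?orbF /=;
  case: ifP; case: ifP; clear -m0; lia.
Qed.

Let isA (p : V * V) (x : 'I_m.+1 * EV) := ins x.1 x.2 && (p == (al x.1, be x.2)).
Let isB (p : V * V) (x : 'I_m.+1 * EV) := ins x.1 x.2 && (p == (be x.2, al x.1)).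

(** The side tells whether the next or the previous [al] is faced. It is therefore kept at a corner
    of [al i] and exchanged at a corner of [be b]. *)
Definition block_turn (f : flag V) : flag V :=
  if [pick x | isA f.1 x] is Some x then (f.1.1, be (gap x.1 f.2 x.2), f.2)
  else if [pick x | isB f.1 x] is Some x then (f.1.1, al (nxt x.2 f.2 x.1), ~~ f.2)
  else turn_side f.

Lemma block_turnA i b s : ins i b ->
  block_turn (al i, be b, s) = (al i, be (gap i s b), s).
Proof.
move=> ib; rewrite /block_turn /=; case: pickP => [[j c] /andP[/= jc]|/(_ (inord i, b))].
  by rewrite xpair_eqE => /andP[/eqP/(bd_al H ib jc) <- /eqP/(bd_be H) <-].
by rewrite /isA /= inordK ?ib ?eqxx // ltnS (ins_le ib).
Qed.

Lemma block_turnB i b s : ins i b ->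
  block_turn (be b, al i, s) = (be b, al (nxt b s i), ~~ s).
Proof.
move=> ib; rewrite /block_turn /=; case: pickP => [[j c] /andP[/= jc]|_].
  by rewrite xpair_eqE eq_sym (negbTE (bd_ab H _ jc)).
case: pickP => [[j c] /andP[/= jc]|/(_ (inord i, b))].
  by rewrite xpair_eqE => /andP[/eqP/(bd_be H) <- /eqP/(bd_al H ib jc) <-].
by rewrite /isB /= inordK ?ib ?eqxx // ltnS (ins_le ib).
Qed.

Lemma block_turn_out f : ~~ on e f -> block_turn f = turn_side f.
Proof.
move=> nf; rewrite /block_turn; case: pickP => [[j c] /andP[/= jc /eqP E]|_].
  by rewrite /on E /= (bd_e1 H jc) in nf.
case: pickP => [[j c] /andP[/= jc /eqP E]|//].
by rewrite /on E /= (bd_sym H) (bd_e1 H jc) in nf.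
Qed.

Lemma block_flag f : on e f -> exists i b s, ins i b /\
  (f = (al i, be b, s) \/ f = (be b, al i, s)).
Proof.
case: f => [[u w] s] /(bd_e2 H) [i [b [ib [[/= -> ->]|[/= -> ->]]]]]; exists i, b, s; split=> //.
  by left.
by right.
Qed.

Lemma block_turnK : involutive block_turn.
Proof.
move=> f; case: (boolP (on e f)) => [/block_flag|nf]; last first.
  by rewrite !block_turn_out ?turn_sideK // block_turn_out.
case=> i [b [s [ib [->|->]]]].
  by rewrite !block_turnA ?gapK ?ins_gap ?(ins_le ib).
by rewrite !block_turnB ?nxtK ?negbK ?ins_nxt.
Qed.

Definition block_th : {perm flag V} := perm (can_inj block_turnK).
Local Notation th := block_th.

Lemma block_thA i b s : ins i b -> th (al i, be b, s) = (al i, be (gap i s b), s).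
Proof. by move=> ib; rewrite permE block_turnA. Qed.

Lemma block_thB i b s : ins i b -> th (be b, al i, s) = (be b, al (nxt b s i), ~~ s).
Proof. by move=> ib; rewrite permE block_turnB. Qed.

Lemma block_corners : corners e th.
Proof.
split.
- by move=> f; rewrite !permE block_turnK.
- move=> f; case: (boolP (on e f)) => [/block_flag|nf]; last first.
    by rewrite permE block_turn_out // -th2E th2F.
  case=> i [b [s [ib [->|->]]]].
    rewrite block_thA //; apply/eqP => -[/(bd_be H)/eqP].
    by rewrite (negbTE (gapF _ _ (ins_le ib))).
  by rewrite block_thB //; apply/eqP => -[_]; case: (s).
- move=> f; case: (boolP (on e f)) => [/block_flag|nf]; last by rewrite permE block_turn_out.
  by case=> i [b [s [ib [->|->]]]]; rewrite ?block_thA ?block_thB.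
by move=> f nf; rewrite permE block_turn_out // th2E.
Qed.

Lemma block_linked : linked_at e th.
Proof.
pose r := link (swap_side V) th.
have S2 u w s s' : connect r (u, w, s) (u, w, s').
  have [->//|/eqP ss'] := eqVneq s s'.
  by apply: connect1; rewrite /r /link th2E /turn_side /=; case: s s' ss' => [] [] // _; rewrite eqxx.
have Sy : connect_sym r.
  by apply: sym_connect_sym; apply: link_sym; [exact: th2K|exact: (cornerK block_corners)].
have LA i b c s s' : ins i b -> ins i c -> connect r (al i, be b, s) (al i, be c, s').
  move=> ib ic; apply: connect_trans (S2 _ _ s' s').
  have /connectP[l] := bd_link H ib ic.
  elim: l b ib s => [|d l IH] b ib s /=; first by move=> _ ->.
  case/andP=> bd pl lc.
  have [t Ed] : exists t, d = gap i t b.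
    by case/orP: bd => /eqP ->; [exists true|exists false].
  have id : ins i d by rewrite Ed ins_gap.
  apply: connect_trans (S2 _ _ s t) _; apply: connect_trans (IH d id t pl lc).
  by apply: connect1; rewrite /r /link block_thA // Ed eqxx orbT.
have LB i b s s' : ins i b -> connect r (be b, al 0, s) (be b, al i, s').
  elim: i s' => [|i IH] s' ib; first exact: S2.
  have ib' : ins i b by move: ib; rewrite /ins; clear; lia.
  have E : nxt b true i = i.+1.
    by move: ib; rewrite /nxt /ins; case: (b \in S) => /=; case: ifP; clear; lia.
  apply: connect_trans (IH true ib') _; apply: connect_trans (S2 _ _ false s').
  by apply: connect1; rewrite /r /link block_thB // E eqxx orbT.
move=> f g /block_flag[i [b [s [ib Ef]]]] /block_flag[j [c [t [jc Eg]]]].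
case: Ef => ->; case: Eg => ->; rewrite /tl /= => E.
- have ij := bd_al H ib jc E; move: ib; rewrite ij => ib; exact: LA.
- by have := bd_ab H c ib; rewrite E eqxx.
- by have := bd_ab H b jc; rewrite E eqxx.
have bc := bd_be H E; move: ib; rewrite bc => ib; apply: connect_trans (LB _ _ s t jc).
by rewrite Sy; apply: LB.
Qed.

Lemma quad_reflect (f : flag V) : let r := (swap_vertex V * th)%g in
  (r ^+ 4)%g f = f -> (r ^+ 4)%g (swap_vertex V f) = swap_vertex V f.
Proof.
move=> r E.
have R g : r (swap_vertex V (r g)) = swap_vertex V g.
  by rewrite !permM th0K (cornerK block_corners).
have R4 k g : (r ^+ k)%g (swap_vertex V ((r ^+ k)%g g)) = swap_vertex V g.
  elim: k g => [|k IH] g; first by rewrite expg0 !perm1.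
  by rewrite permXS [(r ^+ k.+1)%g g]permXSr IH R.
by have := R4 4 f; rewrite E.
Qed.

Lemma block_quads f : on e f -> ((swap_vertex V * th)%g ^+ 4)%g f = f.
Proof.
set r := (swap_vertex V * th)%g.
have rA i b s : ins i b -> r (al i, be b, s) = (be b, al (nxt b s i), ~~ s).
  move=> ib; rewrite permM th0E /turn_edge /= (negbTE (bd_ab H b ib)) addbF.
  by rewrite block_thB.
have rB i b s : ins i b -> r (be b, al i, s) = (al i, be (gap i s b), s).
  move=> ib; rewrite permM th0E /turn_edge /= eq_sym (negbTE (bd_ab H b ib)) addbF.
  by rewrite block_thA.
have Q i b : ins i b -> (r ^+ 4)%g (al i, be b, true) = (al i, be b, true).
  move=> ib; rewrite !permXSr expg0 perm1 rA //.
  set j := nxt b true i; have jb : ins j b by apply: ins_nxt.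
  rewrite rB //= rA ?ins_gap //=.
  (* At the wrap-around [j] is 0 and [gap] yields [M m]; for [b] outside [S] this is [M m.-1], the
     matching at the last index. *)
  have G : gap j false b = M i b.
    rewrite /gap /j /nxt; case bS: (b \in S); first by have [->|_] := eqVneq i m.
    by have [->|_] := eqVneq i m.-1; rewrite //= (bd_out H) // bS.
  rewrite G; have N : nxt (M i b) false j = i.
    rewrite /j /nxt; case bS: (b \in S).
      by have [->|_] := eqVneq i m; rewrite //= (bd_S H) bS.
    by have [->|_] := eqVneq i m.-1; rewrite //= (bd_S' H) bS.
  by rewrite N rB ?[gap i true _](bd_K H) ?(ins_le ib) //; apply: (ins_gap true).
have QB i b : ins i b -> (r ^+ 4)%g (be b, al i, true) = (be b, al i, true).
  move=> ib; have := quad_reflect (Q _ _ ib).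
  by rewrite th0E /turn_edge /= (negbTE (bd_ab H b ib)).
have QB' i b : ins i b -> (r ^+ 4)%g (be b, al i, false) = (be b, al i, false).
  move=> ib; have ib' := ins_nxt false ib.
  have E : r (al (nxt b false i), be b, true) = (be b, al i, false).
    by rewrite rA // (nxtK false).
  by rewrite -E -permXSr permXS Q.
have QA' i b : ins i b -> (r ^+ 4)%g (al i, be b, false) = (al i, be b, false).
  move=> ib; have := quad_reflect (QB' _ _ ib).
  by rewrite th0E /turn_edge /= eq_sym (negbTE (bd_ab H b ib)).
by case/block_flag=> i [b [[] [ib [->|->]]]]; auto.
Qed.

End Block.

(** * Pairings whose unions are Hamiltonian cycles *)

Record pairing (T : finType) (N : {perm T}) : Prop := Pairing {
  pairingK : involutive N;
  pairingF : forall b, N b != b }.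

(** For pairings this says that their union is a Hamiltonian cycle. *)
Definition joined (T : finType) (N N' : {perm T}) := forall b c, connect (link N N') b c.

Lemma linkC (T : finType) (N N' : {perm T}) : link N N' =2 link N' N.
Proof. by move=> b c; rewrite /link orbC. Qed.

Lemma repair_pairing (T : finType) (N : {perm T}) f h : pairing N -> pairing (repair N f h).
Proof. by case=> K F; split; [apply: repairK | apply: repairF]. Qed.

(* N' grows from N1: repairing it with a pair outside S keeps N0 and N' joined
   and adds that pair to S. *)
Lemma grow_pairing (T : finType) (N0 N1 : {perm T}) (b0 : T) i :
  pairing N0 -> pairing N1 -> joined N0 N1 -> 0 < i -> 2 * i <= #|T| ->
  exists N' (S : {set T}), [/\ pairing N', joined N0 N', #|S| = 2 * i, b0 \in S &
    [/\ forall b, (N1 b \in S) = (b \in S), forall b, (N' b \in S) = (b \in S),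
        forall b, b \notin S -> N' b = N1 b &
        {in S &, forall b c, connect (link N1 N') b c}]].
Proof.
move=> P0 P1 J; case: i => // i _; elim: i => [|i IH] le.
  have K := pairingK P1.
  exists N1, [set b0; N1 b0]; split=> //.
  - by rewrite cards2 eq_sym (pairingF P1).
  - by rewrite set21.
  have cl b : (N1 b \in [set b0; N1 b0]) = (b \in [set b0; N1 b0]).
    by rewrite !inE orbC (inj_eq perm_inj) (inv_eq K).
  split=> // b c bS cS.
  have S := sym_connect_sym (link_sym K K).
  have H d : d \in [set b0; N1 b0] -> connect (link N1 N1) b0 d.
    by rewrite !inE => /orP[]/eqP-> //; apply: connect1; rewrite /link eqxx.
  by apply: connect_trans (H _ cS); rewrite S; apply: H.
have [|N' [S [P' J' cS b0S [cl1 cl' out con]]]] := IH; first by lia.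
have [K0 F0] := P0; have [K1 F1] := P1; have [K' F'] := P'.
have [h hS] : exists h, h \notin S.
  have : 0 < #|~: S| by have := cardsC S; lia.
  by case/card_gt0P=> h; rewrite inE => hS; exists h.
have Nh : N' h = N1 h by apply: out.
(* The orbits of [b0] and [N' b0] are the two directions of one cycle and hence disjoint, so [N' h]
   avoids one of them. *)
have [f fS fO] : exists2 f, f \in S & N' h \notin porbit (N0 * N')%g f.
  case: (boolP (N' h \in porbit (N0 * N')%g b0)) => hO; last by exists b0.
  exists (N' b0); first by rewrite cl'.
  rewrite -eq_porbit_mem; rewrite -eq_porbit_mem in hO; rewrite (eqP hO).
  by rewrite eq_sym eq_porbit_mem porbit_b.
have hf : h != f by apply: contraNneq hS => ->.
have hf' : h != N' f by apply: contraNneq hS => ->; rewrite cl'.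
pose N2 := repair N' f h; exists N2, (S :|: [set h; N1 h]).
have N1hS : N1 h \notin S by rewrite cl1.
have cl12 b : (N1 b \in S :|: [set h; N1 h]) = (b \in S :|: [set h; N1 h]).
  by rewrite !inE cl1 (inj_eq perm_inj) (inv_eq K1) [in RHS](orbC (b == h)).
have out2 b : b \notin S :|: [set h; N1 h] -> N2 b = N1 b.
  rewrite !inE !negb_or => /and3P[bS bh bh'].
  rewrite /N2 (repair_out K') ?Nh //; first exact: out.
    by apply: contraNneq bS => ->.
  by apply: contraNneq bS => ->; rewrite cl'.
have cl22 b : (N2 b \in S :|: [set h; N1 h]) = (b \in S :|: [set h; N1 h]).
  have sub c : c \in S :|: [set h; N1 h] -> N2 c \in S :|: [set h; N1 h].
    have [->|cf] := eqVneq c f; first by rewrite /N2 (repair_f F' hf) !inE eqxx orbT.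
    have [->|cf'] := eqVneq c (N' f); first by rewrite /N2 (repair_bf F' hf) Nh !inE eqxx !orbT.
    have [->|ch] := eqVneq c h; first by rewrite /N2 (repair_h K' F' hf) !inE fS.
    have [->|ch'] := eqVneq c (N' h); first by move=> _; rewrite /N2 (repair_bh K' F' hf) !inE cl' fS.
    rewrite !inE -Nh (negbTE ch) (negbTE ch') /= orbF => cS'.
    by rewrite /N2 (repair_out K') // cl' cS'.
  by apply/idP/idP => [/sub|/sub //]; rewrite (repairK K').
split=> //.
- exact: repair_pairing.
- by move=> b c; apply: (repair_connect K0 K' F0 F' hf fO).
- rewrite cardsU cS cards2 (_ : _ :&: _ = set0) ?cards0 ?[h == _]eq_sym ?F1; first by lia.
  apply/setP => b; rewrite !inE; apply/negbTE/andP => -[bS /orP[]/eqP E].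
    by rewrite E (negbTE hS) in bS.
  by rewrite E (negbTE N1hS) in bS.
- by rewrite !inE b0S.
split=> //.
have S2 := sym_connect_sym (link_sym K1 (repairK K' f h)).
(* [N1] and [N'] both preserve [S], so the orbit of [f] stays in it; the new pair is a component of
   its own and gets attached. *)
have oS : N' h \notin porbit (N1 * N')%g f.
  apply: contra N1hS; rewrite Nh => hO; apply: (porbit_closed (A := S) _ fS hO) => z zS.
  by rewrite permM cl' cl1.
have pres := repair_connect K1 K' F1 F' hf.
have fh : connect (link N1 N2) f h by apply: connect1; rewrite /link (repair_f F' hf) eqxx orbT.
have H d : d \in S :|: [set h; N1 h] -> connect (link N1 N2) f d.
  rewrite !inE => /or3P[dS|/eqP->|/eqP->] //; first by apply: pres => //; apply: con.
  by apply: connect_trans fh _; apply: connect1; rewrite /link eqxx.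
by move=> b c /H bS /H cS'; apply: connect_trans cS'; rewrite S2.
Qed.

Section Models.
Import GRing.Theory.
Variable n : nat.
Local Notation Z := 'I_n.+1.
Local Open Scope ring_scope.

Definition generates (d : Z) := forall y : Z, exists k, y = d *+ k.

Lemma generates1 : generates (inZp 1).
Proof.
move=> y; exists y; rewrite Zp_mulrn; apply: val_inj => /=.
by rewrite modnMml mul1n modn_small.
Qed.

Lemma generatesN d : generates d -> generates (- d).
Proof. by move=> g y; have [k E] := g (- y); exists k; rewrite mulNrn -E opprK. Qed.

Lemma generates_double d : ~~ odd n -> generates d -> generates (d + d).
Proof.
(* [n./2.+1] is the inverse of 2 modulo the odd number [n.+1]. *)
move=> no g y; have [k ->] := g y; exists (n./2.+1 * k)%N.
rewrite -mulr2n -mulrnA mulnA mulrnA; congr (_ *+ _).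
rewrite Zp_mulrn; apply: val_inj => /=.
rewrite (_ : 2 * n./2.+1 = n.+1 + 1)%N; last by lia.
by rewrite mulnDr muln1 modnMDl modn_small.
Qed.

Lemma double_eq0 (y : Z) : ~~ odd n -> y + y = 0 -> y = 0.
Proof.
move=> no /(congr1 val) /= E; apply: val_inj => /=.
have := ltn_ord y; move: E; move: (val y) => k E kn.
have : (n.+1 %| k + k)%N by apply/dvdnP; exists ((k + k) %/ n.+1)%N; rewrite {1}(divn_eq (k + k) n.+1) E addn0.
case/dvdnP => -[|[|j]] H; lia.
Qed.

(** Steps of size [d] starting from [x] pass through [x0], unless [z] has been reached before. *)
Lemma connect_generates (T : finType) (r : rel T) (g : Z -> T) (d : Z) (x0 : Z) (z : T) :
  generates d -> connect_sym r -> connect r (g x0) z ->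
  (forall x, connect r (g x) z \/ connect r (g x) (g (x + d))) ->
  forall x, connect r (g x) z.
Proof.
move=> gd Sy c0 H x; have [k E] := gd (x0 - x).
have : connect r (g x) z \/ connect r (g x) (g (x + d *+ k)).
  elim: k {E} => [|k [IH|IH]]; [by right; rewrite mulr0n addr0|by left|].
  have := H (x + d *+ k); rewrite -addrA -mulrSr => -[h|h]; [left|right];
    exact: connect_trans IH h.
by case=> // h; apply: connect_trans h _; rewrite -E addrC subrK.
Qed.

(** The reflection in [c] on the cyclic group, with its fixed point [c] matched to the point at
    infinity [None]. For odd group order these are the classes of the classical 1-factorization of a
    complete graph. *)
Definition reflect_fun (c : Z) (b : option Z) : option Z :=
  if b is Some x then if x == c then None else Some (c + c - x) else Some c.

Lemma reflect_funK c : involutive (reflect_fun c).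
Proof.
case=> [x|] /=; last by rewrite eqxx.
case: (boolP (x == c)) => [/eqP->//|xc] /=.
case: (boolP (c + c - x == c)) => [/eqP E|_]; last by congr Some; rewrite opprB addrC subrK.
by case/eqP: xc; apply: (addIr c); rewrite -[in LHS]E addrC subrK.
Qed.

Definition reflect_perm c : {perm option Z} := perm (can_inj (reflect_funK c)).

Lemma reflect_pairing c : ~~ odd n -> pairing (reflect_perm c).
Proof.
move=> no; split; first by move=> b; rewrite !permE reflect_funK.
case=> [x|]; rewrite permE //=; case: (boolP (x == c)) => [//|xc].
apply: contra xc => /eqP[E]; rewrite -subr_eq0; apply/eqP/double_eq0 => //.
have H : c + c = x + x by rewrite -[LHS](subrK x) E.
by rewrite addrACA -opprD H subrr.
Qed.

(** Two reflections compose to the translation by [2(d - c)], a generator because the group order is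
    odd; the walk ends at [None]. *)
Lemma reflect_joined c d : ~~ odd n -> generates (d - c) ->
  joined (reflect_perm c) (reflect_perm d).
Proof.
move=> no g; have Pc := reflect_pairing c no; have Pd := reflect_pairing d no.
have Sy := sym_connect_sym (link_sym (pairingK Pc) (pairingK Pd)).
have ec b : connect (link (reflect_perm c) (reflect_perm d)) b (reflect_fun c b).
  by apply: connect1; rewrite /link permE eqxx.
have ed b : connect (link (reflect_perm c) (reflect_perm d)) b (reflect_fun d b).
  by apply: connect1; rewrite /link !permE eqxx orbT.
have H b : connect (link (reflect_perm c) (reflect_perm d)) b None.
  case: b => [x|] //; move: x.
  apply: (connect_generates (x0 := c) (generates_double no g)) => //.
    by have := ec (Some c); rewrite /= eqxx.
  move=> x; have := ec (Some x) => /=; case: (boolP (x == c)) => [_ h|_ h]; first by left.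
  have := ed (Some (c + c - x)) => /=; case: (boolP (_ == d)) => [_ h'|_ h']; first by left; apply: connect_trans h h'.
  right; apply: connect_trans h _; move: h'; rewrite (_ : d + d - _ = x + (d - c + (d - c))) //.
  by rewrite opprB addrCA; congr (_ + _); rewrite addrACA -opprD.
by move=> b b'; apply: connect_trans (H b) _; rewrite Sy.
Qed.

(** Perfect matchings between two copies of the cyclic group. They share the bipartition given by
    the second component, and two of them compose to a translation by the difference of their
    shifts. *)
Definition shift_fun (c : Z) (b : Z * bool) : Z * bool :=
  (if b.2 then b.1 - c else b.1 + c, ~~ b.2).

Lemma shift_funK c : involutive (shift_fun c).
Proof. by case=> x [] /=; rewrite /shift_fun /= ?subrK ?addrK. Qed.

Definition shift_perm c : {perm Z * bool} := perm (can_inj (shift_funK c)).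

Lemma shift_pairing c : pairing (shift_perm c).
Proof.
split; first by move=> b; rewrite !permE shift_funK.
by case=> x s; rewrite permE xpair_eqE /= negb_and; case: s; rewrite orbT.
Qed.

Lemma shift_joined c d : generates (d - c) -> joined (shift_perm c) (shift_perm d).
Proof.
move=> g; have Pc := shift_pairing c; have Pd := shift_pairing d.
have Sy := sym_connect_sym (link_sym (pairingK Pc) (pairingK Pd)).
have ec b : connect (link (shift_perm c) (shift_perm d)) b (shift_fun c b).
  by apply: connect1; rewrite /link permE eqxx.
have ed b : connect (link (shift_perm c) (shift_perm d)) b (shift_fun d b).
  by apply: connect1; rewrite /link !permE eqxx orbT.
have H x : connect (link (shift_perm c) (shift_perm d)) (x, false) (0, false).
  apply: (connect_generates (g := fun x => (x, false)) (x0 := 0) g) => // y; right.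
  have := connect_trans (ed (y, false)) (ec _); rewrite /shift_fun /=.
  by rewrite addrA.
have H' b : connect (link (shift_perm c) (shift_perm d)) b (0, false).
  case: b => x [] //; apply: connect_trans (ec _) _; exact: H.
by move=> b b'; apply: connect_trans (H' b) _; rewrite Sy.
Qed.

End Models.

Definition quad_face (V : finType) (th : {perm flag V}) (k0 k1 k2 k3 : flag V) :=
  let r := (swap_vertex V * th)%g in [/\ r k0 = k1, r k1 = k2, r k2 = k3 & r k3 = k0].

Lemma bijection_onto (V EV : finType) (Y : {set V}) (b0 : EV) (y0 : V) :
  #|EV| = #|Y| -> y0 \in Y ->
  exists be : EV -> V, [/\ injective be, be b0 = y0 & forall u, u \in Y <-> exists b, u = be b].
Proof.
move=> c yY.
pose g (b : EV) := enum_val (cast_ord c (enum_rank b)).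
have gI : injective g by move=> b b' /enum_val_inj /cast_ord_inj /enum_rank_inj.
have gY b : g b \in Y by apply: enum_valP.
have gS u : u \in Y -> exists b, u = g b.
  move=> uY; exists (enum_val (cast_ord (esym c) (enum_rank_in yY u))).
  by rewrite /g enum_valK cast_ordKV enum_rankK_in.
have [b1 Eb1] := gS _ yY.
pose be b := g (tperm b0 b1 b); exists be; split.
- by move=> b b' /gI /perm_inj.
- by rewrite /be tpermL.
move=> u; split=> [/gS[b ->]|[b ->]]; last exact: gY.
by exists (tperm b0 b1 b); rewrite /be tpermK.
Qed.

Section BlockFaces.
Variables (V : finType) (e : rel V) (EV : finType) (m : nat).
Variables (al : nat -> V) (be : EV -> V) (M : nat -> EV -> EV) (S : {set EV}).
Hypothesis H : block_data e m al be M S.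
Local Notation th := (block_th H).
Local Notation r := (swap_vertex V * th)%g.

Lemma block_rA i b s : ins m S i b -> r (al i, be b, s) = (be b, al (nxt m S b s i), ~~ s).
Proof.
move=> ib; rewrite permM th0E /turn_edge /= (negbTE (bd_ab H b ib)) addbF.
by rewrite block_thB.
Qed.

Lemma block_rB i b s : ins m S i b -> r (be b, al i, s) = (al i, be (gap m M i s b), s).
Proof.
move=> ib; rewrite permM th0E /turn_edge /= eq_sym (negbTE (bd_ab H b ib)) addbF.
by rewrite block_thA.
Qed.

Lemma block_face_first b : 1 < m ->
  quad_face th (al 0, be b, true) (be b, al 1, false) (al 1, be (M 0 b), false) (be (M 0 b), al 0, true).
Proof.
move=> m1; have i0 c : ins m S 0 c by rewrite /ins (ltnW m1).
have i1 c : ins m S 1 c by rewrite /ins m1.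
have n0 c : nxt m S c true 0 = 1 by rewrite /nxt; case: (c \in S); case: ifP => //; clear -m1; lia.
have n1 c : nxt m S c false 1 = 0 by rewrite /nxt.
split; rewrite ?block_rA ?block_rB // ?n0 ?n1 //.
by rewrite /gap /= (bd_K H).
Qed.

Lemma block_face_wrap b : S = set0 ->
  quad_face th (be b, al m.-1, true) (al m.-1, be (M m.-1 b), true)
    (be (M m.-1 b), al 0, false) (al 0, be b, false).
Proof.
move=> S0; have m0 := bd_m H; have i0 c : ins m S 0 c by rewrite /ins m0.
have i1 c : ins m S m.-1 c by rewrite /ins; clear -m0; lia.
have n0 c : nxt m S c true m.-1 = 0 by rewrite /nxt S0 inE eqxx.
have n1 c : nxt m S c false 0 = m.-1 by rewrite /nxt S0 inE.
have E : M m (M m.-1 b) = b by rewrite (bd_out H) ?S0 ?inE // (bd_K H) // leq_pred.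
by split; rewrite ?block_rA ?block_rB // ?n0 ?n1 // /gap E.
Qed.

Lemma block_face_extra b : b \in S ->
  quad_face th (al m, be b, true) (be b, al 0, false) (al 0, be (M m b), false) (be (M m b), al m, true).
Proof.
move=> bS; have m0 := bd_m H; have i0 c : ins m S 0 c by rewrite /ins m0.
have bS' : M m b \in S by rewrite (bd_S H).
have im c : c \in S -> ins m S m c by move=> cS; rewrite /ins eqxx cS orbT.
have n0 c : c \in S -> nxt m S c true m = 0 by move=> cS; rewrite /nxt cS eqxx.
have n1 c : c \in S -> nxt m S c false 0 = m by move=> cS; rewrite /nxt cS.
by split; rewrite ?block_rA ?block_rB ?im ?i0 // ?n0 ?n1 // /gap (bd_K H).
Qed.

(** A common bipartition of the matchings orients the block: a corner at [al i] changes the class of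
    [be], one at [be b] changes the side. *)
Lemma block_coloring (colE : EV -> bool) :
  (forall i b, i <= m -> colE (M i b) = ~~ colE b) ->
  exists col : flag V -> bool, forall f, on e f ->
  [/\ col (swap_vertex V f) = ~~ col f, col (swap_side V f) = ~~ col f & col (th f) = ~~ col f].
Proof.
move=> cM.
pose cv u := if [pick b | be b == u] is Some b then Some b else None.
have cvB b : cv (be b) = Some b.
  by rewrite /cv; case: pickP => [c /eqP/(bd_be H) ->|/(_ b)]; rewrite ?eqxx.
have cvA i b : ins m S i b -> cv (al i) = None.
  by move=> ib; rewrite /cv; case: pickP => // c; rewrite eq_sym (negbTE (bd_ab H c ib)).
pose col (f : flag V) := f.2 (+) (if cv f.1.2 is Some b then colE b else
  if cv f.1.1 is Some b then ~~ colE b else false).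
have colA i b s : ins m S i b -> col (al i, be b, s) = s (+) colE b by rewrite /col /= cvB.
have colB i b s : ins m S i b -> col (be b, al i, s) = ~~ (s (+) colE b).
  by move=> ib; rewrite /col /= (cvA _ _ ib) cvB addbN.
exists col => f /(block_flag H)[i [b [s [ib [->|->]]]]]; rewrite th0E th2E /turn_edge /turn_side /=.
  rewrite (negbTE (bd_ab H b ib)) addbF block_thA // !colA ?colB //; last exact: (ins_gap H).
  by rewrite addNb /gap cM ?addbN //; apply/gap_le/(ins_le ib).
rewrite eq_sym (negbTE (bd_ab H b ib)) addbF block_thB // !colB ?colA //; last exact: (ins_nxt H).
by rewrite !addNb negbK.
Qed.

(* Colours do not change along the rotation at be b, so they would give a proper
   2-colouring of the odd cycle b1 b2 b3 of the matchings M 0, M 1, M 2. *)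
Lemma block_no_coloring (b1 b2 b3 : EV) (Exc col : flag V -> bool) : 2 < m ->
  M 0 b1 = b2 -> M 1 b2 = b3 -> M 2 b3 = b1 ->
  (forall b i, i < 2 -> b \in [:: b1; b2; b3] -> ~~ Exc (be b, al i, true)) ->
  ~~ Exc (al 0, be b1, true) -> ~~ Exc (al 1, be b2, true) -> ~~ Exc (al 2, be b3, true) ->
  (forall f, on e f -> col (swap_vertex V f) = ~~ col f /\ col (swap_side V f) = ~~ col f) ->
  (forall f, on e f -> ~~ Exc f -> col (th f) = ~~ col f) -> False.
Proof.
move=> m2 E0 E1 E2 ex1 ea eb ec c02 cth.
have ii i c : i < 3 -> ins m S i c by move=> i3; rewrite /ins (leq_trans i3 m2).
have onB i c s : i < 3 -> on e (be c, al i, s).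
  by move=> i3; rewrite /on /= (bd_sym H) (bd_e1 H (ii i c i3)).
have onA i c s : i < 3 -> on e (al i, be c, s) by move=> i3; apply: (bd_e1 H (ii i c i3)).
have cA i c : i < 3 -> col (al i, be c, true) = ~~ col (be c, al i, true).
  move=> i3; have [<- _] := c02 _ (onB i c true i3).
  by rewrite th0E /turn_edge /= eq_sym (negbTE (bd_ab H c (ii i c i3))).
have chi i c : i < 2 -> c \in [:: b1; b2; b3] -> col (be c, al i.+1, true) = col (be c, al i, true).
  move=> i2 cb; have := cth _ (onB i c true (ltnW i2)) (ex1 _ _ i2 cb).
  have n1 : nxt m S c true i = i.+1.
    by rewrite /nxt; case: (c \in S); case: ifP => //; clear -m2 i2; lia.
  rewrite (block_thB H _ (ii i c (ltnW i2))) n1 => E.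
  have [_] := c02 _ (onB i.+1 c true i2); rewrite th2E /turn_side /= => E'.
  by apply: negb_inj; rewrite -E -E'.
have [m0 m1 m3] : [/\ b1 \in [:: b1; b2; b3], b2 \in [:: b1; b2; b3] & b3 \in [:: b1; b2; b3]].
  by rewrite !inE !eqxx !orbT.
have g0 := cth _ (onA 0 b1 true isT) ea; have g1 := cth _ (onA 1 b2 true isT) eb.
have g2 := cth _ (onA 2 b3 true isT) ec.
move: g0 g1 g2; rewrite !block_thA ?ii // /gap E0 E1 E2 !cA //.
rewrite !(chi 1) // !(chi 0) //.
by case: (col _); case: (col _); case: (col _).
Qed.

End BlockFaces.

Definition star_half (V : finType) (X Y : {set V}) (y : V) (S : {set V}) : rel V :=
  fun u w => (u \in X) && (w \in Y) || (u == y) && (w \in S).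

Definition star_rel (V : finType) (X Y : {set V}) (y : V) (S : {set V}) : rel V :=
  fun u w => star_half X Y y S u w || star_half X Y y S w u.

Section StarBlock.
Variables (V : finType) (X Y : {set V}) (y v0 : V) (EV : finType) (be : EV -> V).
Variables (M : nat -> {perm EV}) (S : {set EV}).
Local Notation m := #|X|.

Definition star_al (i : nat) : V := if i < m then nth v0 (enum X) i else y.

Lemma star_block :
  [disjoint X & Y] -> 0 < m -> injective be -> (forall u, u \in Y <-> exists b, u = be b) ->
  (S != set0 -> (y \notin X) && (y \notin Y)) ->
  (forall i, i <= m -> pairing (M i)) ->
  (forall b, b \notin S -> M m b = M m.-1 b) ->
  (forall b, (M m b \in S) = (b \in S)) -> (forall b, (M m.-1 b \in S) = (b \in S)) ->
  (forall i, i < m -> joined (M i) (M (if i == 0 then m else i.-1))) ->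
  {in S &, forall b c, connect (link (M m) (M m.-1)) b c} ->
  block_data (star_rel X Y y (be @: S)) m star_al be M S.
Proof.
move=> dXY m0 beI beY yS MP Mout MS MS' ML MLS.
have alX i : i < m -> star_al i \in X.
  by move=> im; rewrite /star_al im -mem_enum mem_nth // -cardE.
have beYb b : be b \in Y by apply/beY; exists b.
have insm b : ins m S m b -> [/\ b \in S, y \notin X & y \notin Y].
  rewrite /ins ltnn eqxx /= => bS; have /yS/andP[] // : S != set0.
  by apply/set0Pn; exists b.
have ale : star_al m = y by rewrite /star_al ltnn.
have insE i b : ins m S i b -> i < m \/ i = m /\ b \in S.
  by case/orP=> [|/andP[/eqP-> bS]]; [left|right].
split=> //.
- by move=> u w; rewrite /star_rel orbC.
- move=> i j b c /insE ib /insE jc.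
  case: ib => [im|[-> bS]]; case: jc => [jm|[-> cS]] //.
  + rewrite /star_al im jm => /eqP; rewrite nth_uniq -?cardE ?enum_uniq //; exact: eqP.
  + rewrite ale => E; have /andP[] := yS (introT (set0Pn _) (ex_intro _ c cS)).
    by rewrite -E alX.
  rewrite ale => E; have /andP[] := yS (introT (set0Pn _) (ex_intro _ b bS)).
  by rewrite E alX.
- move=> i b c /insE[im|[-> bS]].
    by apply: contraTneq (beYb c) => <-; rewrite (disjointFr dXY (alX _ im)).
  rewrite ale; have /andP[_] := yS (introT (set0Pn _) (ex_intro _ b bS)).
  by apply: contraNneq => ->.
- move=> i b /insE[im|[-> bS]]; rewrite /star_rel /star_half.
    by rewrite alX // beYb.
  by rewrite ale eqxx imset_f // orbT.
- move=> u w.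
  have D a b : star_half X Y y (be @: S) a b -> exists i c, ins m S i c /\ a = star_al i /\ b = be c.
    case/orP=> [/andP[aX /beY[c ->]]|/andP[/eqP-> /imsetP[c cS ->]]].
      exists (index a (enum X)), c; have im : index a (enum X) < m by rewrite cardE index_mem mem_enum.
      by rewrite /ins im /star_al im nth_index ?mem_enum.
    by exists m, c; rewrite /ins eqxx cS orbT ale.
  by case/orP=> /D[i [c [ic [-> ->]]]]; exists i, c; split=> //; [left|right].
- by move=> i im; apply: pairingK (MP _ im).
- by move=> i b im; apply: pairingF (MP _ im) b.
move=> i b c /insE[im|[-> bS]] /insE[im'|[_ cS]].
- exact: ML.
- exact: ML.
- by rewrite ltnn in im'.
by have := MLS b c bS cS; rewrite /gap eqn0Ngt m0.
Qed.

End StarBlock.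

(** * Quadrangulations of the left block *)

Record sheet (V : finType) (e : rel V) (th : {perm flag V}) : Prop := Sheet {
  sheet_sym : symmetric e;
  sheet_corners : corners e th;
  sheet_linked : linked_at e th;
  sheet_quads : forall f, on e f -> ((swap_vertex V * th)%g ^+ 4)%g f = f }.

Lemma block_sheet (V EV : finType) (e : rel V) m al be (M : nat -> EV -> EV) S
  (H : block_data e m al be M S) : sheet e (block_th H).
Proof.
split; [exact: bd_sym H|exact: block_corners|exact: block_linked|exact: block_quads].
Qed.

Definition biclique (V : finType) (A B : {set V}) : rel V :=
  fun u w => (u \in A) && (w \in B) || (u \in B) && (w \in A).

(** The flags at [v] and [x] on the face v b x b'. They are the only flags of the left block whose
    corners are rerouted when the blocks are joined. *)
Definition corner_flags (V : finType) (v b x b' : V) (s0 s1 s2 s3 : bool) : seq (flag V) :=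
  [:: (v, b, s0); (v, b', s3); (x, b, s1); (x, b', s2)].

(* No change of th on Exc makes the surface orientable. *)
Definition rigid (V : finType) (e : rel V) th (Exc : seq (flag V)) :=
  forall col : flag V -> bool,
  (forall f, on e f -> col (swap_vertex V f) = ~~ col f /\ col (swap_side V f) = ~~ col f) ->
  (forall f, on e f -> f \notin Exc -> col (th f) = ~~ col f) -> False.

Lemma bicliqueC (V : finType) (X Y : {set V}) :
  biclique X Y = biclique Y X.
Proof.
by apply: functional_extensionality => u; apply: functional_extensionality => w; apply: orbC.
Qed.

Lemma star_rel0 (V : finType) (X Y : {set V}) y : star_rel X Y y set0 = biclique X Y.
Proof.
apply: functional_extensionality => u; apply: functional_extensionality => w.
by rewrite /star_rel /star_half !inE !andbF !orbF [(w \in X) && _]andbC.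
Qed.

Section LeftBlock.
Variables (V EV : finType) (X Y : {set V}) (N : nat -> {perm EV}).
Local Notation m := #|X|.
(* 0, 1, 2, 1, 2, ...: cyclically consecutive values differ. *)
Definition alternate (i : nat) := if i == 0 then 0 else if odd i then 1 else 2.
(** There is no extra vertex here, so [M m] repeats [M m.-1], as [bd_out] requires for empty [S]. *)
Definition left_match (i : nat) : {perm EV} := N (alternate (if i == m then m.-1 else i)).
Local Notation M := left_match.

Hypotheses (dXY : [disjoint X & Y]) (m0 : 0 < m) (cY : #|EV| = #|Y|).
Hypotheses (NP : forall k, pairing (N k)).
Hypothesis NJ : forall i, i < m ->
  joined (N (alternate i)) (N (alternate (if i == 0 then m.-1 else i.-1))).

Lemma left_block_data (b0 : EV) : exists v0 be,
  block_data (biclique X Y) m (star_al X v0 v0) be M (set0 : {set EV}).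
Proof.
have [v0 v0X] : exists v0, v0 \in X by apply/card_gt0P.
have [y0 y0Y] : exists y0, y0 \in Y by apply/card_gt0P; rewrite -cY; apply/card_gt0P; exists b0.
have [be [beI _ beY]] := bijection_onto b0 cY y0Y.
exists v0, be; rewrite -(star_rel0 X Y v0) -(imset0 be); apply: star_block => //.
- by rewrite eqxx.
- by move=> i _; apply: NP.
- by move=> b _; rewrite /M eqxx ltn_eqF // prednK.
- by move=> b; rewrite !inE.
- by move=> b; rewrite !inE.
- move=> i im; have := NJ im; rewrite /M (ltn_eqF im).
  case: i im => [|i] im /=; first by rewrite eqxx.
  by rewrite (ltn_eqF (ltnW im)).
by move=> b c; rewrite inE.
Qed.

(** A closed walk of length three in the union of the pairings; it feeds [block_no_coloring]. *)
Definition odd_cycle (b1 : EV) := N 2 (N 1 (N 0 b1)) = b1.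

(** Variant with [v] and [x] in the cyclically ordered class: the chosen face lies between [al 0]
    and [al 1]. *)
Lemma left_cyclic (b0 : EV) : 1 < m ->
  exists v x b b' s0 s1 s2 s3 th,
  [/\ [/\ v \in X, x \in X & v != x], sheet (biclique X Y) th,
      quad_face th (v, b, s0) (b, x, s1) (x, b', s2) (b', v, s3),
      (forall colE : EV -> bool, (forall k b, colE (N k b) = ~~ colE b) ->
        exists col, flips_on (biclique X Y) th col) &
      (2 < m -> odd_cycle (N 0 (N 1 b0)) -> rigid (biclique X Y) th (corner_flags v b x b' s0 s1 s2 s3))].
Proof.
move=> m1; have [v0 [be H]] := left_block_data b0.
set al := star_al X v0 v0 in H.
exists (al 0), (al 1), (be b0), (be (M 0 b0)), true, false, false, true, (block_th H).
have alX i : i < m -> al i \in X.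
  by move=> im; rewrite /al /star_al im -mem_enum mem_nth // -cardE.
have i0 i (c : EV) : i < m -> ins m set0 i c by rewrite /ins => ->.
have alI i j : i < m -> j < m -> (al i == al j) = (i == j).
  move=> im jm; apply/eqP/eqP => [|->//]; exact: (bd_al H (i0 i b0 im) (i0 j b0 jm)).
split.
- by rewrite !alX // alI.
- exact: block_sheet.
- exact: block_face_first.
- move=> colE cE; have [|col colP] := block_coloring H (colE := colE).
    by move=> i b _; apply: cE.
  by exists col.
move=> m2 cyc col c02 cth.
have M0 : M 0 = N 0 by rewrite /M ltn_eqF.
have M1 : M 1 = N 1 by rewrite /M ltn_eqF.
have M2 : M 2 = N 2 by rewrite /M ltn_eqF.
have K k := pairingK (NP k); have F k := pairingF (NP k).
(* The triangle is b1, [N 1 b0], b0. Its pair from [N 0] differs from the pair [b0], [N 0 b0] of the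
   chosen face, so its corner at [al 0] is not exceptional. *)
set b1 := N 0 (N 1 b0) in cyc.
have E2 : N 0 b1 = N 1 b0 by rewrite /b1 K.
have E3 : N 1 (N 0 b1) = b0 by rewrite E2 K.
have nb1 : b1 != b0.
  by apply: contraTneq isT => E; have := F 2 b0; rewrite -{1}E3 cyc E eqxx.
apply: (@block_no_coloring _ _ _ _ _ _ _ _ H b1 (N 0 b1) (N 1 (N 0 b1))
   (fun f => f \in corner_flags (al 0) (be b0) (al 1) (be (M 0 b0)) true false false true) col m2) => //.
- by rewrite M0.
- by rewrite M1.
- by rewrite M2.
- move=> b i i2 _; rewrite !inE !xpair_eqE.
  have n j : (be b == al j) && (j < m) = false.
    by apply/negbTE/andP => -[/eqP E jm]; have := bd_ab H b (i0 j b jm); rewrite E eqxx.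
  have := n 0; have := n 1; rewrite m1 (ltnW m1) !andbT => -> ->; by rewrite !andFb.
- rewrite !inE !xpair_eqE alI // ?(ltnW m1) //= !andbF !andbT !orbF.
  rewrite !(inj_eq (bd_be H)) negb_or nb1 M0 /b1 (inj_eq perm_inj); exact: F.
- by rewrite !inE !xpair_eqE alI // ?(ltnW m1) //= !andbF.
- by rewrite !inE !xpair_eqE !alI // ?(ltnW m1) //.
Qed.

(** Variant with [v] and [x] in the paired class. The face between [al m.-1] and [al 0] is taken,
    away from the corners at the indices 0, 1, 2 that the triangle needs. *)
Lemma left_matched (b0 : EV) :
  exists v x b b' s0 s1 s2 s3 th,
  [/\ [/\ v \in Y, x \in Y & v != x], sheet (biclique Y X) th,
      quad_face th (v, b, s0) (b, x, s1) (x, b', s2) (b', v, s3),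
      (forall colE : EV -> bool, (forall k b, colE (N k b) = ~~ colE b) ->
        exists col, flips_on (biclique Y X) th col) &
      (2 < m -> odd_cycle b0 -> rigid (biclique Y X) th (corner_flags v b x b' s0 s1 s2 s3))].
Proof.
have [v0 [be H]] := left_block_data b0.
set al := star_al X v0 v0 in H.
rewrite bicliqueC in H.
exists (be b0), (be (M m.-1 b0)), (al m.-1), (al 0), true, true, false, false, (block_th H).
have i0 i (c : EV) : i < m -> ins m set0 i c by rewrite /ins => ->.
have alI i j : i < m -> j < m -> (al i == al j) = (i == j).
  move=> im jm; apply/eqP/eqP => [|->//]; exact: (bd_al H (i0 i b0 im) (i0 j b0 jm)).
have beY b : be b \in Y.
  have := bd_e1 H (i0 0 b m0); rewrite /biclique /al /star_al m0.
  have aX : nth v0 (enum X) 0 \in X by rewrite -mem_enum mem_nth // -cardE.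
  by rewrite aX (disjointFr dXY aX).
have mm : m.-1 < m by rewrite prednK.
split.
- split=> //; rewrite (inj_eq (bd_be H)) eq_sym; exact: (bd_F H) (leq_pred _).
- exact: block_sheet.
- exact: block_face_wrap.
- move=> colE cE; have [|col colP] := block_coloring H (colE := colE).
    by move=> i b _; apply: cE.
  by exists col.
move=> m2 cyc col c02 cth.
have M0 : M 0 = N 0 by rewrite /M ltn_eqF.
have M1 : M 1 = N 1 by rewrite /M ltn_eqF // ltnW.
have M2 : M 2 = N 2 by rewrite /M ltn_eqF.
apply: (@block_no_coloring _ _ _ _ _ _ _ _ H b0 (N 0 b0) (N 1 (N 0 b0))
   (fun f => f \in corner_flags (be b0) (al m.-1) (be (M m.-1 b0)) (al 0) true true false false) col m2) => //.
- by rewrite M0.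
- by rewrite M1.
- by rewrite M2.
- move=> b i i2 _; rewrite !inE !xpair_eqE /= !andbF !andbT !alI ?(ltn_trans i2) //.
  have -> : (i == m.-1) = false by apply/eqP; clear -i2 m2; lia.
  by rewrite !andbF.
- by rewrite !inE !xpair_eqE !(negbTE (bd_ab H _ (i0 0 b0 m0))).
- by rewrite !inE !xpair_eqE !(negbTE (bd_ab H _ (i0 1 b0 (ltnW m2)))).
- by rewrite !inE !xpair_eqE !(negbTE (bd_ab H _ (i0 2 b0 m2))).
Qed.

End LeftBlock.

(** * Left and right blocks *)

Lemma alternate_joined (EV : finType) (N : nat -> {perm EV}) m : 1 < m ->
  (forall a b, a < 3 -> b < 3 -> a != b -> joined (N a) (N b)) ->
  forall i, i < m -> joined (N (alternate i)) (N (alternate (if i == 0 then m.-1 else i.-1))).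
Proof.
move=> m1 J i im; have lt j : alternate j < 3 by rewrite /alternate; case: ifP => // _; case: ifP.
apply: J => //; case: i im => [|[|i]] im; rewrite /alternate /=.
- by case: m m1 im => [|[|[|m]]] //= _ _; case: (odd m).
- by [].
by case: (odd i).
Qed.

(** Only a class of even size can be paired: this is A for odd [p] and B for even [p]. The
    cyclically ordered class then has odd size. *)
Lemma left_sheet (V EV : finType) (A B : {set V}) p (N : nat -> {perm EV}) :
  [disjoint A & B] -> #|A| = p.+1 -> #|B| = p -> 0 < p ->
  #|EV| = (if odd p then p.+1 else p) -> (forall k, pairing (N k)) ->
  (forall i, i < (if odd p then p else p.+1) ->
     joined (N (alternate i)) (N (alternate (if i == 0 then (if odd p then p else p.+1).-1 else i.-1)))) ->
  forall b0 : EV,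
  exists v x b b' s0 s1 s2 s3 th,
  [/\ [/\ v \in A, x \in A & v != x], sheet (biclique A B) th,
      quad_face th (v, b, s0) (b, x, s1) (x, b', s2) (b', v, s3),
      (forall colE : EV -> bool, (forall k b, colE (N k b) = ~~ colE b) ->
        exists col, flips_on (biclique A B) th col) &
      (2 < p -> odd_cycle N (if odd p then b0 else N 0 (N 1 b0)) ->
        rigid (biclique A B) th (corner_flags v b x b' s0 s1 s2 s3))].
Proof.
move=> dAB cA cB p0 + NP + b0; case: (boolP (odd p)) => op.
  have dBA : [disjoint B & A] by rewrite disjoint_sym.
  rewrite -cA -{1 2}cB => cE NJ; have B0 : 0 < #|B| by rewrite cB.
  have [v [x [b [b' [s0 [s1 [s2 [s3 [th [h1 h2 h3 h4 h5]]]]]]]]]] := left_matched dBA B0 cE NP NJ b0.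
  by exists v, x, b, b', s0, s1, s2, s3, th; split=> // p2; apply: h5; rewrite cB.
rewrite -{1}cB -cA => cE NJ; have A0 : 0 < #|A| by rewrite cA.
have A1 : 1 < #|A| by rewrite cA.
have [v [x [b [b' [s0 [s1 [s2 [s3 [th [h1 h2 h3 h4 h5]]]]]]]]]] := left_cyclic dAB A0 cE NP NJ b0 A1.
by exists v, x, b, b', s0, s1, s2, s3, th; split=> // p2; apply: h5; rewrite cA ltnS ltnW.
Qed.

Section Left.
Import GRing.Theory.

(** The differences of 0, 1, 2 are 1 and 2 up to sign, and 2 generates because the order is odd. *)
Lemma generates3 n (a b : nat) : ~~ odd n -> a < 3 -> b < 3 -> a != b ->
  generates ((inZp 1 : 'I_n.+1) *+ b - (inZp 1 : 'I_n.+1) *+ a)%R.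
Proof.
move=> no; set u : 'I_n.+1 := inZp 1.
have g1 : generates u by apply: generates1.
have g2 : generates (u *+ 2)%R by rewrite mulr2n; apply: generates_double.
case: a b => [|[|[|a]]] // [|[|[|b]]] // _ _ _; rewrite ?mulr0n ?subr0 ?sub0r ?mulr1n //;
  try exact: generatesN.
- by rewrite mulr2n addrK.
by rewrite mulr2n opprD addrA subrr sub0r; apply: generatesN.
Qed.

Variables (V : finType) (A B : {set V}) (p : nat).
Hypotheses (dAB : [disjoint A & B]) (cA : #|A| = p.+1) (cB : #|B| = p).

(** The reflections in 0, 1, 2 send [None] to 0, then to 2, then back to [None]: an odd closed walk.
    The group must have at least three elements, hence the bound on [p]. *)
Lemma left_nonorientable : 2 < p ->
  exists v x b b' s0 s1 s2 s3 th,
  [/\ [/\ v \in A, x \in A & v != x], sheet (biclique A B) th,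
      quad_face th (v, b, s0) (b, x, s1) (x, b', s2) (b', v, s3) &
      rigid (biclique A B) th (corner_flags v b x b' s0 s1 s2 s3)].
Proof.
move=> p2.
pose n := if odd p then p.-1 else p.-2.
have no : ~~ odd n by rewrite /n; case: ifP; clear -p2; lia.
have n1 : 1 < n by rewrite /n; case: ifP; clear -p2; lia.
pose N k := reflect_perm ((inZp 1 : 'I_n.+1) *+ k)%R.
have NP k : pairing (N k) by apply: reflect_pairing.
have cE : #|{: option 'I_n.+1}| = (if odd p then p.+1 else p).
  by rewrite card_option card_ord /n; case: ifP; clear -p2; lia.
have NJ := @alternate_joined _ N (if odd p then p else p.+1).
have {}NJ := NJ _ (fun a b ha hb hab => reflect_joined no (generates3 no ha hb hab)).
have [||v [x [b [b' [s0 [s1 [s2 [s3 [th [h1 h2 h3 h4 h5]]]]]]]]]] :=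
    (* For even [p] the base point is chosen so that [N 0 (N 1 b0)] is [None]. *)
    left_sheet dAB cA cB _ cE NP (NJ _) (if odd p then None else N 1 (N 0 None)).
- by clear -p2; lia.
- by case: ifP; clear -p2; lia.
exists v, x, b, b', s0, s1, s2, s3, th; split=> //; apply: h5 => //.
have -> : (if odd p then if odd p then None else N 1 (N 0 None)
           else N 0 (N 1 (if odd p then None else N 1 (N 0 None)))) = None.
  by case: (odd p); rewrite ?(pairingK (NP 1)) ?(pairingK (NP 0)).
have u0 : (0%R == (inZp 1 : 'I_n.+1) *+ 1)%R = false.
  by apply/eqP => /(congr1 val) /=; rewrite modn_small // ltnS ltnW.
by rewrite /odd_cycle /N /reflect_perm; do 3!rewrite permE /= ?mulr0n ?u0 /=; rewrite subr0 -mulr2n mulr1n eqxx.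
Qed.

(** These residues make the genus (p-1)(p-2)/4 an integer. They are also those for which half of the
    paired class is odd, so that the shifts by 0, 1, 2 are pairwise joined. *)
Lemma left_orientable : (p %% 4 == 1) || (p %% 4 == 2) ->
  exists v x b b' s0 s1 s2 s3 th,
  [/\ [/\ v \in A, x \in A & v != x], sheet (biclique A B) th,
      quad_face th (v, b, s0) (b, x, s1) (x, b', s2) (b', v, s3) &
      exists col, flips_on (biclique A B) th col].
Proof.
move=> p4; pose n := (p %/ 4).*2.
have no : ~~ odd n by rewrite odd_double.
have p0 : 0 < p by clear -p4; lia.
pose N k := shift_perm ((inZp 1 : 'I_n.+1) *+ k)%R.
have NP k : pairing (N k) by apply: shift_pairing.
have cE : #|{: 'I_n.+1 * bool}| = (if odd p then p.+1 else p).
  by rewrite card_prod card_ord card_bool /n; case: ifP; clear -p4; lia.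
have [|v [x [b [b' [s0 [s1 [s2 [s3 [th [h1 h2 h3 h4 h5]]]]]]]]]] :=
    left_sheet dAB cA cB p0 cE NP _ (ord0, true).
  have J3 a b ha hb hab := shift_joined (@generates3 n a b no ha hb hab).
  have [p1|p1] := eqVneq p 1; last first.
    by apply: alternate_joined J3; case: ifP; clear -p1 p0; lia.
  have n0 : n = 0 by rewrite /n p1.
  rewrite p1 /= => -[] // _; apply: shift_joined => y; exists 0; apply: val_inj => /=.
  by apply/eqP; rewrite -leqn0 -[X in _ <= X]n0; exact: ltn_ord y.
exists v, x, b, b', s0, s1, s2, s3, th; split=> //.
by apply: (h4 (fun b => b.2)) => k c; rewrite permE.
Qed.

End Left.

Section Right.
Variables (V : finType) (X Y : {set V}) (y y0 : V) (w : nat).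
Hypotheses (dXY : [disjoint X & Y]) (yX : y \notin X) (yY : y \notin Y).
Hypotheses (m1 : 1 < #|X|) (cY : #|Y| = 2 * w) (w0 : 0 < w) (y0Y : y0 \in Y).
Local Notation m := #|X|.
Local Notation n := (2 * w).-2.
Local Notation EV := (option 'I_n.+1).

Definition right_sheet (S : {set V}) a n' t0 t1 t2 t3 th :=
  [/\ S \subset Y, y0 \in S, [/\ a \in X, n' \in S & n' != y0],
      sheet (star_rel X Y y S) th &
      quad_face th (y, y0, t0) (y0, a, t1) (a, n', t2) (n', y, t3)].

Lemma star_sheet (M : nat -> {perm EV}) (S : {set EV}) : None \in S ->
  (forall i, i <= m -> pairing (M i)) ->
  (forall b, b \notin S -> M m b = M m.-1 b) ->
  (forall b, (M m b \in S) = (b \in S)) -> (forall b, (M m.-1 b \in S) = (b \in S)) ->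
  (forall i, i < m -> joined (M i) (M (if i == 0 then m else i.-1))) ->
  {in S &, forall b c, connect (link (M m) (M m.-1)) b c} ->
  exists (S' : {set V}) a n' t0 t1 t2 t3 th, [/\ #|S'| = #|S|, right_sheet S' a n' t0 t1 t2 t3 th &
    forall colE : EV -> bool, (forall i b, i <= m -> colE (M i b) = ~~ colE b) ->
    exists col, flips_on (star_rel X Y y S') th col].
Proof.
move=> SN MP Mout MS MS' ML MLS.
have cE : #|{: EV}| = #|Y| by rewrite card_option card_ord cY; clear -w0; lia.
have [be [beI be0 beY]] := bijection_onto None cE y0Y.
have m0 : 0 < m := ltnW m1.
have H := star_block y0 dXY m0 beI beY (fun _ => introT andP (conj yX yY)) MP Mout MS MS' ML MLS.
have aX : star_al X y y0 0 \in X by rewrite /star_al m0 -mem_enum mem_nth // -cardE.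
exists (be @: S), (star_al X y y0 0), (be (M m None)), true, false, false, true, (block_th H); split.
- exact: card_imset.
- split.
  + by apply/subsetP => u /imsetP[b _ ->]; apply/beY; exists b.
  + by rewrite -be0 imset_f.
  + by split; rewrite ?imset_f ?MS // -be0 (inj_eq beI) (pairingF (MP _ _)).
  + exact: block_sheet.
  by have := block_face_extra H SN; rewrite be0 /star_al ltnn.
move=> colE cE'; have [|col colP] := block_coloring H (colE := colE); last by exists col.
by move=> i b im; apply: cE'.
Qed.

Let no : ~~ odd n. Proof. by clear -w0; lia. Qed.
Let N k := reflect_perm ((inZp 1 : 'I_n.+1) *+ k)%R.

Let NP k : pairing (N k). Proof. exact: reflect_pairing. Qed.

Let NJ a b : a < 3 -> b < 3 -> a != b -> joined (N a) (N b).
Proof. by move=> ha hb ab; apply: reflect_joined => //; apply: generates3. Qed.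

Lemma right_nonorientable i : 0 < i -> i <= w ->
  exists (S : {set V}) a n' t0 t1 t2 t3 th, #|S| = 2 * i /\ right_sheet S a n' t0 t1 t2 t3 th.
Proof.
move=> i0 iw; have [|N' [S [P' J' cS NS [S1 S2 S3 S4]]]] :=
  @grow_pairing _ _ _ None i (NP 0) (NP 1) (@NJ 0 1 isT isT isT) i0.
  by rewrite card_option card_ord; clear -iw w0; lia.
(* [N 1] is kept for index [m.-1], next to [N'] that was grown from it, and the other indices
   alternate between [N 0] and [N 2]. Cyclic neighbours are then joined whatever the parity of
   [m]. *)
pose M j := if j == m then N' else N (if j == m.-1 then 1 else if odd j then 2 else 0).
have Mm : M m = N' by rewrite /M eqxx.
have Mm1 : M m.-1 = N 1 by rewrite /M eqxx ltn_eqF // prednK // ltnW.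
have ME j : j < m -> M j = N (if j == m.-1 then 1 else if odd j then 2 else 0).
  by move=> jm; rewrite /M ltn_eqF.
have [||||||S' [a [n' [t0 [t1 [t2 [t3 [th [c h _]]]]]]]]] := star_sheet NS (M := M).
- by move=> j _; rewrite /M; case: ifP.
- by move=> b bS; rewrite Mm Mm1 S3.
- by move=> b; rewrite Mm.
- by move=> b; rewrite Mm1.
- move=> [|j] jm /=.
    rewrite Mm (ME _ jm) (_ : 0 == m.-1 = false) //.
    by clear -m1; lia.
  rewrite (ME _ jm) (ME _ (ltnW jm)).
  rewrite (_ : j == m.-1 = false); last by clear -jm; lia.
  by apply: NJ; case: ifP => _ //=; case: (odd j).
- by move=> b c bS cS'; rewrite Mm Mm1 (eq_connect (linkC _ _)); apply: S4.
by exists S', a, n', t0, t1, t2, t3, th; rewrite c.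
Qed.

(** For even [m] the two pairings [N 0] and [N 1] suffice, and any two pairings have a common
    bipartition. Here [S] is one pair of [N 1]. *)
Lemma right_orientable : ~~ odd m ->
  exists (S : {set V}) a n' t0 t1 t2 t3 th, [/\ #|S| = 2, right_sheet S a n' t0 t1 t2 t3 th &
    exists col, flips_on (star_rel X Y y S) th col].
Proof.
move=> om.
pose M j := N (if j == m then 1 else odd j).
have Mm : M m = N 1 by rewrite /M eqxx.
have Mm1 : M m.-1 = N 1.
  rewrite /M ltn_eqF; last by rewrite prednK // ltnW.
  by rewrite (_ : odd m.-1) //; clear -m1 om; lia.
have ME j : j < m -> M j = N (odd j) by move=> jm; rewrite /M ltn_eqF.
pose S := [set None; N 1 None].
have S1 b : (N 1 b \in S) = (b \in S).
  by rewrite !inE orbC (inj_eq perm_inj) (inv_eq (pairingK (NP 1))).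
have [|||||||S' [a [n' [t0 [t1 [t2 [t3 [th [c h h']]]]]]]]] := @star_sheet M S.
- by rewrite set21.
- by move=> j _; apply: NP.
- by move=> b bS; rewrite Mm Mm1.
- by move=> b; rewrite Mm.
- by move=> b; rewrite Mm1.
- move=> [|j] jm /=; first by rewrite Mm (ME _ jm); apply: NJ.
  rewrite (ME _ jm) (ME _ (ltnW jm)) /=.
  by apply: NJ; case: (odd j).
- move=> b c bS cS; rewrite Mm Mm1.
  have Sy := sym_connect_sym (link_sym (pairingK (NP 1)) (pairingK (NP 1))).
  have H d : d \in S -> connect (link (N 1) (N 1)) None d.
    by rewrite !inE => /orP[]/eqP-> //; apply: connect1; rewrite /link eqxx.
  by apply: connect_trans (H _ cS); rewrite Sy; apply: H.
exists S', a, n', t0, t1, t2, t3, th; split=> //.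
  by rewrite c cards2 eq_sym (pairingF (NP 1)).
have [colE cE] := two_coloring (pairingK (NP 0)) (pairingK (NP 1)) (pairingF (NP 0)) (pairingF (NP 1)).
apply: (h' colE) => j b jm; have [c0 c1] := cE b.
by rewrite /M; case: ifP => _; [|case: (odd j)].
Qed.

End Right.

(** * Joining two blocks *)

Lemma linked_agree (V : finType) (e : rel V) (th th' : {perm flag V}) f g :
  corners e th -> linked_at e th -> (forall f, on e f -> th' f = th f) ->
  on e f -> on e g -> tl f = tl g -> connect (link (swap_side V) th') f g.
Proof.
move=> C L E fo go fg; have /connectP[l] := L f g fo go fg.
elim: l f fo {fg} => [|h l IH] f fo /=; first by move=> _ ->.
case/andP=> fh pl gl; apply: connect_trans (IH h _ pl gl).
  by apply: connect1; move: fh; rewrite /link E.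
by case/orP: fh => /eqP ->; rewrite ?on2 ?(on_corner C).
Qed.

Section Union.
Variables (V : finType) (eL eR : rel V) (thL thR : {perm flag V}).
Hypotheses (L : sheet eL thL) (R : sheet eR thR).
Hypothesis dis : forall u w, eL u w -> ~~ eR u w.
Local Notation th0 := (swap_vertex V).
Local Notation th2 := (swap_side V).

Definition union_rel : rel V := fun u w => eL u w || eR u w.
(** Each corner map equals [swap_side] off its own edges. The product is therefore [thL] on left
    edges, [thR] on right edges and [swap_side] elsewhere. *)
Definition union_th : {perm flag V} := (thL * th2 * thR)%g.
Local Notation e := union_rel.
Local Notation th := union_th.

Lemma union_on f : on e f = on eL f || on eR f. Proof. by []. Qed.

Lemma union_L f : on eL f -> th f = thL f.
Proof.
move=> fo; rewrite !permM (corner_out (sheet_corners R)) ?th2K //.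
by apply: dis; rewrite -/(on eL _) on2 (on_corner (sheet_corners L)).
Qed.

Lemma union_R f : on eR f -> th f = thR f.
Proof.
move=> fo; rewrite !permM (corner_out (sheet_corners L)) ?th2K //.
by apply: contraTN fo; apply: dis.
Qed.

Lemma union_sym : symmetric e.
Proof. by move=> u w; rewrite /union_rel (sheet_sym L) (sheet_sym R). Qed.

Lemma union_corners : corners e th.
Proof.
have CL := sheet_corners L; have CR := sheet_corners R.
have out f : ~~ on e f -> th f = th2 f.
  rewrite union_on negb_or => /andP[fL fR].
  by rewrite !permM (corner_out CL) // th2K (corner_out CR).
have cases f : [\/ on eL f, on eR f | ~~ on e f].
  by rewrite union_on; case: (on eL f) (on eR f) => -[]; constructor.
split=> // f; case: (cases f) => fo.
- by rewrite (union_L fo) union_L ?(on_corner CL) // (cornerK CL).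
- by rewrite (union_R fo) union_R ?(on_corner CR) // (cornerK CR).
- by rewrite (out _ fo) out ?th2K // /on -/(on e _) on2.
- by rewrite union_L // (cornerF CL).
- by rewrite union_R // (cornerF CR).
- by rewrite out // th2F.
- by rewrite union_L // (corner_tl CL).
- by rewrite union_R // (corner_tl CR).
by rewrite out // tl2.
Qed.

Lemma agree_quads e1 th1 f : sheet e1 th1 -> (forall f, on e1 f -> th f = th1 f) ->
  on e1 f -> ((th0 * th)%g ^+ 4)%g f = f.
Proof.
move=> S1 E fo; rewrite -[RHS](sheet_quads S1 fo).
have st k : on e1 (((th0 * th1)%g ^+ k)%g f) /\ ((th0 * th)%g ^+ k)%g f = ((th0 * th1)%g ^+ k)%g f.
  elim: k => [|k [IH1 IH2]]; first by rewrite !expg0 !perm1.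
  rewrite !permXS IH2 (permM th0 th) (permM th0 th1).
  rewrite (on_corner (sheet_corners S1)) (on0 (sheet_sym S1)); split=> //.
  by apply: E; rewrite (on0 (sheet_sym S1)).
by have [] := st 4.
Qed.

Lemma union_quads f : on e f -> ((th0 * th)%g ^+ 4)%g f = f.
Proof. by case/orP=> fo; [exact: (agree_quads L union_L fo)|exact: (agree_quads R union_R fo)]. Qed.

(** All faces have length at most four, so there are at least half as many faces as edges;
    [porbits_darts] turns this into a bound over all flags. *)
Lemma union_porbits : irreflexive e ->
  2 * (#|V| * #|V| + #|V|) <= 2 * #|porbits (th0 * th)%g| + #|[pred p : V * V | e p.1 p.2]|.
Proof.
move=> ei; have := porbits_darts union_sym ei union_corners.
have cl := on_closed union_sym union_corners.
have le f : f \in on e -> fingraph.order (th0 * th)%g f <= 4.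
  by move=> fo; apply: order_leq => //; [apply: perm_inj | rewrite -permX; apply: union_quads].
have := card_leq_fcard (@perm_inj _ _) cl le; rewrite (_ : #|on e| = #|[pred p : V * V | e p.1 p.2]| * 2).
  move: (fcard _ _) (#|porbits _|) (#|V| * _) #|[pred p : V * V | _]| => F P Q D.
  by clear; lia.
by rewrite -card_bool -cardX; apply: eq_card => f; rewrite !inE andbT.
Qed.

(** Each block is linked by itself, so at a shared vertex one connection between a left and a right
    flag is enough. *)
Lemma union_linked (th' : {perm flag V}) : involutive th' ->
  (forall f g, connect (link th2 th) f g -> connect (link th2 th') f g) ->
  (forall f g, on eL f -> on eR g -> tl f = tl g -> exists f' g',
    [/\ on eL f', on eR g', tl f' = tl f, tl g' = tl f & connect (link th2 th') f' g']) ->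
  linked_at e th'.
Proof.
move=> K mono mix.
have Sy : connect_sym (link th2 th') by apply: sym_connect_sym; apply: link_sym => //; exact: th2K.
have cL f g (fo : on eL f) (go : on eL g) (E : tl f = tl g) := mono f g (linked_agree (sheet_corners L) (sheet_linked L) union_L fo go E).
have cR f g (fo : on eR f) (go : on eR g) (E : tl f = tl g) := mono f g (linked_agree (sheet_corners R) (sheet_linked R) union_R fo go E).
have cLR f g : on eL f -> on eR g -> tl f = tl g -> connect (link th2 th') f g.
  move=> fo go E; have [f' [g' [f'o g'o Ef Eg c]]] := mix f g fo go E.
  apply: connect_trans (cL f f' fo f'o (esym Ef)) _.
  by apply: connect_trans c _; apply: cR; rewrite // Eg.
move=> f g /orP[]fo /orP[]go E.
- exact: cL.
- exact: cLR.
- by rewrite Sy; apply: cLR.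
exact: cR.
Qed.

Lemma union_neq f g : on eL f -> on eR g -> f != g.
Proof. by move=> fo; apply: contraTneq => <-; apply: dis. Qed.

Lemma union_flips colL colR fL fR :
  flips_on eL thL colL -> flips_on eR thR colR -> on eL fL -> on eR fR ->
  exists col, [/\ flips_on e th col, col fL = false & col fR = false].
Proof.
move=> FL FR Lo Ro.
pose col f := if on eL f then colL f (+) colL fL else colR f (+) colR fR.
exists col; split; rewrite /col.
- move=> f fo; case: (boolP (on eL f)) => fL'.
    have [E0 E2 Eth] := FL f fL'.
    rewrite (on0 (sheet_sym L)) on2 fL' (union_L fL') (on_corner (sheet_corners L)) fL'.
    by rewrite E0 E2 Eth !addNb.
  have fR' : on eR f by move: fo; rewrite union_on (negbTE fL').
  have [E0 E2 Eth] := FR f fR'.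
  have nL g : on eR g -> on eL g = false by move=> go; apply: contraTF go; apply: dis.
  rewrite (on0 (sheet_sym L)) on2 (negbTE fL') (union_R fR') nL ?(on_corner (sheet_corners R)) //.
  by rewrite E0 E2 Eth !addNb.
- by rewrite Lo addbb.
by rewrite ifF ?addbb //; apply: contraTF Ro; apply: dis.
Qed.

End Union.

Lemma tl0 (V : finType) (f : flag V) : tl (swap_vertex V f) = f.1.2.
Proof. by rewrite th0E. Qed.

(** Off the graph the face map just exchanges the two ends of a pair, which [v != x] rules out. *)
Lemma quad_on (V : finType) (e : rel V) th (v b x b' : V) s0 s1 s2 s3 : sheet e th -> v != x ->
  quad_face th (v, b, s0) (b, x, s1) (x, b', s2) (b', v, s3) ->
  [/\ e v b, e b x, e x b' & e b' v].
Proof.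
move=> S vx [E0 E1 E2 _]; have C := sheet_corners S; have Sy := sheet_sym S.
have st f g : (swap_vertex V * th)%g f = g -> on e f -> on e g.
  by move=> <- fo; rewrite permM (on_corner C) (on0 Sy).
have o0 : on e (v, b, s0).
  apply: contraT => no; move: E0; rewrite permM (corner_out C) ?(on0 Sy) // th2E th0E.
  by case=> /= E; rewrite E eqxx in vx.
have o1 := st _ _ E0 o0; have o2 := st _ _ E1 o1; have o3 := st _ _ E2 o2.
by split.
Qed.

Lemma gadget_singleton (V : finType) (A B C D : {set V}) (v x a : V) (S : {set V}) :
  gadget A B C D v x S [set a] false =
  add_edge (union_rel (biclique A B) (star_rel C D v S)) a x.
Proof.
apply: functional_extensionality => u; apply: functional_extensionality => w.
rewrite /gadget /half_gadget /add_edge /union_rel /biclique /star_rel /star_half /= !inE.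
btauto.
Qed.

(** Seen from the right block, [v] joins the class C, and [x] becomes the extra vertex adjacent to
    [S]; the edge vx belongs to that block. *)
Lemma gadget_full (V : finType) (A B C D : {set V}) (v x : V) (S : {set V}) : v \in S ->
  gadget A B C D v x D (S :\ v) true =
  union_rel (biclique A B) (star_rel D (v |: C) x S).
Proof.
move=> vS; apply: functional_extensionality => u; apply: functional_extensionality => w.
rewrite /gadget /half_gadget /union_rel /biclique /star_rel /star_half /= !inE.
have Eu : (u \in S) = (u != v) && (u \in S) || (u == v) by case: (boolP (u == v)) => [/eqP->|_]; rewrite ?vS ?orbF ?orbT.
have Ew : (w \in S) = (w != v) && (w \in S) || (w == v) by case: (boolP (w == v)) => [/eqP->|_]; rewrite ?vS ?orbF ?orbT.
rewrite [in RHS]Eu [in RHS]Ew.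
btauto.
Qed.

(* The left face v b x b' and the right face v y0 a n' are merged at v; the edge
   xa then splits the merged face. *)
Section Even.
Variables (V : finType) (A B C D : {set V}) (v x : V) (p q : nat).
Hypothesis P : parts A B C D v x p q.
Variables (thL : {perm flag V}) (b b' : V) (s0 s1 s2 s3 : bool).
Hypothesis SL : sheet (biclique A B) thL.
Hypothesis QL : quad_face thL (v, b, s0) (b, x, s1) (x, b', s2) (b', v, s3).
Variables (thR : {perm flag V}) (S : {set V}) (y0 a n' : V) (t0 t1 t2 t3 : bool).
Hypothesis RS : right_sheet C D v y0 S a n' t0 t1 t2 t3 thR.
Local Notation th0 := (swap_vertex V).
Local Notation th2 := (swap_side V).
Local Notation eL := (biclique A B).
Local Notation eR := (star_rel C D v S).
Local Notation e := (union_rel eL eR).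
Local Notation th := (union_th thL thR).
Let l0 : flag V := (v, b, s0).
Let l1 : flag V := (b, x, s1).
Let l2 : flag V := (x, b', s2).
Let l3 : flag V := (b', v, s3).
Let k0 : flag V := (v, y0, t0).
Let k1 : flag V := (y0, a, t1).
Let k2 : flag V := (a, n', t2).
Let k3 : flag V := (n', v, t3).

Let SD : S \subset D. Proof. by case: RS. Qed.
Let SR : sheet eR thR. Proof. by case: RS. Qed.
Let QR : quad_face thR k0 k1 k2 k3. Proof. by case: RS. Qed.
Let aC : a \in C. Proof. by case: RS => _ _ []. Qed.

Lemma even_disjoint u w : eL u w -> ~~ eR u w.
Proof.
have nS z : z \in D = false -> z \in S = false.
  by move=> zD; apply: contraFF zD; apply/subsetP.
have [vA vB vC vD] := v_class P; rewrite /star_rel /star_half.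
case/orP=> /andP[].
  move=> /(class_A P)[_ _ -> uD] /(class_B P)[_ _ -> wD].
  by rewrite !(nS _ uD) !(nS _ wD) !andbF.
move=> /(class_B P)[_ _ -> uD] /(class_A P)[_ _ -> wD].
by rewrite !(nS _ uD) !(nS _ wD) !andbF.
Qed.
Local Notation dis := even_disjoint.

Let eLE u w : eL u w -> (u \in A) || (u \in B).
Proof. by case/orP=> /andP[->]; rewrite ?orbT. Qed.

Let eRE u w : eR u w -> [|| u \in C, u \in D | u == v].
Proof.
rewrite /eR /star_rel /star_half.
by case/orP=> [/orP[]|/orP[]] /andP[H1 H2]; rewrite ?H1 ?H2 ?orbT // (subsetP SD _ H2) orbT.
Qed.

Let onL : [/\ eL v b, eL b x, eL x b' & eL b' v].
Proof. exact: quad_on SL (part_vx P) QL. Qed.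

Let va : v != a.
Proof. by have [_ _ vC _] := v_class P; apply: contraFneq vC => ->. Qed.

Let xa : x != a.
Proof. by have [_ _ xC _] := x_class P; apply: contraFneq xC => ->. Qed.

Let onR : [/\ eR v y0, eR y0 a, eR a n' & eR n' v].
Proof. exact: quad_on SR va QR. Qed.

Let o0 : on eL l0. Proof. by case: onL. Qed.
Let o1 : on eL l1. Proof. by case: onL. Qed.
Let o2 : on eL l2. Proof. by case: onL. Qed.
Let o3 : on eL l3. Proof. by case: onL. Qed.
Let q0 : on eR k0. Proof. by case: onR. Qed.
Let q1 : on eR k1. Proof. by case: onR. Qed.
Let q2 : on eR k2. Proof. by case: onR. Qed.
Let q3 : on eR k3. Proof. by case: onR. Qed.

Let Le f : on eL f -> on e f. Proof. by rewrite union_on => ->. Qed.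
Let Re f : on eR f -> on e f. Proof. by rewrite union_on orbC => ->. Qed.
Let C0 := union_corners SL SR dis.
Let K0 := cornerK C0.
Let F0 := cornerF C0.
Let onL0 f : on eL (th0 f) = on eL f. Proof. exact: on0 (sheet_sym SL) f. Qed.
Let onR0 f : on eR (th0 f) = on eR f. Proof. exact: on0 (sheet_sym SR) f. Qed.

Let rL l l' : on eL l -> (th0 * thL)%g l = l' -> th (th0 l) = l'.
Proof. by move=> lo <-; rewrite (union_L SL SR dis) ?permM ?onL0. Qed.
Let rR l l' : on eR l -> (th0 * thR)%g l = l' -> th (th0 l) = l'.
Proof. by move=> lo <-; rewrite (union_R thR SL dis) ?permM ?onR0. Qed.

Let e01 : th (th0 l0) = l1. Proof. by case: QL => H _ _ _; apply: rL. Qed.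
Let e12 : th (th0 l1) = l2. Proof. by case: QL => _ H _ _; apply: rL. Qed.
Let e23 : th (th0 l2) = l3. Proof. by case: QL => _ _ H _; apply: rL. Qed.
Let e30 : th (th0 l3) = l0. Proof. by case: QL => _ _ _ H; apply: rL. Qed.
Let d01 : th (th0 k0) = k1. Proof. by case: QR => H _ _ _; apply: rR. Qed.
Let d12 : th (th0 k1) = k2. Proof. by case: QR => _ H _ _; apply: rR. Qed.
Let d30 : th (th0 k3) = k0. Proof. by case: QR => _ _ _ H; apply: rR. Qed.
Let e03 : th l0 = th0 l3. Proof. by rewrite -e30 K0. Qed.

(** At [v] the corners {[th0 k3], [k0]} and {[l0], [th0 l3]} become {[th0 k3], [l0]} and {[k0],
    [th0 l3]}. *)
Let th1 := repair th (th0 k3) l0.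

Let hf : l0 != th0 k3. Proof. by apply: (union_neq dis); rewrite ?onR0. Qed.
Let hf' : l0 != th (th0 k3). Proof. by rewrite d30; apply: (union_neq dis). Qed.

Let C1 : corners e th1.
Proof.
apply: (repair_corners C0) hf hf'; first by rewrite tl0.
  by apply: Re; rewrite onR0.
exact: Le.
Qed.

Let th1_out z : tl z != v -> th1 z = th z.
Proof.
move=> zv; have H f : tl f = v -> z != f by move=> fv; apply: contraNneq zv => ->; rewrite fv.
by rewrite /th1 (repair_out K0) // ?H ?d30 ?e03 ?tl0.
Qed.

Let mono f g : connect (link th2 th) f g -> connect (link th2 th1) f g.
Proof.
apply: (repair_connect (@th2K V) K0 (@th2F V) F0 hf).
rewrite e03; apply/negP => H.
have : th0 l3 \in on eR.
  apply: porbit_closed H; last by rewrite -topredE /= onR0.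
  move=> z; rewrite -!topredE /= => zo.
  by rewrite permM (union_R thR SL dis) ?(on_corner (sheet_corners SR)) on2.
by rewrite -topredE /= onR0; apply/negP/dis.
Qed.

Let L1 : linked_at e th1.
Proof.
apply: union_linked SL SR dis _ (cornerK C1) mono _ => f g fo go E.
have Ev : tl f = v.
  have := eLE fo; have := eRE go; rewrite -/(tl g) -/(tl f) -E.
  case/or3P=> [/(class_C P)|/(class_D P)|/eqP //]; by case=> -> ->.
exists l0, (th0 k3); rewrite onR0 tl0 Ev; split=> //.
by apply: connect1; rewrite /link /th1 (repair_h K0 F0 hf) eqxx orbT.
Qed.

Let nax : ~~ e a x.
Proof.
rewrite /e negb_or; apply/andP; split.
  by apply/negP => /eLE; have [-> -> _ _] := class_C P aC.
apply/negP; rewrite (sheet_sym SR) => /eRE; have [_ _ -> ->] := x_class P.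
by rewrite eq_sym (negbTE (part_vx P)).
Qed.

Let ax : a != x. Proof. by rewrite eq_sym. Qed.
Let f2 := th0 k1.
Let g2 := th0 l1.
Let f2o : on e f2. Proof. by apply: Re; rewrite onR0. Qed.
Let g2o : on e g2. Proof. by apply: Le; rewrite onL0. Qed.
Let f2a : tl f2 = a. Proof. by rewrite tl0. Qed.
Let g2x : tl g2 = x. Proof. by rewrite tl0. Qed.
Let thalf := insert_half th1 a x f2 false.
Let th' := insert th1 a x f2 g2 false true.
Let es := union_sym SL SR.

Let neqv z : z \in B -> z != v.
Proof. by move=> zB; have [_ vB _ _] := v_class P; apply: contraFneq vB => <-. Qed.
Let neqa z : z \in B -> z != a.
Proof. by move=> zB; have [_ aB _ _] := class_C P aC; apply: contraFneq aB => <-. Qed.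
Let b'B : b' \in B.
Proof.
have [_ _] := onL; case/orP=> /andP[] //; have [_ xB _ _] := x_class P.
by rewrite xB.
Qed.

Let half_out' z : tl z != a -> thalf z = th1 z.
Proof. exact: (half_out x C1 false f2a). Qed.

Let vx' : x != v. Proof. by rewrite eq_sym (part_vx P). Qed.
Let y0D : y0 \in D. Proof. by apply: (subsetP SD); case: RS. Qed.
Let nxa s : ~~ on e (x, a, s). Proof. by rewrite /on /= es. Qed.
Let K1 := half_K a x C1 f2 false.
Let F1 := half_F a x C1 f2 false.
Let hf1 := insert_hf nax false f2o.

(** From [l2] the merged face runs through [l3], [k0] and [k1], then along the half-inserted edge
    from [a]. Its loose end thus arrives in the corner at [x] where it is to be inserted, and the
    insertion splits the face. *)
Let split_orbit : ((x, a, true) : flag V) \in porbit (th0 * thalf)%g (th1 g2).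
Proof.
have [y0A _ y0C _] := class_D P y0D.
have y0v : y0 != v by apply: contraFneq y0A => ->; apply: part_v P.
have y0a : y0 != a by apply: contraFneq y0C => ->.
have E0 : th1 g2 = l2 by rewrite th1_out ?g2x.
have E1 : thalf (th0 l2) = l3 by rewrite half_out' ?th1_out ?tl0 ?neqa ?neqv.
have E2 : thalf (th0 l3) = k0.
  by rewrite half_out' ?tl0 // -e03 /th1 (repair_bh K0 F0 hf).
have E3 : thalf (th0 k0) = k1 by rewrite half_out' ?th1_out ?tl0.
have E4 : thalf (th0 k1) = (a, x, false) by rewrite /thalf /insert_half (repair_f (cornerF C1) hf1).
have E5 : thalf (th0 (a, x, false)) = (x, a, true).
  rewrite th0E /turn_edge /= (negbTE ax) half_out' // th1_out //.
  by rewrite (corner_out C0) ?nxa // th2E.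
apply/porbitP; exists 5; rewrite E0 !permXSr expg0 perm1 !(permM th0 thalf).
by rewrite E1 E2 E3 E4 E5.
Qed.

Local Notation e' := (add_edge e a x).

(** The union has at least half as many faces as edges. Merging at [v] loses at most one face and
    the edge xa gains one back. *)
Let even_faces : irreflexive e ->
  #|[pred d : V * V | e' d.1 d.2]| <= 2 * fcard (th0 * th')%g (on e') + 2.
Proof.
move=> ei; have c0 := union_porbits SL SR dis ei.
have c1 := repair_porbits_ge (@th0K V) K0 hf hf'.
have c2 := insert_split es C1 ax nax f2o g2o f2a g2x split_orbit.
have c3 := porbits_darts (add_edge_sym a x es) (add_edge_irr ei ax)
  (insert_corners C1 nax false true f2o g2o f2a g2x).
have c4 := card_add_edge es ax nax.
rewrite -/th1 -c2 in c1; move: c0 c1 c3 c4; rewrite -/th'.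
move: (fcard _ _) #|porbits _| #|porbits _| (#|V| * _) #|[pred d : V * V | _]| #|[pred d : V * V | _]|.
clear; lia.
Qed.

Let agree f : on eL f -> f \notin corner_flags v b x b' s0 s1 s2 s3 -> th' f = thL f.
Proof.
move=> fo; rewrite !inE !negb_or => /and4P[f0 f3 f1 f'2].
have nR h : on eR h -> f != h by move=> ho; apply: (union_neq dis).
have nO h : ~~ on e h -> f != h by move=> ho; apply: contraNneq ho => <-; apply: Le.
have th0l3 : th0 l3 = (v, b', s3).
  by rewrite th0E /turn_edge /= (negbTE (neqv b'B)) addbF.
have xb : b != x by have [_ + _ _] := onL; apply: contraTneq => ->; rewrite /biclique; have [-> -> _ _] := x_class P.
have th0l1 : g2 = (x, b, s1) by rewrite /g2 th0E /turn_edge /= (negbTE xb) addbF.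
have E1 : th1 g2 = l2 by rewrite th1_out ?g2x.
have E2 : thalf (x, a, true) = th2 (x, a, true).
  by rewrite half_out' // th1_out // (corner_out C0) ?nxa.
have a1 : th' f = thalf f.
  rewrite /th' /insert (repair_out K1) //.
  - by rewrite -/g2 th0l1.
  - by rewrite -/thalf half_out' ?g2x // E1.
  - exact: nO.
  by apply: nO; rewrite -/thalf E2 on2.
have a2 : thalf f = th1 f.
  rewrite /thalf /insert_half (repair_out (cornerK C1)) //.
  - by apply: nR; rewrite onR0.
  - have -> : th1 f2 = k2 by rewrite th1_out ?d12 // f2a eq_sym.
    exact: nR.
  - exact: nO.
  by apply: nO; rewrite (corner_out C1) ?on2.
rewrite a1 a2 -(union_L SL SR dis) // /th1 (repair_out K0) //.
- by apply: nR; rewrite onR0.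
- by rewrite d30; apply: nR.
by rewrite e03 th0l3.
Qed.

(** The colourings of the blocks are normalised to agree at [l0] and [k0]; then the exchange at [v]
    and both ends of xa pair flags of opposite colours. *)
Let even_coloring : (exists col, flips_on eL thL col) -> (exists col, flips_on eR thR col) ->
  exists col, flips_on e' th' col.
Proof.
case=> colL FL [colR FR]; have [col [F c0 c1]] := union_flips SL SR dis FL FR o0 q0.
have F1' : flips_on e th1 col.
  have on1 f : (th f \in on e) = (f \in on e) by apply: (on_corner C0).
  have H : {in on e, forall f, col (th1 f) = ~~ col f}.
    apply: repair_flips => //.
    - by move=> f /F[].
    - by rewrite -topredE /=; apply: Re; rewrite onR0.
    - by rewrite -topredE /=; apply: Le.
    have [_ _] := F _ (Re (etrans (onR0 _) q3)).
    by rewrite d30 c0 c1 => /esym/negbFE ->.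
  by move=> f fo; have [H0 H2 _] := F f fo; split=> //; apply: H.
have cf2 : col f2 = true.
  have [E0 _ _] := F _ (Re q0); have [_ _] := F _ (Re (etrans (onR0 _) q0)).
  have [-> _ _] := F _ (Re q1).
  by rewrite d01 E0 c1 => ->.
have cg2 : col g2 = true.
  have [E0 _ _] := F _ (Le o0); have [_ _] := F _ (Le (etrans (onL0 _) o0)).
  have [-> _ _] := F _ (Le o1).
  by rewrite e01 E0 c0 => ->.
have [col' _] := insert_flips es ax nax C1 F1' f2o g2o f2a g2x.
by rewrite cf2 cg2; exists col'.
Qed.

Lemma even_assembly (G := gadget A B C D v x S [set a] false) : irreflexive G ->
  exists th' : {perm flag V}, [/\ corners G th', linked_at G th',
    #|[pred d : V * V | G d.1 d.2]| <= 2 * fcard (th0 * th')%g (on G) + 2,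
    rigid eL thL (corner_flags v b x b' s0 s1 s2 s3) -> ~ exists col, flips_on G th' col &
    (exists col, flips_on eL thL col) -> (exists col, flips_on eR thR col) ->
    exists col, flips_on G th' col].
Proof.
rewrite /G gadget_singleton => ei'.
have sub f : on e f -> on e' f by rewrite /on /add_edge /= => ->.
have ei : irreflexive e.
  by move=> z; apply: contraFF (ei' z) => ez; apply: (sub (z, z, true)).
exists th'; split.
- exact: insert_corners.
- exact: insert_linked.
- exact: even_faces.
- move=> R [col F]; apply: (R col) => f fo.
    by have [] := F f (sub _ (Le fo)).
  by move=> fc; have [_ _] := F f (sub _ (Le fo)); rewrite agree.
exact: even_coloring.
Qed.

End Even.

(* The left face v b x b' and the right face x v a n' are merged at v; merging the
   corners at x then splits the result. *)
Section Odd.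
Variables (V : finType) (A B C D : {set V}) (v x : V) (p q : nat).
Hypothesis P : parts A B C D v x p q.
Variables (thL : {perm flag V}) (b b' : V) (s0 s1 s2 s3 : bool).
Hypothesis SL : sheet (biclique A B) thL.
Hypothesis QL : quad_face thL (v, b, s0) (b, x, s1) (x, b', s2) (b', v, s3).
Variables (thR : {perm flag V}) (S : {set V}) (a n' : V) (t0 t1 t2 t3 : bool).
Hypothesis RS : right_sheet D (v |: C) x v S a n' t0 t1 t2 t3 thR.
Local Notation th0 := (swap_vertex V).
Local Notation th2 := (swap_side V).
Local Notation eL := (biclique A B).
Local Notation eR := (star_rel D (v |: C) x S).
Local Notation e := (union_rel eL eR).
Local Notation th := (union_th thL thR).
Let l0 : flag V := (v, b, s0).
Let l1 : flag V := (b, x, s1).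
Let l2 : flag V := (x, b', s2).
Let l3 : flag V := (b', v, s3).
Let k0 : flag V := (x, v, t0).
Let k1 : flag V := (v, a, t1).
Let k2 : flag V := (a, n', t2).
Let k3 : flag V := (n', x, t3).

Let SC : S \subset v |: C. Proof. by case: RS. Qed.
Let SR : sheet eR thR. Proof. by case: RS. Qed.
Let QR : quad_face thR k0 k1 k2 k3. Proof. by case: RS. Qed.
Let aD : a \in D. Proof. by case: RS => _ _ []. Qed.
Let n'C : n' \in C.
Proof.
case: RS => _ _ [_ /(subsetP SC) + n'v] _ _.
by rewrite !inE (negbTE n'v).
Qed.

Lemma odd_disjoint u w : eL u w -> ~~ eR u w.
Proof.
have [vA vB vC vD] := v_class P.
have nS z : z \in B -> (z \in S) = false /\ (z \in v |: C) = false.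
  move=> zB; have zC : (z \in v |: C) = false.
    rewrite !inE; have [_ _ -> _] := class_B P zB; rewrite orbF.
    by apply: contraTF zB => /eqP ->; rewrite vB.
  by split=> //; apply: contraFF zC; apply/subsetP.
have xB : (x \in B) = false by have [] := x_class P.
rewrite /star_rel /star_half; case/orP=> /andP[].
  move=> uA wB; have [_ _ _ uD] := class_A P uA; have [_ _ _ wD] := class_B P wB.
  have [-> ->] := nS _ wB; rewrite uD wD !andbF /= ?orbF.
  by apply/negP => /andP[/eqP E]; rewrite E xB in wB.
move=> uB wA; have [_ _ _ wD] := class_A P wA; have [_ _ _ uD] := class_B P uB.
have [-> ->] := nS _ uB; rewrite uD wD !andbF /= ?orbF.
by apply/negP => /andP[/eqP E]; rewrite E xB in uB.
Qed.
Local Notation dis := odd_disjoint.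

Let eLE u w : eL u w -> (u \in A) || (u \in B).
Proof. by case/orP=> /andP[->]; rewrite ?orbT. Qed.

Let eRE u w : eR u w -> [|| u \in C, u \in D, u == v | u == x].
Proof.
have H z : z \in v |: C -> [|| z \in C, z \in D, z == v | z == x].
  by rewrite !inE => /orP[]->; rewrite ?orbT.
rewrite /star_rel /star_half.
case/orP=> [/orP[]|/orP[]] /andP[H1 H2]; rewrite ?H1 ?H2 ?orbT //; apply: H => //.
exact: (subsetP SC).
Qed.

Let onL : [/\ eL v b, eL b x, eL x b' & eL b' v].
Proof. exact: quad_on SL (part_vx P) QL. Qed.

Let va : v != a.
Proof. by have [_ _ _ vD] := v_class P; apply: contraFneq vD => ->. Qed.

Let xa : x != a.
Proof. by have [_ _ _ xD] := x_class P; apply: contraFneq xD => ->. Qed.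

Let onR : [/\ eR x v, eR v a, eR a n' & eR n' x].
Proof. exact: quad_on SR xa QR. Qed.

Let o0 : on eL l0. Proof. by case: onL. Qed.
Let o1 : on eL l1. Proof. by case: onL. Qed.
Let o2 : on eL l2. Proof. by case: onL. Qed.
Let o3 : on eL l3. Proof. by case: onL. Qed.
Let q0 : on eR k0. Proof. by case: onR. Qed.
Let q1 : on eR k1. Proof. by case: onR. Qed.
Let q2 : on eR k2. Proof. by case: onR. Qed.
Let q3 : on eR k3. Proof. by case: onR. Qed.

Let Le f : on eL f -> on e f. Proof. by rewrite union_on => ->. Qed.
Let Re f : on eR f -> on e f. Proof. by rewrite union_on orbC => ->. Qed.
Let C0 := union_corners SL SR dis.
Let K0 := cornerK C0.
Let F0 := cornerF C0.
Let onL0 f : on eL (th0 f) = on eL f. Proof. exact: on0 (sheet_sym SL) f. Qed.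
Let onR0 f : on eR (th0 f) = on eR f. Proof. exact: on0 (sheet_sym SR) f. Qed.
Let onL0' l : on eL l -> on eL (th0 l). Proof. by rewrite onL0. Qed.
Let onR0' l : on eR l -> on eR (th0 l). Proof. by rewrite onR0. Qed.

Let rL l l' : on eL l -> (th0 * thL)%g l = l' -> th (th0 l) = l'.
Proof. by move=> lo <-; rewrite (union_L SL SR dis) ?permM ?onL0. Qed.
Let rR l l' : on eR l -> (th0 * thR)%g l = l' -> th (th0 l) = l'.
Proof. by move=> lo <-; rewrite (union_R thR SL dis) ?permM ?onR0. Qed.

Let e01 : th (th0 l0) = l1. Proof. by case: QL => H _ _ _; apply: rL. Qed.
Let e12 : th (th0 l1) = l2. Proof. by case: QL => _ H _ _; apply: rL. Qed.
Let e23 : th (th0 l2) = l3. Proof. by case: QL => _ _ H _; apply: rL. Qed.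
Let e30 : th (th0 l3) = l0. Proof. by case: QL => _ _ _ H; apply: rL. Qed.
Let d01 : th (th0 k0) = k1. Proof. by case: QR => H _ _ _; apply: rR. Qed.
Let d12 : th (th0 k1) = k2. Proof. by case: QR => _ H _ _; apply: rR. Qed.
Let d23 : th (th0 k2) = k3. Proof. by case: QR => _ _ H _; apply: rR. Qed.
Let d30 : th (th0 k3) = k0. Proof. by case: QR => _ _ _ H; apply: rR. Qed.
Let d10 : th k1 = th0 k0. Proof. by rewrite -d01 K0. Qed.
Let d03 : th k0 = th0 k3. Proof. by rewrite -d30 K0. Qed.

Let RL f g : on eR f -> on eL g -> f != g.
Proof. by move=> fo go; rewrite eq_sym; apply: (union_neq dis). Qed.

Let th1 := repair th (th0 l3) k1.
Let hf : k1 != th0 l3. Proof. by apply: RL; rewrite ?onL0. Qed.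
Let hf' : k1 != th (th0 l3). Proof. by rewrite e30; apply: RL. Qed.

Let C1 : corners e th1.
Proof.
apply: (repair_corners C0) hf hf'; first by rewrite tl0.
  exact/Le/onL0'.
exact: Re.
Qed.
Let K1 := cornerK C1.
Let F1 := cornerF C1.

Let th1_out z : tl z != v -> th1 z = th z.
Proof.
move=> zv; have H f : tl f = v -> z != f by move=> fv; apply: contraNneq zv => ->; rewrite fv.
by rewrite /th1 (repair_out K0) // ?H ?e30 ?d10 ?tl0.
Qed.

Let th' := repair th1 (th0 l1) k0.
Let xv : x != v. Proof. by rewrite eq_sym (part_vx P). Qed.
Let E12 : th1 (th0 l1) = l2. Proof. by rewrite th1_out ?tl0. Qed.
Let D03 : th1 k0 = th0 k3. Proof. by rewrite th1_out. Qed.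
Let kf : k0 != th0 l1. Proof. by apply: RL; rewrite ?onL0. Qed.
Let kf' : k0 != th1 (th0 l1). Proof. by rewrite E12; apply: RL. Qed.

Let C' : corners e th'.
Proof.
apply: (repair_corners C1) kf kf'; first by rewrite tl0.
  exact/Le/onL0'.
exact: Re.
Qed.

Let mono1 f g : connect (link th2 th) f g -> connect (link th2 th1) f g.
Proof.
apply: (repair_connect (@th2K V) K0 (@th2F V) F0 hf).
rewrite d10; apply/negP => H.
have : th0 k0 \in on eL.
  apply: porbit_closed H; last exact: onL0'.
  move=> z; rewrite -!topredE /= => zo.
  by rewrite permM (union_L SL SR dis) ?(on_corner (sheet_corners SL)) on2.
by move=> /dis/negP; apply; apply: onR0'.
Qed.

Let mono2 f g : connect (link th2 th1) f g -> connect (link th2 th') f g.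
Proof.
apply: (repair_connect (@th2K V) K1 (@th2F V) F1 kf).
rewrite D03; apply/negP => H.
have : th0 k3 \in [pred z | on eL z & tl z == x].
  apply: porbit_closed H; last by rewrite inE onL0' //= tl0.
  move=> z /andP[zo /eqP zx]; rewrite permM th1_out ?tl2 ?zx // inE.
  by rewrite (union_L SL SR dis) ?(on_corner (sheet_corners SL)) ?(corner_tl (sheet_corners SL)) on2 ?tl2 ?zo ?zx /=.
by case/andP=> /dis/negP H' _; apply: H'; apply: onR0'.
Qed.

Let L' : linked_at e th'.
Proof.
have Sy : connect_sym (link th2 th') by apply: sym_connect_sym; apply: link_sym; [exact: th2K|exact: (cornerK C')].
apply: union_linked SL SR dis _ (cornerK C') _ _ => [f g /mono1/mono2 //|f g fo go E].
have [Ev|Ex] : tl f = v \/ tl f = x.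
  have := eLE fo; have := eRE go; rewrite -/(tl g) -/(tl f) -E.
  case/or4P=> [/(class_C P)|/(class_D P)|/eqP Ev _|/eqP Ex _]; try by case=> -> ->.
    by left.
  by right.
  exists (th0 l3), k1; rewrite onL0 tl0 Ev; split=> //; apply: mono2.
  by apply: connect1; rewrite /link /th1 (repair_f F0 hf) eqxx orbT.
exists (th0 l1), k0; rewrite onL0 tl0 Ex; split=> //.
by apply: connect1; rewrite /link /th' (repair_f F1 kf) eqxx orbT.
Qed.

Let neqB z z' : z \in B -> z' \notin B -> z != z'.
Proof. by move=> zB; apply: contraNneq => <-. Qed.
Let b'B : b' \in B.
Proof.
have [_ _] := onL; case/orP=> /andP[] //; have [_ xB _ _] := x_class P.
by rewrite xB.
Qed.

(** From [l2] the merged face runs through [l3], [k1], [k2], [k3] to [k0], so the second exchange,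
    at [x], acts within one face and cuts it. *)
Let split_orbit : k0 \in porbit (th0 * th1)%g (th1 (th0 l1)).
Proof.
have [_ vB vC _] := v_class P; have [_ xB _ _] := x_class P.
have E1 : th1 (th0 l2) = l3 by rewrite th1_out ?tl0 ?neqB ?vB.
have E2 : th1 (th0 l3) = k1 by rewrite /th1 (repair_f F0 hf).
have E3 : th1 (th0 k1) = k2 by rewrite th1_out ?tl0 // eq_sym.
have E4 : th1 (th0 k2) = k3.
  by rewrite th1_out ?tl0 //; apply: contraFneq vC => <-.
have E5 : th1 (th0 k3) = k0 by rewrite th1_out ?tl0.
apply/porbitP; exists 5; rewrite E12 !permXSr expg0 perm1 !(permM th0 th1).
by rewrite E1 E2 E3 E4 E5.
Qed.

Let odd_faces : irreflexive e ->
  #|[pred d : V * V | e d.1 d.2]| <= 2 * fcard (th0 * th')%g (on e).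
Proof.
move=> ei; have c0 := union_porbits SL SR dis ei.
have c1 := repair_porbits_ge (@th0K V) K0 hf hf'.
have c2 := repair_split (@th0K V) K1 (@th0F V) F1 kf kf' split_orbit.
have c3 := porbits_darts (union_sym SL SR) ei C'.
move: c0 c1 c2 c3; rewrite -/th1 -/th'.
move: (fcard _ _) #|porbits _| #|porbits _| #|porbits _| (#|V| * _) #|[pred d : V * V | _]|.
clear; lia.
Qed.

Let agree f : on eL f -> f \notin corner_flags v b x b' s0 s1 s2 s3 -> th' f = thL f.
Proof.
move=> fo; rewrite !inE !negb_or => /and4P[f0 f3 f1 f'2].
have nR h : on eR h -> f != h by move=> ho; apply: (union_neq dis).
have [_ vB _ _] := v_class P; have [_ xB _ _] := x_class P.
have b'v : b' != v by rewrite neqB ?vB.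
have th0l3 : th0 l3 = (v, b', s3) by rewrite th0E /turn_edge /= (negbTE b'v) addbF.
have xb : b != x by have [_ + _ _] := onL; apply: contraTneq => ->; rewrite /biclique; have [-> -> _ _] := x_class P.
have th0l1 : th0 l1 = (x, b, s1) by rewrite th0E /turn_edge /= (negbTE xb) addbF.
rewrite /th' (repair_out K1) ?E12 ?D03 ?th0l1 //; try by apply: nR; rewrite ?onR0.
rewrite -(union_L SL SR dis) // /th1 (repair_out K0) ?e30 ?d10 ?th0l3 //.
  exact: nR.
exact/nR/onR0'.
Qed.

Lemma odd_assembly (G := gadget A B C D v x D (S :\ v) true) : irreflexive G ->
  exists th' : {perm flag V}, [/\ corners G th', linked_at G th',
    #|[pred d : V * V | G d.1 d.2]| <= 2 * fcard (th0 * th')%g (on G) &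
    rigid eL thL (corner_flags v b x b' s0 s1 s2 s3) -> ~ exists col, flips_on G th' col].
Proof.
have vS : v \in S by case: RS.
rewrite /G gadget_full // => ei; exists th'; split.
- exact: C'.
- exact: L'.
- exact: odd_faces.
move=> R [col F]; apply: (R col) => f fo; first by have [] := F f (Le fo).
by move=> fc; have [_ _] := F f (Le fo); rewrite agree.
Qed.

End Odd.

(** * Genus *)

Definition critical_of_order (n : nat) (G : sgraph) :=
  [/\ two_connected G, factor_critical G, equimatchable G & #|G| = n].

Section Counting.
Variables (V : finType) (A B C D : {set V}) (v x : V) (p q : nat).
Hypothesis P : parts A B C D v x p q.
Variables (S T : {set V}) (z : bool).
Hypotheses (SD : S \subset D) (TC : T \subset C) (Sn0 : S != set0) (Tn0 : T != set0).
Hypotheses (p0 : 0 < p) (q1 : 1 < q).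
Local Notation e := (gadget A B C D v x S T z).
Variables (es : symmetric e) (ei : irreflexive e).
Let G := SGraph es ei.
Let m := p * p.+1 + q * q + #|S| + #|T| + z.

Lemma gadget_order : critical_of_order (2 * p + 2 * q + 1) G.
Proof.
split.
- exact: (gadget_two_connected P z SD TC).
- exact: (@gadget_factor_critical _ _ _ _ _ _ _ _ _ P _ _ z SD TC Sn0 Tn0).
- exact: (@gadget_equimatchable _ _ _ _ _ _ _ _ _ P _ _ z SD TC).
exact: (card_gadget P z SD TC).
Qed.

Lemma gadget_edges : #|edges G| = m.
Proof.
apply/eqP; rewrite -(eqn_pmul2l (isT : 0 < 2)) card_edges.
by rewrite (card_gadget_darts P z SD TC).
Qed.

Let vx_adj : e v x = z.
Proof.
have [_ vB vC _] := v_class P; have [_ xB _ xD] := x_class P.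
have vT : v \in T = false by apply: contraFF vC; apply/subsetP.
have xS : x \in S = false by apply: contraFF xD; apply/subsetP.
rewrite /gadget /half_gadget vB vC vT xB xD xS !eqxx (negbTE (part_vx P)) eq_sym (negbTE (part_vx P)).
have [_ _ xC _] := x_class P.
by rewrite xC !andbF /= !andbT !orbF.
Qed.

Lemma gadget_fcard (E : embedding G) : fcard (face_step E) predT <= m + z.
Proof.
rewrite -gadget_edges -[X in _ <= _ + nat_of_bool X]vx_adj.
exact: (fcard_face_step E (gadget_deg2 P SD TC Sn0 Tn0 p0 q1) (gadget_triangles P SD TC)).
Qed.

(** A face is two orbits. The hypothesis holds without the edge vx, or for even [m]; the triangles
    through vx then do not raise the bound. *)
Lemma gadget_nfaces (E : embedding G) : (m + z)./2 = m./2 -> nfaces E <= m./2.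
Proof.
move=> <-; rewrite /nfaces geq_max half_leq ?gadget_fcard // andbT half_gt0 /m.
by clear -p0; case: p p0 => // k _; rewrite mulSn; lia.
Qed.

(** The bound on [fcard] says that at most the rounding is lost, so the embedding attains Euler's
    bound of [m./2] faces. *)
Lemma gadget_embedding (th : {perm flag V}) : corners e th -> linked_at e th ->
  m <= fcard (swap_vertex V * th)%g (on e) + odd m -> (m + z)./2 = m./2 ->
  exists E : embedding G, nfaces E = m./2 /\
    (orientable E <-> exists col, flips_on e th col).
Proof.
move=> Cth Lth le mz; have [E [cE oE]] := @embedding_of_flags G th Cth Lth.
exists E; split=> //; apply/eqP; rewrite eqn_leq gadget_nfaces //= /nfaces cE leq_max.
by apply/orP; right; move: le; clear; rewrite /=; set F := fcard _ _; lia.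
Qed.

Lemma gadget_nonorientable_genus (th : {perm flag V}) h : corners e th -> linked_at e th ->
  m <= fcard (swap_vertex V * th)%g (on e) + odd m -> (m + z)./2 = m./2 ->
  ~ (exists col, flips_on e th col) -> 0 < h -> 2 * p + 2 * q + 1 + m./2 + h = 2 + m ->
  has_nonorientable_genus G h.
Proof.
move=> Cth Lth le mz nc h0 Eh.
have conn : connected_graph G := gadget_connected P z SD TC Sn0 Tn0 p0 q1.
have cG : #|G| = 2 * p + 2 * q + 1 := card_gadget P z SD TC.
have [E [nE oE]] := gadget_embedding Cth Lth le mz.
split.
  split=> //; exists E; rewrite eqn0Ngt h0 /euler_char nE gadget_edges cG; split; first by move/oE.
  by move: Eh; clear; lia.
move=> k [_ [E' [_]]]; rewrite /euler_char gadget_edges cG.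
by have := gadget_nfaces E' mz; move: Eh; clear; lia.
Qed.

(** The 3 instead of Euler's 2 is a matter of parity: [2 * k] and [2 * g] are even. *)
Lemma gadget_orientable_ge g k : embeds_orientable G k -> (m + z)./2 = m./2 ->
  2 * p + 2 * q + 1 + m./2 + 2 * g <= 3 + m -> g <= k.
Proof.
have cG : #|G| = 2 * p + 2 * q + 1 := card_gadget P z SD TC.
case=> _ [E [_]]; rewrite /euler_char gadget_edges cG => Ek mz Eg.
by have := gadget_nfaces E mz; move: Ek Eg; clear; lia.
Qed.

Lemma gadget_embeds_orientable (th : {perm flag V}) k : corners e th -> linked_at e th ->
  m <= fcard (swap_vertex V * th)%g (on e) + odd m -> (m + z)./2 = m./2 ->
  (exists col, flips_on e th col) -> 2 * p + 2 * q + 1 + m./2 + 2 * k = 2 + m ->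
  embeds_orientable G k.
Proof.
move=> Cth Lth le mz nc Eh.
have conn : connected_graph G := gadget_connected P z SD TC Sn0 Tn0 p0 q1.
have cG : #|G| = 2 * p + 2 * q + 1 := card_gadget P z SD TC.
have [E [nE oE]] := gadget_embedding Cth Lth le mz.
split=> //; exists E; rewrite /euler_char nE gadget_edges cG; split; first by apply/oE.
by move: Eh; clear; lia.
Qed.

End Counting.

Lemma four_parts p q : exists (V : finType) (A B C D : {set V}),
  [/\ #|A| = p.+1, #|B| = p, [disjoint A & B] &
  forall v x, v \in A -> x \in A -> v != x -> parts A B C D v x p q].
Proof.
pose V : finType := (('I_p.+1 + 'I_p) + ('I_q + 'I_q))%type.
pose A : {set V} := [set inl (inl i) | i : 'I_p.+1].
pose B : {set V} := [set inl (inr i) | i : 'I_p].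
pose C : {set V} := [set inr (inl i) | i : 'I_q].
pose D : {set V} := [set inr (inr i) | i : 'I_q].
have dis (U W : {set V}) : (forall u, u \in U -> u \notin W) -> [disjoint U & W].
  by move=> H; rewrite disjoint_subset; apply/subsetP => u /H; rewrite inE.
have cAB : [disjoint A & B] by apply: dis => _ /imsetP[i _ ->]; apply/imsetP => -[].
have cA : #|A| = p.+1 by rewrite card_imset ?card_ord // => i j [].
have cB : #|B| = p by rewrite card_imset ?card_ord // => i j [].
exists V, A, B, C, D; split=> // v x vA xA vx; split=> //.
- by case=> [[i|i]|[i|i]]; rewrite imset_f ?orbT.
- by apply: dis => _ /imsetP[i _ ->]; apply/imsetP => -[].
- by apply: dis => _ /imsetP[i _ ->]; apply/imsetP => -[].
- by apply: dis => _ /imsetP[i _ ->]; apply/imsetP => -[].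
- by apply: dis => _ /imsetP[i _ ->]; apply/imsetP => -[].
- by apply: dis => _ /imsetP[i _ ->]; apply/imsetP => -[].
- by rewrite card_imset ?card_ord // => i j [].
by rewrite card_imset ?card_ord // => i j [].
Qed.

(** Here q = 2w, #|S| = 2i, #|T| = 1 and vx is absent, so the number of edges is odd; the equation
    for [h] is Euler's formula. *)
Lemma even_nonorientable p w i h : 2 < p -> 0 < i -> i <= w ->
  2 * h = p.-1 * p.-2 + 4 * (w.-1 * w.-1) + 2 * i.-1 ->
  exists G, critical_of_order (2 * p + 4 * w + 1) G /\ has_nonorientable_genus G h.
Proof.
move=> p2 i0 iw Eh; have w0 : 0 < w := leq_trans i0 iw.
have p0 : 0 < p by apply: leq_trans p2.
have [V [A [B [C [D [cA cB dAB PP]]]]]] := four_parts p (2 * w).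
have [v [x [b [b' [s0 [s1 [s2 [s3 [thL [[vA xA vx] SL QL RL]]]]]]]]]] := left_nonorientable dAB cA cB p2.
have P := PP v x vA xA vx.
have [_ _ vC vD] := v_class P.
have [y0 y0D] : exists y, y \in D.
  by apply/card_gt0P; rewrite (card_D P) muln_gt0.
have C1 : 1 < #|C| by rewrite (card_C P); clear -w0; lia.
have [S [a [n' [t0 [t1 [t2 [t3 [thR [cS RS]]]]]]]]] :=
  right_nonorientable (part_CD P) (negbT vC) (negbT vD) C1 (card_D P) w0 y0D i0 iw.
have SD : S \subset D by case: RS.
have aC : [set a] \subset C by rewrite sub1set; case: RS => _ _ [].
have ei := gadget_irr P false SD aC.
have Sn0 : S != set0 by rewrite -card_gt0 cS; clear -i0; lia.
have Tn0 : [set a] != set0 by rewrite -card_gt0 cards1.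
have q1 : 1 < 2 * w by clear -w0; lia.
have [th [Ct Lt le nf _]] := even_assembly P SL QL RS ei.
exists (SGraph (gadget_sym A B C D v x S [set a] false) ei); split.
  have := gadget_order P SD aC Sn0 Tn0 p0 q1 (gadget_sym A B C D v x S [set a] false) ei.
  by rewrite mulnA.
have om : odd (p * p.+1 + 2 * w * (2 * w) + #|S| + #|[set a]| + false).
  by rewrite cards1 cS addn0 !oddD !oddM /= andbN ?addbF; case: (odd i).
apply: (gadget_nonorientable_genus P SD aC Sn0 Tn0 p0 q1 _ _ Ct Lt).
- move: le; rewrite (card_gadget_darts P false SD aC) om.
  by move: (fcard _ _) (_ + _ + false) => F m; clear; lia.
- by rewrite addn0.
- exact: nf.
- have : 0 < p.-1 * p.-2 by rewrite muln_gt0; clear -p2; lia.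
  by move: Eh; move: (p.-1 * _) (w.-1 * _) => a1 a2; clear; lia.
rewrite cards1 cS; move: Eh; clear -p2 w0 i0; case: p p2 => [|[|p]] // _.
case: w w0 => // w _; case: i i0 => // i _; rewrite !succnK.
have -> : p.+1 * p = p * p + p by rewrite mulSn addnC.
have -> : p.+2 * p.+3 = p * p + 5 * p + 6 by clear; lia.
have -> : 2 * w.+1 * (2 * w.+1) = 4 * (w * w) + 8 * w + 4 by clear; lia.
by move: (p * p) (w * w) => a1 a2; clear; lia.
Qed.

(** Here q = 2w - 1, S = D, #|T| = 2i - 1 and vx is present, so the number of edges is even. *)
Lemma odd_nonorientable p w i h : 2 < p -> 1 < w -> 0 < i -> i <= w ->
  2 * h = p.-1 * p.-2 + 2 * w.-1 * (2 * w.-1).-1 + 2 * i.-1 ->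
  exists G, critical_of_order (2 * p + 4 * w - 1) G /\ has_nonorientable_genus G h.
Proof.
move=> p2 w1 i0 iw Eh; have w0 : 0 < w := leq_trans i0 iw.
have p0 : 0 < p by apply: leq_trans p2.
have [V [A [B [C [D [cA cB dAB PP]]]]]] := four_parts p (2 * w).-1.
have [v [x [b [b' [s0 [s1 [s2 [s3 [thL [[vA xA vx] SL QL RL]]]]]]]]]] := left_nonorientable dAB cA cB p2.
have P := PP v x vA xA vx.
have [_ _ vC vD] := v_class P; have [_ _ xC xD] := x_class P.
have vY : v \in v |: C by rewrite setU11.
have xY : x \notin v |: C by rewrite !inE xC orbF eq_sym.
have dis : [disjoint D & v |: C].
  rewrite disjoints_subset; apply/subsetP => u uD; have [uA _ uC _] := class_D P uD.
  by rewrite !inE uC orbF; apply: contraFneq uA => ->.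
have cY : #|v |: C| = 2 * w by rewrite cardsU1 vC (card_C P) /= add1n prednK // muln_gt0.
have D1 : 1 < #|D| by rewrite (card_D P); clear -w1; lia.
have [S [a [n' [t0 [t1 [t2 [t3 [thR [cS RS]]]]]]]]] :=
  right_nonorientable dis (negbT xD) xY D1 cY w0 vY i0 iw.
have [SC vS] : S \subset v |: C /\ v \in S by case: RS.
have TC : S :\ v \subset C.
  by apply/subsetP => u /setD1P[uv /(subsetP SC)]; rewrite !inE (negbTE uv).
have cT : #|S :\ v| = (2 * i).-1 by rewrite -cS (cardsD1 v S) vS.
have DD := subxx D.
have ei := gadget_irr P true DD TC.
have Sn0 : D != set0 by rewrite -card_gt0 ltnW.
have Tn0 : S :\ v != set0 by rewrite -card_gt0 cT; clear -i0; lia.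
have q1 : 1 < (2 * w).-1 by clear -w1; lia.
have [th [Ct Lt le nf]] := odd_assembly P SL QL RS ei.
exists (SGraph (gadget_sym A B C D v x D (S :\ v) true) ei); split.
  have := gadget_order P DD TC Sn0 Tn0 p0 q1 (gadget_sym A B C D v x D (S :\ v) true) ei.
  by rewrite (_ : 2 * p + 2 * (2 * w).-1 + 1 = 2 * p + 4 * w - 1) //; clear -w0; lia.
have om : odd (p * p.+1 + (2 * w).-1 * (2 * w).-1 + #|D| + #|S :\ v| + true) = false.
  have ow : odd (2 * w).-1 by clear -w0; lia.
  have oi : odd (2 * i).-1 by clear -i0; lia.
  by rewrite (card_D P) cT !oddD [odd (p * _)]oddM [odd (_.-1 * _)]oddM ow oi /= andbN.
apply: (gadget_nonorientable_genus P DD TC Sn0 Tn0 p0 q1 _ _ Ct Lt).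
- move: le; rewrite (card_gadget_darts P true DD TC) om.
  by move: (fcard _ _) (_ + _ + true) => F m; clear; lia.
- by move: om; move: (_ + _ + true) => m; clear; lia.
- exact: nf.
- have : 0 < p.-1 * p.-2 by rewrite muln_gt0; clear -p2; lia.
  by move: Eh; move: (p.-1 * _) (2 * w.-1 * _) => a1 a2; clear; lia.
rewrite (card_D P) cT; move: Eh; clear -p2 w1 i0; case: p p2  => [|[|p]] // _.
case: w w1 => [|[|w]] // _; case: i i0 => // i _; rewrite -[p.+2.-1]/p.+1 -[p.+2.-2]/p -[w.+2.-1]/w.+1 -[i.+1.-1]/i.
have -> : p.+1 * p = p * p + p by rewrite mulSn addnC.
have -> : p.+2 * p.+3 = p * p + 5 * p + 6 by clear; lia.
have -> : (2 * w.+2).-1 * (2 * w.+2).-1 = 4 * (w * w) + 12 * w + 9.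
  by rewrite (_ : (2 * w.+2).-1 = 2 * w + 3); clear; nia.
have -> : 2 * w.+1 * (2 * w.+1).-1 = 4 * (w * w) + 6 * w + 2.
  by rewrite (_ : (2 * w.+1).-1 = 2 * w + 1); clear; nia.
by move: (p * p) (w * w) => a1 a2; clear; lia.
Qed.

Section Enlarge.
Variables (V : finType) (A B C D : {set V}) (v x : V) (S T : {set V}) (z : bool).

Lemma gadget_add_S d : gadget A B C D v x (d |: S) T z = add_edge (gadget A B C D v x S T z) v d.
Proof.
apply: functional_extensionality => u; apply: functional_extensionality => w.
rewrite /gadget /half_gadget /add_edge /= !inE; btauto.
Qed.

Lemma gadget_add_T c : gadget A B C D v x S (c |: T) z = add_edge (gadget A B C D v x S T z) x c.
Proof.
apply: functional_extensionality => u; apply: functional_extensionality => w.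
rewrite /gadget /half_gadget /add_edge /= !inE; btauto.
Qed.

End Enlarge.

(** The lower limit is the genus of the embedding with #|S| = 2 and #|T| = 1; the upper one is
    Euler's bound for S = D and T = C. *)
Lemma orientable_gadget p w g : (p %% 4 == 1) || (p %% 4 == 2) -> 0 < w ->
  p.-1 * p.-2 + 4 * (w.-1 * w.-1) <= 4 * g <= p.-1 * p.-2 + 4 * (w * w.-1) ->
  exists G, critical_of_order (2 * p + 4 * w + 1) G /\ has_orientable_genus G g.
Proof.
move=> p4 w0 /andP[g1 g2].
have p0 : 0 < p by clear -p4; lia.
have [V [A [B [C [D [cA cB dAB PP]]]]]] := four_parts p (2 * w).
have [v [x [b [b' [s0 [s1 [s2 [s3 [thL [[vA xA vx] SL QL colL]]]]]]]]]] := left_orientable dAB cA cB p4.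
have P := PP v x vA xA vx.
have [_ _ vC vD] := v_class P; have [_ _ xC xD] := x_class P.
have [y0 y0D] : exists y, y \in D.
  by apply/card_gt0P; rewrite (card_D P) muln_gt0.
have [c0 c0C] : exists c, c \in C.
  by apply/card_gt0P; rewrite (card_C P) muln_gt0.
have C1 : 1 < #|C| by rewrite (card_C P); clear -w0; lia.
have oC : ~~ odd #|C| by rewrite (card_C P) oddM.
have [S [a [n' [t0 [t1 [t2 [t3 [thR [cS RS colR]]]]]]]]] :=
  right_orientable (part_CD P) (negbT vC) (negbT vD) C1 (card_D P) w0 y0D oC.
have SD : S \subset D by case: RS.
have aC : [set a] \subset C by rewrite sub1set; case: RS => _ _ [].
have ei := gadget_irr P false SD aC.
have es := gadget_sym A B C D v x S [set a] false.
have Sn0 : S != set0 by rewrite -card_gt0 cS.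
have Tn0 : [set a] != set0 by rewrite -card_gt0 cards1.
have q1 : 1 < 2 * w by clear -w0; lia.
have [th [Ct Lt le _ col]] := even_assembly P SL QL RS ei.
have {}col := col colL colR.
have om : odd (p * p.+1 + 2 * w * (2 * w) + #|S| + #|[set a]| + false).
  by rewrite cards1 cS addn0 !oddD !oddM /= andbN.
have p4' : p.-1 * p.-2 = 4 * (p.-1 * p.-2 %/ 4).
  case/orP: p4 => /eqP p4; rewrite [RHS]mulnC divnK //.
    by apply: dvdn_mulr; clear -p4; lia.
  by apply: dvdn_mull; clear -p4; lia.
pose k := p.-1 * p.-2 %/ 4 + w.-1 * w.-1.
(* The two blocks have genera (p-1)(p-2)/4 and (w-1)^2, and joining them adds no handle. *)
have emb : embeds_orientable (SGraph es ei) k.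
  apply: (gadget_embeds_orientable P SD aC Sn0 Tn0 p0 q1 _ _ Ct Lt).
  - move: le; rewrite (card_gadget_darts P false SD aC) om.
    by move: (fcard _ _) (_ + _ + false) => F m; clear; lia.
  - by rewrite addn0.
  - exact: col.
  rewrite cards1 cS /k; move: p4'; move: (_ %/ 4) => d; clear -p0 w0.
  case: w w0 => // w _; case: p p0 => [|[|p]] // _ p4.
    have -> : d = 0 by clear -p4; lia.
    have -> : 2 * w.+1 * (2 * w.+1) = 4 * (w * w) + 8 * w + 4 by clear; lia.
    by rewrite -[w.+1.-1]/w; move: (w * w) => a1; clear; lia.
  have -> : p.+2 * p.+3 = 4 * d + 4 * p + 6.
    by rewrite -p4 -[p.+2.-1]/p.+1 -[p.+2.-2]/p; clear; lia.
  have -> : 2 * w.+1 * (2 * w.+1) = 4 * (w * w) + 8 * w + 4 by clear; lia.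
  by rewrite -[w.+1.-1]/w; move: (w * w) => a1; clear; lia.
pose Q (e : rel V) := exists S T : {set V}, [/\ S \subset D, T \subset C, S != set0, T != set0 &
  e = gadget A B C D v x S T false].
have [||||e' [es' [ei' [[S' [T' [S'D T'C S'n T'n Ee]]] hg]]]] :=
  @orientable_genus_interpolation V Q g _ _ _ es ei k _ _ emb.
- move=> e es1 ei1 [S1 [T1 [S1D T1C S1n T1n Ee]]]; subst e.
  exact: (gadget_connected P false S1D T1C S1n T1n p0 q1).
- move=> e es1 ei1 [S1 [T1 [S1D T1C S1n T1n Ee]]]; subst e.
  have adjS d : d \in D -> exists z, gadget A B C D v x S1 T1 false d z.
    by move=> dD; exists c0; rewrite /gadget /half_gadget c0C dD !orbT.
  have adjT c : c \in C -> exists z, gadget A B C D v x S1 T1 false c z.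
    by move=> cC; exists y0; rewrite /gadget /half_gadget cC y0D !orbT.
  case: (boolP (D \subset S1)) => [DS|/subsetPn[d dD dS]]; last first.
    right; exists v, d; have [dA dB dC _] := class_D P dD; split.
    - by apply: contraFneq dA => <-.
    - have dv : d != v by apply: contraFneq dA => ->.
      have dx : d != x by apply: contraFneq dA => ->.
      rewrite /gadget /half_gadget dA dB dC (negbTE dS) (negbTE dv) (negbTE dx) vC (negbTE vx).
      by rewrite !andbF.
    - by have /set0Pn[s sS] := S1n; exists s; rewrite /gadget /half_gadget eqxx sS !orbT.
    - exact: adjS.
    exists (d |: S1), T1; rewrite gadget_add_S; split=> //.
      by apply/subsetP => u /setU1P[->//|/(subsetP S1D)].
    by apply/set0Pn; exists d; rewrite setU11.
  case: (boolP (C \subset T1)) => [CT|/subsetPn[c cC cT]]; last first.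
    right; exists x, c; have [cA' cB' _ cD] := class_C P cC; split.
    - by apply: contraFneq cA' => <-.
    - have cv : c != v by apply: contraFneq cA' => ->.
      have cx : c != x by apply: contraFneq cA' => ->.
      rewrite /gadget /half_gadget cA' cB' cD (negbTE cT) (negbTE cv) (negbTE cx) xD.
      by rewrite xC [x == v]eq_sym (negbTE vx) !andbF.
    - by have /set0Pn[s sT] := T1n; exists s; rewrite /gadget /half_gadget eqxx sT !orbT.
    - exact: adjT.
    exists S1, (c |: T1); rewrite gadget_add_T; split=> //.
      by apply/subsetP => u /setU1P[->//|/(subsetP T1C)].
    by apply/set0Pn; exists c; rewrite setU11.
  left=> m em; apply: (gadget_orientable_ge P S1D T1C S1n T1n p0 q1 em); first by rewrite addn0.
  have -> : #|S1| = 2 * w by rewrite -(card_D P); apply/eqP; rewrite eqn_leq !subset_leq_card.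
  have -> : #|T1| = 2 * w by rewrite -(card_C P); apply/eqP; rewrite eqn_leq !subset_leq_card.
  move: g2; rewrite p4'; move: p4'; move: (_ %/ 4) => d; clear -p0 w0.
  case: w w0 => // w _; case: p p0 => [|[|p]] // _ p4.
    have -> : d = 0 by clear -p4; lia.
    have -> : 2 * w.+1 * (2 * w.+1) = 4 * (w * w) + 8 * w + 4 by clear; lia.
    by rewrite -[w.+1.-1]/w [w.+1 * w]mulSn; move: (w * w) => a1; clear; lia.
  have -> : p.+2 * p.+3 = 4 * d + 4 * p + 6.
    by rewrite -p4 -[p.+2.-1]/p.+1 -[p.+2.-2]/p; clear; lia.
  have -> : 2 * w.+1 * (2 * w.+1) = 4 * (w * w) + 8 * w + 4 by clear; lia.
  by rewrite -[w.+1.-1]/w [w.+1 * w]mulSn; move: (w * w) => a1; clear; lia.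
- by exists S, [set a].
- by rewrite -(leq_pmul2l (isT : 0 < 4)) /k mulnDr -p4'.
exists (SGraph es' ei'); split=> //; subst e'.
have := gadget_order P S'D T'C S'n T'n p0 q1 es' ei'.
by rewrite mulnA.
Qed.

(** * Covering all genera *)

Lemma sqrt_bound k r n : k < r * r -> 4 * r + 1 <= n -> 4 * Nat.sqrt k + 5 <= n.
Proof.
move=> /ltP/PeanoNat.Nat.sqrt_lt_square/ltP kr; apply: leq_trans.
by move: kr; move: (Nat.sqrt k) => s; clear; lia.
Qed.

(** The shifts [p.+2], [w.+1] remove the predecessors. [r] exceeds the square root, and the last
    hypothesis says that [4 * r + 1] is at most the order. *)
Lemma orientable_at p w r g : (p.+2 %% 4 == 1) || (p.+2 %% 4 == 2) ->
  p.+1 * p + 4 * (w * w) <= 4 * g -> 4 * g <= p.+1 * p + 4 * (w.+1 * w) ->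
  2 * g < r * r -> 2 * r <= p + 2 * w + 4 ->
  exists G, [/\ two_connected G, factor_critical G, equimatchable G,
    has_orientable_genus G g & 4 * Nat.sqrt (2 * g) + 5 <= #|G|].
Proof.
move=> p4 g1 g2 gr rp; have [|G [[tc fc em cG] hg]] := @orientable_gadget p.+2 w.+1 g p4 isT.
  by rewrite g1 g2.
by exists G; split=> //; apply: (sqrt_bound gr); rewrite cG; clear -rp; lia.
Qed.

(* The genus intervals of the nine pairs (p.+2, w.+1) below leave no gap. *)
Lemma orientable_graph g :
  exists G, [/\ two_connected G, factor_critical G, equimatchable G,
    has_orientable_genus G g & 4 * Nat.sqrt (2 * g) + 5 <= #|G|].
Proof.
have [g4|g4] := ltnP g 4.
  case: g g4 => [|[|[|[|]]]] // _.
  - by apply: (@orientable_at 0 0 2).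
  - by apply: (@orientable_at 0 1 3).
  - by apply: (@orientable_at 0 1 3).
  by apply: (@orientable_at 3 0 3).
(* The lower limit is the least genus for p = 4t + 5, w = 2t + 2; the upper limit is the same
   expression at t + 1. *)
have [t g1 g2] : exists2 t, 8 * (t * t) + 11 * t + 4 <= g & g < 8 * (t * t) + 27 * t + 23.
  elim: g g4 => // g IH; rewrite ltnS leq_eqVlt => /orP[/eqP<-|/IH[t g1 g2]]; first by exists 0.
  have [H|H] := ltnP g.+1 (8 * (t * t) + 27 * t + 23); first by exists t => //; apply: ltnW.
  by exists t.+1; clear -H g2; lia.
have [H|H0] := leqP g (8 * (t * t) + 13 * t + 5).
  by apply: (@orientable_at (4 * t + 3) (2 * t + 1) (4 * t + 4)); clear -H g1; lia.
have [H|H1] := leqP g (8 * (t * t) + 15 * t + 7).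
  by apply: (@orientable_at (4 * t + 4) (2 * t + 1) (4 * t + 5)); clear -H H0; lia.
have [H|H2] := leqP g (8 * (t * t) + 17 * t + 9).
  by apply: (@orientable_at (4 * t + 3) (2 * t + 2) (4 * t + 5)); clear -H H1; lia.
have [H|H3] := leqP g (8 * (t * t) + 19 * t + 11).
  by apply: (@orientable_at (4 * t + 4) (2 * t + 2) (4 * t + 6)); clear -H H2; lia.
have [H|H4] := leqP g (8 * (t * t) + 21 * t + 13).
  by apply: (@orientable_at (4 * t + 3) (2 * t + 3) (4 * t + 6)); clear -H H3; lia.
have [H|H5] := leqP g (8 * (t * t) + 23 * t + 17).
  by apply: (@orientable_at (4 * t + 4) (2 * t + 3) (4 * t + 7)); clear -H H4; lia.
have [H|H6] := leqP g (8 * (t * t) + 25 * t + 20).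
  by apply: (@orientable_at (4 * t + 7) (2 * t + 2) (4 * t + 7)); clear -H H5; lia.
(* The previous interval ends at 8t^2 + 25t + 20 and the last one starts at 8t^2 + 25t + 22, so a
   separate pair serves the single value between them. *)
have [H|H7] := leqP g (8 * (t * t) + 25 * t + 21).
  by apply: (@orientable_at (4 * t + 3) (2 * t + 4) (4 * t + 7)); clear -H H6; lia.
by apply: (@orientable_at (4 * t + 8) (2 * t + 2) (4 * t + 8)); clear -g2 H7; lia.
Qed.

(** The two families meet at [c]: for this pair, [even_nonorientable] reaches the genera from [c] to
    [c + w], and [odd_nonorientable] those from [c - w] to [c]. *)
Lemma nonorientable_at p w r h : 0 < p -> 0 < w ->
  p.+1 * p + 4 * (w * w) <= 2 * h + 2 * w -> 2 * h <= p.+1 * p + 4 * (w * w) + 2 * w ->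
  h < r * r -> 2 * r <= p + 2 * w + 3 ->
  exists G, [/\ two_connected G, factor_critical G, equimatchable G,
    has_nonorientable_genus G h & 4 * Nat.sqrt h + 5 <= #|G|].
Proof.
move=> p0 w0 h1 h2 hr rp.
have ev : ~~ odd (p.+1 * p) by rewrite oddM /= andNb.
pose c := (p.+1 * p)./2 + 2 * (w * w).
have cE : 2 * c = p.+1 * p + 4 * (w * w) by move: ev; rewrite /c; move: (p.+1 * p) (w * w); clear; lia.
have [hc|hc] := leqP c h.
  have [||G [[tc fc em cG] hg]] := @even_nonorientable p.+2 w.+1 (h - c).+1 h p0 isT.
  - by move: cE h2 hc; move: (p.+1 * p) (w * w); clear; lia.
  - by rewrite -[p.+2.-1]/p.+1 -[p.+2.-2]/p -[w.+1.-1]/w -cE -mulnDr subnKC.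
  by exists G; split=> //; apply: (sqrt_bound hr); rewrite cG; clear -rp; lia.
have [||||G [[tc fc em cG] hg]] := @odd_nonorientable p.+2 w.+1 (w.+1 + h - c) h p0.
- by [].
- by move: cE h1; move: (p.+1 * p) (w * w); clear; lia.
- by clear -hc; lia.
- rewrite -[p.+2.-1]/p.+1 -[p.+2.-2]/p -[w.+1.-1]/w.
  have -> : 2 * w * (2 * w).-1 = 4 * (w * w) - 2 * w by case: w w0 {h1 h2 rp c cE hc} => // w _; clear; lia.
  have : w <= w * w by apply: leq_pmulr.
  by move: cE h1 hc; move: (p.+1 * p) (w * w); clear; lia.
by exists G; split=> //; apply: (sqrt_bound hr); rewrite cG; clear -rp; lia.
Qed.

Lemma nonorientable_graph h :
  exists G, [/\ two_connected G, factor_critical G, equimatchable G,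
    has_nonorientable_genus G h & 4 * Nat.sqrt h + 5 <= #|G|].
Proof.
have [h2|h2] := ltnP h 2.
  (* Genus 0 means the sphere by convention, so a planar graph serves. Genus 1 lies below the
     intervals used afterwards and comes from p = 3, w = i = 1. *)
  case: h h2 => [|[|]] // _.
    have [G [tc fc em [[conn [E [oE cE]]] _] cG]] := orientable_graph 0.
    by exists G; split=> //; split=> //; split=> //; exists E.
  have [|G [[tc fc em cG] hg]] := @even_nonorientable 3 1 1 1 isT isT isT; first by [].
  by exists G; split=> //; rewrite cG.
(* Again the upper limit is the lower one at t + 1; the lower one is [c - w] for the first pair
   below. *)
have [t h1 h3] : exists2 t, 4 * (t * t) + 6 * t + 2 <= h & h < 4 * (t * t) + 14 * t + 12.
  elim: h h2 => // h IH; rewrite ltnS leq_eqVlt => /orP[/eqP<-|/IH[t h1 h3]]; first by exists 0.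
  have [H|H] := ltnP h.+1 (4 * (t * t) + 14 * t + 12); first by exists t => //; apply: ltnW.
  by exists t.+1; clear -H h3; lia.
have [H|H0] := leqP h (4 * (t * t) + 8 * t + 4).
  by apply: (@nonorientable_at (2 * t + 1) (t + 1) (2 * t + 3)); clear -H h1; lia.
have [H|H1] := leqP h (4 * (t * t) + 10 * t + 6).
  by apply: (@nonorientable_at (2 * t + 2) (t + 1) (2 * t + 3)); clear -H H0; lia.
have [H|H2] := leqP h (4 * (t * t) + 12 * t + 9).
  by apply: (@nonorientable_at (2 * t + 3) (t + 1) (2 * t + 4)); clear -H H1; lia.
by apply: (@nonorientable_at (2 * t + 2) (t + 2) (2 * t + 4)); clear -h3 H2; lia.
Qed.

Theorem theorem10 (g h : nat) :
  exists G G' : sgraph,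
    [/\ two_connected G, factor_critical G, equimatchable G,
        has_orientable_genus G g & 4 * Nat.sqrt (2 * g) + 5 <= #|G|] /\
    [/\ two_connected G', factor_critical G', equimatchable G',
        has_nonorientable_genus G' h & 4 * Nat.sqrt h + 5 <= #|G'|].
Proof.
have [G hG] := orientable_graph g; have [G' hG'] := nonorientable_graph h.
by exists G, G'.
Qed.
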